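(* Let $M$ be a compact, connected Riemannian manifold of dimension $d\ge 1$, and let $X\in\mathfrak{X}^d(M)$. Assume that every singularity and periodic orbit of $X$ is hyperbolic, that $\Omega(X)=\overline{\mathrm{Per}(X)}$, and that the $C^d$-centralizer of $X$ is collinear. Then $X$ has trivial $C^d$-centralizer, that is, $\mathfrak{C}^d(X)=\{cX: c\in\mathbb{R}\}$.
   Context: $M$ is smooth and boundaryless. $\mathfrak{X}^d(M)$ is the space of $C^d$ vector fields on $M$, where $d=\dim M$; $X_t$ is the flow of $X$. The $C^d$-centralizer is $\mathfrak{C}^d(X)=\{Y\in\mathfrak{X}^d(M):[X,Y]=0\}$. It is collinear if for every $Y\in\mathfrak{C}^d(X)$ and $x\in M$ the span of $X(x),Y(x)$ has dimension at most $1$. $\mathrm{Per}(X)$ is the set of periodic points ($X_T(x)=x$ for some $T>0$), singularities (zeros of $X$) included. $\Omega(X)$ is the non-wandering set: $x\in\Omega(X)$ iff for every open neighborhood $\mathcal{U}$ of $x$ and every $T>0$ there is $t>T$ with $\mathcal{U}\cap X_t(\mathcal{U})\neq\emptyset$. A singularity or periodic orbit $\gamma$ is hyperbolic if there is a continuous $DX_t$-invariant splitting $T_\gamma M=E^s\oplus\langle X\rangle\oplus E^u$ and $T>0$ with $\|DX_T(x)|_{E^s_x}\|<\frac12$ and $\|DX_{-T}(x)|_{E^u_x}\|<\frac12$ for all $x\in\gamma$. *)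

(* Defs.v *)
From HB Require Import structures.
From mathcomp Require Import all_boot all_order all_algebra.
From mathcomp Require Import all_classical all_reals all_analysis.

Set Implicit Arguments.
Unset Strict Implicit.
Unset Printing Implicit Defensive.

Import Order.TTheory GRing.Theory Num.Theory.
Import numFieldNormedType.Exports.

Local Open Scope classical_set_scope.
Local Open Scope ring_scope.

(* f is of class C^k on U. Only used with U open, so that the derivatives on U
   depend only on the restriction of f to U. *)
Fixpoint Ck (R : realType) (V W : normedModType R) (k : nat) (U : set V)
    (f : V -> W) : Prop :=
  match k with
  | 0 => {within U, continuous f}
  | k'.+1 => (forall x, U x -> differentiable f x) /\
             forall v : V, Ck k' U (fun x => 'D_v f x)
  end.

(* A homeomorphism from an open subset of M onto an open subset of R^d. Both
   directions are total functions; their values off chart_dom and chart_cod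
   are irrelevant. *)
Record chart (R : realType) (d : nat) (M : topologicalType) := Chart {
  chart_dom : set M;
  chart_cod : set 'rV[R]_d;
  chart_fun :> M -> 'rV[R]_d;
  chart_inv : 'rV[R]_d -> M;
  chart_dom_open : open chart_dom;
  chart_cod_open : open chart_cod;
  chart_fun_cod : set_fun chart_dom chart_cod chart_fun;
  chart_inv_dom : set_fun chart_cod chart_dom chart_inv;
  chart_funK : {in chart_dom, cancel chart_fun chart_inv};
  chart_invK : {in chart_cod, cancel chart_inv chart_fun};
  chart_fun_continuous : {within chart_dom, continuous chart_fun};
  chart_inv_continuous : {within chart_cod, continuous chart_inv}
}.

(* Smooth manifolds without boundary, of dimension d. Each point has a
   preferred chart of the atlas: the tangent space T_x M is represented by
   'rV[R]_d, a tangent vector at x being given by its coordinates in the chart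
   chart_at x. *)
Record manifold (R : realType) (d : nat) := Manifold {
  carrier :> topologicalType;
  manifold_hausdorff : hausdorff_space carrier;
  manifold_second_countable : @second_countable carrier;
  atlas : set (chart R d carrier);
  chart_at : carrier -> chart R d carrier;
  chart_at_atlas : forall x, atlas (chart_at x);
  chart_at_dom : forall x, chart_dom (chart_at x) x;
  atlas_smooth : forall c c', atlas c -> atlas c' -> forall k,
    Ck k (chart_cod c `&` chart_inv c @^-1` chart_dom c') (c' \o chart_inv c)
}.

Section Manifold.
Context {R : realType} {d : nat} {M : manifold R d}.

Definition vector_field := M -> 'rV[R]_d.

(* The coordinates in c of the tangent vector v at x, for x in chart_dom c. *)
Definition to_chart (c : chart R d M) (x : M) (v : 'rV[R]_d) : 'rV[R]_d :=
  'd (c \o chart_inv (chart_at x)) (chart_at x x) v.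

(* The tangent vector at x whose coordinates in c are v. *)
Definition of_chart (c : chart R d M) (x : M) (v : 'rV[R]_d) : 'rV[R]_d :=
  'd (chart_at x \o chart_inv c) (c x) v.

Definition tangent_map (f : M -> M) (x : M) (v : 'rV[R]_d) : 'rV[R]_d :=
  'd (chart_at (f x) \o f \o chart_inv (chart_at x)) (chart_at x x) v.

Definition local_rep (c : chart R d M) (X : vector_field) (y : 'rV[R]_d) :=
  to_chart c (chart_inv c y) (X (chart_inv c y)).

Definition Ck_vector_field (k : nat) (X : vector_field) :=
  forall c, atlas c -> Ck k (chart_cod c) (local_rep c X).

(* DY(X) - DX(Y), computed in the preferred chart. *)
Definition lie_bracket (X Y : vector_field) : vector_field := fun x =>
  'D_(X x) (local_rep (chart_at x) Y) (chart_at x x) -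
  'D_(Y x) (local_rep (chart_at x) X) (chart_at x x).

Definition centralizer (k : nat) (X : vector_field) : set vector_field :=
  [set Y | Ck_vector_field k Y /\ forall x, lie_bracket X Y x = 0].

Definition collinear_centralizer (k : nat) (X : vector_field) :=
  forall Y, centralizer k X Y ->
    forall x, (\dim <<[:: X x; Y x]>>%VS <= 1)%N.

Definition integral_curve (X : vector_field) (c : R -> M) :=
  forall t : R, {for t, continuous c} /\
    is_derive t 1 (chart_at (c t) \o c) (X (c t)).

Definition is_flow (X : vector_field) (phi : R -> M -> M) :=
  forall x, phi 0 x = x /\ integral_curve X (phi ^~ x).

(* The global flow X_t. It exists and is unique when M is compact and X is
   C^1; the default value is only there to make the definition total. *)
Definition flow (X : vector_field) : R -> M -> M :=
  @xget (R -> M -> M) (fun _ x => x) [set phi | is_flow X phi].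

(* This contains the zeros of X, which are fixed by the flow. *)
Definition periodic_points (X : vector_field) : set M :=
  [set x | exists2 T, 0 < T & flow X T x = x].

Definition nonwandering_set (X : vector_field) : set M :=
  [set x | forall U : set M, open U -> U x -> forall T : R, 0 < T ->
    exists2 t, T < t & U `&` (flow X t @` U) !=set0].

Definition orbit_of (X : vector_field) (x : M) : set M :=
  range (fun t => flow X t x).

Definition singularity_or_periodic_orbit (X : vector_field) (gamma : set M) :=
  (exists2 p, X p = 0 & gamma = [set p]) \/
  (exists2 p, periodic_points X p & gamma = orbit_of X p).

(* riem_mx x is the Gram matrix at x in the preferred chart; smoothness is
   that of the Gram matrices in every chart of the atlas. *)
Record riemannian_metric := RiemannianMetric {
  riem_mx : M -> 'M[R]_d;
  riem_sym : forall x, (riem_mx x)^T = riem_mx x;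
  riem_pos : forall x (u : 'rV[R]_d), u != 0 ->
    0 < (u *m riem_mx x *m u^T) 0 0;
  riem_smooth : forall c, atlas c -> forall k, Ck k (chart_cod c) (fun y =>
    let J := lin1_mx (of_chart c (chart_inv c y)) in
    J *m riem_mx (chart_inv c y) *m J^T)
}.

Definition riem_norm (g : riemannian_metric) (x : M) (v : 'rV[R]_d) : R :=
  Num.sqrt ((v *m riem_mx g x *m v^T) 0 0).

(* The operator norm of the restriction to E of A : T_x M -> T_y M. *)
Definition op_norm (g : riemannian_metric) (x y : M) (E : {vspace 'rV[R]_d})
    (A : 'rV[R]_d -> 'rV[R]_d) : R :=
  sup [set riem_norm g y (A v) | v in
    [set v | v \in E /\ riem_norm g x v <= 1]].

(* E restricts to a continuous subbundle over gamma: it has a continuous frame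
   on a neighbourhood in gamma of each point of gamma. *)
Definition continuous_subbundle (gamma : set M) (E : M -> {vspace 'rV[R]_d}) :=
  forall x, gamma x -> exists (U : set M) (n : nat) (e : 'I_n -> vector_field),
    [/\ open U, U x, U `<=` chart_dom (chart_at x),
        forall y, (gamma `&` U) y -> basis_of (E y) [tuple e i y | i < n] &
        forall i, {within gamma `&` U,
          continuous (fun y => to_chart (chart_at x) y (e i y))}].

Definition flow_invariant (X : vector_field) (gamma : set M)
    (E : M -> {vspace 'rV[R]_d}) :=
  forall t x, gamma x ->
    tangent_map (flow X t) x @` [set` E x] = [set` E (flow X t x)].

Definition hyperbolic (g : riemannian_metric) (X : vector_field)
    (gamma : set M) :=
  exists Es Eu : M -> {vspace 'rV[R]_d},
  [/\ continuous_subbundle gamma Es /\ continuous_subbundle gamma Eu,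
      flow_invariant X gamma Es /\ flow_invariant X gamma Eu,
      forall x, gamma x -> (Es x + <[X x]> + Eu x = fullv)%VS /\
        directv (Es x + <[X x]> + Eu x) &
      exists2 T, 0 < T & forall x, gamma x ->
        op_norm g x (flow X T x) (Es x) (tangent_map (flow X T) x) < 2^-1 /\
        op_norm g x (flow X (- T) x) (Eu x) (tangent_map (flow X (- T)) x)
          < 2^-1].

End Manifold.

Arguments vector_field {R d} M.
Arguments riemannian_metric {R d} M.

(* Main.v *)
From HB Require Import structures.
Require Import Defs.
From mathcomp Require Import all_boot all_order all_algebra.
From mathcomp Require Import all_classical all_reals all_analysis.
From mathcomp Require Import ring lra.
Set Implicit Arguments.
Unset Strict Implicit.
Unset Printing Implicit Defensive.
Import Order.TTheory GRing.Theory Num.Theory.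
Import numFieldNormedType.Exports.
Local Open Scope classical_set_scope.
Local Open Scope ring_scope.

(** Let Y commute with X and be collinear with it. Where X does not vanish,
    Y = f X for a function f (the function quotient below), and everything
    consists in showing that f is constant.

    In coordinates f = (Y, X) / (X, X), so f is of class C^d on the regular
    part. Since [X, f X] = (df X) X, it is constant along orbits. At a zero p
    of X, hyperbolicity makes the linear part of X injective
    (hyperbolic_singularity_nondegenerate). Then the zero is isolated, Y
    vanishes there too, the linear parts of X and Y are proportional, and their
    ratio extends f continuously (quotient_continuous_singular).

    At a regular periodic point df vanishes (periodic_dform0): it is invariant
    under the flow and bounded along the orbit, so it kills the stable and
    unstable vectors, which the tangent maps of the flow contract, and it kills
    X. By continuity df vanishes at all regular points of the closure of the
    periodic points, which is the non-wandering set. Now by compactness the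
    orbit of any x accumulates at a non-wandering point y, where f y = f x
    (omega_limit). So each value of f is taken at a zero of X or at a critical
    point of f.

    Zeros are isolated, hence countable in number, and critical values form a
    null set by Sard's theorem (sard), for which the class C^d is what a
    function of d variables requires. So the range of f is null, and as M is
    connected and f is continuous, f is constant.

    Sard's theorem is proved along Morse's lines (morse_decomposition): the
    common zeros of some functions of class C^k decompose into countably many
    pieces on which they are flat to order k.

    The flow enters only through the properties collected in tame_flow. They do
    not include differentiability in space: tangent maps are zero where the
    flow is not differentiable, and then the invariant subbundles are zero as
    well, so that there is nothing to prove about them. *)

Reserved Notation "''e_' j" (at level 8, j at level 2, format "''e_' j").
Notation "''e_' j" := (delta_mx (0 : 'I_1) j) : ring_scope.

(** * Functions of class C^k *)

Section DiffBasics.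
Context {R : realType}.
Implicit Types V W : normedModType R.

Lemma differentiable_eps V W (f : V -> W) x : differentiable f x ->
  forall e, 0 < e -> \forall h \near (0 : V), `|f (h + x) - f x - 'd f x h| <= e * `|h|.
Proof.
move=> /diff_locallyP[_ /eqaddoP h] e e0; have := h e e0.
by apply: filterS => z; rewrite /= !fctE /= opprD addrA.
Qed.

Lemma is_diff_eps V W (f : V -> W) (L : {linear V -> W}) x : continuous L ->
  (forall e, 0 < e -> \forall h \near (0 : V), `|f (h + x) - f x - L h| <= e * `|h|) ->
  is_diff x f L.
Proof.
move=> cL H.
have E : f \o shift x = cst (f x) + L +o_ 0 id.
  apply/eqaddoP => e e0; have := H e e0.
  by apply: filterS => z; rewrite /= !fctE /= opprD addrA.
have dE := diff_unique cL E.
by apply: DiffDef => //; apply/diff_locallyP; split; rewrite dE.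
Qed.

Lemma near_eq_is_diff V W (f g : V -> W) x : (\forall y \near x, f y = g y) ->
  differentiable f x -> is_diff x g ('d f x).
Proof.
move=> fg df; apply: is_diff_eps; first exact: diff_continuous.
move=> e e0; have := differentiable_eps df e0.
apply: filterS2 => [h|]; last first.
  by have := fg; rewrite (near_shift 0); apply: id.
by rewrite /= !(subr0, sub0r) => <- ; rewrite (nbhs_singleton fg).
Qed.

Lemma near_eq_differentiable V W (f g : V -> W) x :
  (\forall y \near x, f y = g y) -> differentiable f x -> differentiable g x.
Proof. by move=> fg /(near_eq_is_diff fg) []. Qed.

Lemma near_eq_diff V W (f g : V -> W) x :
  (\forall y \near x, f y = g y) -> differentiable f x -> 'd g x = 'd f x :> (V -> W).
Proof. by move=> fg /(near_eq_is_diff fg) []. Qed.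

(** The differential is zero by convention where it does not exist. This is
    what lets tangent maps of the flow be used without the flow being known to
    be differentiable: where it is not, an invariant subbundle is zero. *)
Lemma diff_nondifferentiable V W (f : V -> W) x v : ~ differentiable f x -> 'd f x v = 0.
Proof.
move=> nd; suff -> : 'd f x = \0 :> {linear V -> W} by [].
rewrite /diff; case: xgetP => [df E H|_]; last by [].
by case: nd; apply/diffP; rewrite /diff -E.
Qed.

Lemma open_near V (U : set V) x : open U -> U x -> \forall y \near x, U y.
Proof. by move=> oU Ux; apply: open_nbhs_nbhs. Qed.

End DiffBasics.

Section CkBasics.
Context {R : realType}.
Implicit Types V W : normedModType R.

Lemma Ck0P V W (U : set V) (f : V -> W) : open U ->
  Ck 0 U f <-> forall x, U x -> {for x, continuous f}.
Proof.
move=> oU /=; rewrite (continuous_open_subspace _ oU).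
by split=> H x => [/mem_set/H//|/set_mem/H].
Qed.

Lemma Ck_eq V W k (U : set V) (f g : V -> W) : open U ->
  (forall x, U x -> f x = g x) -> Ck k U f -> Ck k U g.
Proof.
move=> oU; elim: k f g => [|k IH] f g fg.
  by apply: subspace_eq_continuous => x /set_mem/fg.
have nfg x : U x -> \forall y \near x, f y = g y.
  by move=> Ux; apply: filterS (open_near oU Ux).
move=> [df dfk]; split=> [x Ux|v].
  by apply: near_eq_differentiable (df x Ux); exact: nfg.
by apply: IH (dfk v) => x Ux; apply: near_eq_derive; exact: nfg.
Qed.

Lemma CkW V W k (U : set V) (f : V -> W) : open U -> Ck k.+1 U f -> Ck k U f.
Proof.
move=> oU; elim: k f => [|k IH] f [df dfk].
  by apply/Ck0P => // x Ux; apply: differentiable_continuous; exact: df.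
by split=> // v; apply: IH.
Qed.

Lemma Ck_le V W k l (U : set V) (f : V -> W) : open U -> (k <= l)%N ->
  Ck l U f -> Ck k U f.
Proof.
move=> oU /subnK <-; elim: (l - k)%N => // n IH H; exact/IH/CkW.
Qed.

Lemma Ck_sub V W k (U U' : set V) (f : V -> W) : open U -> open U' -> U' `<=` U ->
  Ck k U f -> Ck k U' f.
Proof.
move=> oU oU' UU; elim: k f => [|k IH] f.
  by move=> /(Ck0P _ oU) H; apply/Ck0P => // x /UU; exact: H.
move=> [df dfk]; split=> [x /UU|v]; first exact: df.
exact: IH (dfk v).
Qed.

Lemma Ck_continuous V W k (U : set V) (f : V -> W) x : open U -> Ck k U f -> U x ->
  {for x, continuous f}.
Proof. by move=> oU /(Ck_le oU (leq0n k)) /(Ck0P _ oU); apply. Qed.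

Lemma Ck_cst V W k (U : set V) (c : W) : open U -> Ck k U (fun=> c).
Proof.
move=> oU; elim: k c => [|k IH] c; first by apply/Ck0P => // x _; exact: cst_continuous.
split=> [x _|v]; first exact: differentiable_cst.
by apply: Ck_eq (IH 0) => // x _; rewrite derive_cst.
Qed.

Lemma CkD V W k (U : set V) (f g : V -> W) : open U -> Ck k U f -> Ck k U g ->
  Ck k U (fun x => f x + g x).
Proof.
move=> oU; elim: k f g => [|k IH] f g.
  move=> /(Ck0P _ oU) cf /(Ck0P _ oU) cg; apply/Ck0P => // x Ux.
  by apply: continuousD; [exact: cf|exact: cg].
move=> [df dfk] [dg dgk]; split=> [x Ux|v].
  by apply: differentiableD; [exact: df|exact: dg].
apply: Ck_eq (IH _ _ (dfk v) (dgk v)) => // x Ux.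
by rewrite (_ : (fun _ => _) = f + g)// deriveD//; apply: diff_derivable; [exact: df|exact: dg].
Qed.

Lemma Ck_sum V W k (U : set V) n (f : 'I_n -> V -> W) : open U ->
  (forall i, Ck k U (f i)) -> Ck k U (fun x => \sum_i f i x).
Proof.
move=> oU; elim: n f => [|n IH] f H.
  by apply: Ck_eq (Ck_cst k 0 oU) => // x _; rewrite big_ord0.
apply: Ck_eq (CkD oU (IH (fun i => f (widen_ord (leqnSn n) i)) _) (H ord_max)) => // x _.
by rewrite big_ord_recr.
Qed.

Lemma CkM V k (U : set V) (f g : V -> R) : open U -> Ck k U f -> Ck k U g ->
  Ck k U (fun x => f x * g x).
Proof.
move=> oU; elim: k f g => [|k IH] f g.
  move=> /(Ck0P _ oU) cf /(Ck0P _ oU) cg; apply/Ck0P => // x Ux.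
  by apply: continuousM; [exact: cf|exact: cg].
move=> F G; have [df dfk] := F; have [dg dgk] := G; split=> [x Ux|v].
  by apply: differentiableM; [exact: df|exact: dg].
apply: Ck_eq (CkD oU (IH _ _ (CkW oU F) (dgk v)) (IH _ _ (CkW oU G) (dfk v))) => // x Ux.
by rewrite (_ : (fun _ => _) = f * g)// deriveM//; apply: diff_derivable; [exact: df|exact: dg].
Qed.

Lemma CkZ V W k (U : set V) (c : R) (f : V -> W) : open U -> Ck k U f ->
  Ck k U (fun x => c *: f x).
Proof.
move=> oU; elim: k f => [|k IH] f.
  move=> /(Ck0P _ oU) cf; apply/Ck0P => // x Ux.
  by apply: continuousZr; exact: cf.
move=> [df dfk]; split=> [x Ux|v].
  by apply: differentiableZ; exact: df.
apply: Ck_eq (IH _ (dfk v)) => // x Ux.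
by rewrite (_ : (fun _ => _) = c *: f)// deriveZ//; apply: diff_derivable; exact: df.
Qed.

Lemma CkZl V W k (U : set V) (f : V -> R) (w : W) : open U -> Ck k U f ->
  Ck k U (fun x => f x *: w).
Proof.
move=> oU; elim: k f => [|k IH] f.
  move=> /(Ck0P _ oU) cf; apply/(Ck0P _ oU) => x Ux.
  by apply: cvgZr_tmp; exact: cf.
move=> [df dfk]; split=> [x Ux|v].
  by apply: differentiableZl; exact: df.
apply: (Ck_eq oU _ (IH _ (dfk v))) => x Ux.
have dfx := df x Ux.
by rewrite [RHS]deriveE ?diffZl//= ?deriveE//; exact: differentiableZl.
Qed.

Lemma CkN V W k (U : set V) (f : V -> W) : open U -> Ck k U f ->
  Ck k U (fun x => - f x).
Proof. by move=> oU /(CkZ (-1) oU); apply: Ck_eq => // x _; rewrite scaleN1r. Qed.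

Lemma CkB V W k (U : set V) (f g : V -> W) : open U -> Ck k U f -> Ck k U g ->
  Ck k U (fun x => f x - g x).
Proof. by move=> oU F G; apply: CkD => //; exact: CkN. Qed.

Lemma Ck_id V k (U : set V) : open U -> Ck k U (fun x : V => x).
Proof.
move=> oU; case: k => [|k]; first by apply/(Ck0P _ oU) => x _; exact: cvg_id.
split=> [x _|v]; first exact: (@ex_diff _ _ _ _ _ id).
by apply: (Ck_eq oU _ (Ck_cst k v oU)) => x _; rewrite derive_id.
Qed.

Lemma CkV V k (U : set V) (f : V -> R) : open U -> (forall x, U x -> f x != 0) ->
  Ck k U f -> Ck k U (fun x => (f x)^-1).
Proof.
move=> oU f0; elim: k => [|k IH].
  move=> /(Ck0P _ oU) cf; apply/Ck0P => // x Ux.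
  by apply: continuousV; [exact: f0|exact: cf].
move=> F; have [df dfk] := F; split=> [x Ux|v].
  by apply: differentiableV; [exact: df|exact: f0].
have I := IH (CkW oU F).
have J : Ck k U (fun x => (-1) *: ((f x)^-1 * (f x)^-1 * 'D_v f x) : R).
  by apply: CkZ => //; apply: CkM => //; [exact: CkM|exact: dfk].
apply: Ck_eq J => // x Ux.
rewrite deriveV//; [|exact: f0|by apply: diff_derivable; exact: df].
by rewrite -exprVn expr2 scaleN1r scaleNr.
Qed.

End CkBasics.

Section RowVectors.
Context {R : realType}.
Implicit Types (V : normedModType R) (n m : nat).

Lemma coordB n (x y : 'rV[R]_n) j : (x - y) 0 j = x 0 j - y 0 j.
Proof. by rewrite !mxE. Qed.

Lemma ler_coord n (x : 'rV[R]_n) j : `|x 0 j| <= `|x|.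
Proof. by rewrite [leRHS]/Num.Def.normr/= mx_normrE; exact: (le_bigmax _ _ (0, j)). Qed.

Lemma rV_norm_le n (x : 'rV[R]_n) e : 0 <= e -> (forall j, `|x 0 j| <= e) -> `|x| <= e.
Proof.
move=> e0 H; rewrite [leLHS]/Num.Def.normr/= mx_normrE; apply: bigmax_le => // -[i j] _ /=.
by rewrite ord1.
Qed.

Lemma rV_norm_lt n (x : 'rV[R]_n) e : 0 < e -> (forall j, `|x 0 j| < e) -> `|x| < e.
Proof.
move=> e0 H; rewrite [ltLHS]/Num.Def.normr/= mx_normrE; apply: bigmax_lt => // -[i j] _ /=.
by rewrite ord1.
Qed.

Lemma norm_delta_le1 n (j : 'I_n) : `|'e_j : 'rV[R]_n| <= 1.
Proof. by apply: rV_norm_le => // i; rewrite mxE; case: andb; rewrite ?normr1 ?normr0. Qed.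

Lemma differentiable_comp_coord V n (phi : V -> 'rV[R]_n) x j :
  differentiable phi x -> differentiable (fun y => phi y 0 j) x.
Proof.
move=> d; apply: (@differentiable_comp _ _ _ _ phi (fun N : 'rV[R]_n => N 0 j)) => //.
exact: differentiable_coord.
Qed.

Lemma diff_coord V n (phi : V -> 'rV[R]_n) x j v :
  differentiable phi x -> 'd (fun y => phi y 0 j) x v = ('d phi x v) 0 j.
Proof.
move=> d; rewrite -deriveE; last exact: differentiable_comp_coord.
rewrite -deriveE// derive_mx ?mxE//; exact: diff_derivable.
Qed.

Lemma derive_coord V n (phi : V -> 'rV[R]_n) x j v :
  differentiable phi x -> 'D_v (fun y => phi y 0 j) x = ('D_v phi x) 0 j.
Proof.
move=> d; rewrite deriveE; last exact: differentiable_comp_coord.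
by rewrite diff_coord// deriveE.
Qed.

Lemma differentiable_rV V n (phi : V -> 'rV[R]_n) x :
  (forall j, differentiable (fun y => phi y 0 j) x) -> differentiable phi x.
Proof.
move=> H; have -> : phi = \sum_j (fun y => phi y 0 j *: 'e_j).
  by rewrite funeqE => y; rewrite fct_sumE {1}(row_sum_delta (phi y)).
by apply: differentiable_sum => j; exact: differentiableZl.
Qed.

Lemma diff_partial n (W : normedModType R) (f : 'rV[R]_n -> W) x v : differentiable f x ->
  'd f x v = \sum_j v 0 j *: 'D_('e_j) f x.
Proof.
move=> d; rewrite {1}(row_sum_delta v) linear_sum; apply: eq_bigr => j _.
by rewrite linearZ -deriveE.
Qed.

Lemma Ck_comp_coord V n k (U : set V) (phi : V -> 'rV[R]_n) j : open U ->
  Ck k U phi -> Ck k U (fun x => phi x 0 j).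
Proof.
move=> oU; elim: k phi => [|k IH] phi.
  move=> /(Ck0P _ oU) c; apply/Ck0P => // x Ux.
  apply: (@continuous_comp _ _ _ phi (fun N : 'rV[R]_n => N 0 j)); first exact: c.
  exact: coord_continuous.
move=> [d dk]; split=> [x Ux|v]; first by apply: differentiable_comp_coord; exact: d.
by apply: Ck_eq (IH _ (dk v)) => // x Ux; rewrite derive_coord//; exact: d.
Qed.

Lemma Ck_coord n k (U : set 'rV[R]_n) j : open U -> Ck k U (fun x => x 0 j).
Proof. by move=> oU; exact: Ck_comp_coord oU (Ck_id k oU). Qed.

(** The chain rule turns derivatives of the composite into sums of products of
    functions of the class one below. *)
Lemma Ck_comp V n k (U : set V) (U' : set 'rV[R]_n) (phi : V -> 'rV[R]_n)
    (f : 'rV[R]_n -> R) : open U -> open U' -> (forall x, U x -> U' (phi x)) ->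
  Ck k U phi -> Ck k U' f -> Ck k U (f \o phi).
Proof.
move=> oU oU' UU'; elim: k f => [|k IH] f.
  move=> /(Ck0P _ oU) cp /(Ck0P _ oU') cf; apply/(Ck0P _ oU) => x Ux.
  apply: (@continuous_comp _ _ _ phi f); first exact: cp.
  by apply: cf; exact: UU'.
move=> P F; have [dp dpk] := P; have [df dfk] := F.
split=> [x Ux|v]; first by apply: differentiable_comp; [exact: dp|exact/df/UU'].
have A j : Ck k U (fun x => ('D_v phi x) 0 j).
  exact: Ck_comp_coord oU (dpk v).
have B j : Ck k U (('D_('e_j) f) \o phi).
  exact: IH (CkW oU P) (dfk _).
have S := Ck_sum oU (fun j => CkM oU (A j) (B j)).
apply: Ck_eq S => // x Ux.
have dpx := dp x Ux; have dfx : differentiable f (phi x) by exact/df/UU'.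
rewrite [RHS]deriveE; last exact: differentiable_comp.
rewrite diff_comp// [RHS]/= diff_partial//.
by apply: eq_bigr => j _; rewrite deriveE.
Qed.

End RowVectors.

Section MeanValue.
Context {R : realType}.
Implicit Types (V : normedModType R) (n m : nat).

Lemma line_is_derive V (W : normedModType R) (f : V -> W) (a v : V) (t : R) :
  differentiable f (a + t *: v) ->
  is_derive t 1 (fun s => f (a + s *: v)) ('d f (a + t *: v) v).
Proof.
move=> d.
have dl : is_diff t (fun s : R => a + s *: v) (fun s => s *: v).
  by apply: is_diff_eq; rewrite funeqE => s /=; rewrite !fctE add0r.
have dc : differentiable (f \o (fun s : R => a + s *: v)) t.
  by apply: differentiable_comp => //; exact: ex_diff.
apply: DeriveDef; first exact: diff_derivable.
rewrite -[fun s => _]/(f \o (fun s : R => a + s *: v)) (deriveE _ dc).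
have dl' := @ex_diff _ _ _ _ _ _ _ dl.
by rewrite (@diff_comp _ _ _ _ (fun s : R => a + s *: v) f _ dl' d) /= diff_val scale1r.
Qed.

Lemma mean_value V (f : V -> R) (a b : V) :
  (forall t : R, 0 <= t <= 1 -> differentiable f (a + t *: (b - a))) ->
  exists2 t : R, 0 <= t <= 1 & f b - f a = 'd f (a + t *: (b - a)) (b - a).
Proof.
move=> H.
pose g (s : R) := f (a + s *: (b - a)).
have dg (t : R) : 0 <= t <= 1 -> is_derive t 1 g ('d f (a + t *: (b - a)) (b - a)).
  by move=> /H; exact: line_is_derive.
have [|||t t01 E] := @MVT_segment _ g (fun t => 'd f (a + t *: (b - a)) (b - a)) 0 1.
- exact: ler01.
- by move=> x; rewrite in_itv/= => /andP[/ltW x0 /ltW x1]; apply: dg; rewrite x0.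
- apply: continuous_in_subspaceT => x; rewrite inE/= in_itv/= => /dg dx.
  by apply/differentiable_continuous/derivable1_diffP; exact: ex_derive.
by exists t => //; move: E; rewrite subr0 mulr1 /g scale0r addr0 scale1r [a + _]addrC subrK.
Qed.

Lemma ball_segment V (c a b : V) r t : 0 <= t <= 1 ->
  ball c r a -> ball c r b -> ball c r (a + t *: (b - a)).
Proof.
move=> /andP[t0 t1]; rewrite -!ball_normE /= => ha hb.
have -> : c - (a + t *: (b - a)) = (1 - t) *: (c - a) + t *: (c - b).
  rewrite opprD addrA scalerBl scale1r -[RHS]addrA; congr (_ + _).
  by rewrite -!scalerN -scalerDr !opprB addrA subrK.
apply: (le_lt_trans (ler_normD _ _)); rewrite !normrZ (ger0_norm t0) ger0_norm ?subr_ge0//.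
case: (ltgtP t 1) t1 => // [t1 _|-> _]; last by rewrite subrr mul0r mul1r add0r.
rewrite (_ : r = (1 - t) * r + t * r); last by rewrite -mulrDl subrK mul1r.
by rewrite ltr_leD// ?ler_wpM2l ?ltr_pM2l ?subr_gt0// ltW.
Qed.

Lemma diff_norm_le n (f : 'rV[R]_n -> R) x v : differentiable f x ->
  `|'d f x v| <= (\sum_j `|'D_('e_j) f x|) * `|v|.
Proof.
move=> d; rewrite diff_partial// mulr_suml (le_trans (ler_norm_sum _ _ _))//.
by apply: ler_sum => j _; rewrite normrZ mulrC ler_wpM2l// ler_coord.
Qed.

End MeanValue.

(** * Projection onto the zero set of a function *)

Section ImplicitProjection.
Context {R : realType}.

Lemma near_ex_ball (V : normedModType R) (x : V) (P : V -> Prop) :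
  (\forall y \near x, P y) -> exists2 r : R, 0 < r & forall y, ball x r y -> P y.
Proof. by move=> /nbhs_ballP[r r0 H]; exists r. Qed.

(** The shape of the derivative of a projection along w onto a hypersurface,
    packed as a linear map. *)
Lemma linear_minus_rank1 (V : normedModType R) (l : {linear V -> R}) (w : V) :
  continuous l -> exists2 L : {linear V -> V}, continuous L & forall v, L v = v - l v *: w.
Proof.
move=> cl; pose Lf (v : V) := v - l v *: w.
have Llin : linear Lf.
  by move=> t u v; rewrite /Lf linearP scalerDl opprD addrACA scalerBr scalerA.
pose LfM := GRing.isLinear.Build _ _ _ _ _ Llin.
pose L : {linear V -> V} := HB.pack Lf LfM.
exists L => // x.
by apply: (@continuousB _ _ _ (fun v => v) (fun v => l v *: w)); [exact: cvg_id|apply: cvgZr_tmp; exact: cl].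
Qed.

Lemma Ck1_partials_bounded n (U : set 'rV[R]_n) (g : 'rV[R]_n -> R) a : open U -> Ck 1 U g -> U a ->
  exists2 K : R, 0 < K & \forall y \near a, \sum_j `|'D_('e_j) g y| <= K.
Proof.
move=> oU [_ dgk] Ua.
exists (1 + \sum_j `|'D_('e_j) g a|); first by rewrite ltr_wpDr// sumr_ge0.
have C : {for a, continuous (fun y => \sum_j `|'D_('e_j) g y|)}.
  apply: (@Ck_continuous _ _ _ 0%N U) => //; apply: Ck_sum => // j.
  apply/(Ck0P _ oU) => x Ux; apply: (@continuous_comp _ _ _ ('D_('e_j) g) Num.norm).
    by have /(Ck0P _ oU) := dgk 'e_j; apply.
  exact: norm_continuous.
have /= := cvgr_le _ C; apply; by rewrite ltrDr.
Qed.

Lemma Ck1_diff_bounded n m (U : set 'rV[R]_n) (F : 'rV[R]_n -> 'rV[R]_m) a :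
  open U -> Ck 1 U F -> U a ->
  exists2 K : R, 0 < K & \forall y \near a, forall v, `|'d F y v| <= K * `|v|.
Proof.
move=> oU F1 Ua.
have H j := Ck1_partials_bounded oU (Ck_comp_coord j oU F1) Ua.
pose K j := s2val (cid2 (H j)).
have K0 j : 0 < K j by rewrite /K; case: cid2.
exists (1 + \sum_j K j); first by rewrite ltr_pwDl// sumr_ge0// => j _; exact/ltW.
have N : \forall y \near a, forall j, \sum_i `|'D_('e_i) (fun x => F x 0 j) y| <= K j.
  have Nj j : \forall y \near a, \sum_i `|'D_('e_i) (fun x => F x 0 j) y| <= K j.
    by rewrite /K; case: cid2.
  exact: filter_forall Nj.
apply: filterS2 (open_near oU Ua) N => y Uy HK v.
apply: rV_norm_le => [|j]; first by rewrite mulr_ge0// addr_ge0// sumr_ge0// => j _; exact/ltW.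
have dF := F1.1 y Uy.
rewrite -diff_coord//; apply: (le_trans (diff_norm_le _ (differentiable_comp_coord _ dF))).
rewrite ler_wpM2r// (le_trans (HK j))// (bigD1 j)//= addrCA lerDl addr_ge0// sumr_ge0// => i _.
exact/ltW.
Qed.

Section core.
Variables (n k : nat) (U : set 'rV[R]_n) (g : 'rV[R]_n -> R) (a : 'rV[R]_n) (i : 'I_n).
Hypotheses (oU : open U) (gk : Ck k.+1 U g) (Ua : U a) (ga : g a = 0)
  (gi : 0 < 'D_('e_i) g a).

Let Cg1 : Ck 1 U g. Proof. exact: Ck_le oU _ gk. Qed.

Lemma partial_bounds_ball : exists rho c K : R, [/\ 0 < rho, 0 < c, 0 < K,
  ball a rho `<=` U & forall y, ball a rho y -> c <= 'D_('e_i) g y /\ \sum_j `|'D_('e_j) g y| <= K].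
Proof.
have [K K0 HK] := Ck1_partials_bounded oU Cg1 Ua.
have C : {for a, continuous ('D_('e_i) g)} by exact: (Ck_continuous oU (gk.2 'e_i) Ua).
have Hc : \forall y \near a, 'D_('e_i) g a / 2 <= 'D_('e_i) g y.
  by have /= := cvgr_ge _ C; apply; rewrite ltr_pdivrMr// ltr_pMr// ltr1n.
have : \forall y \near a, U y /\ 'D_('e_i) g a / 2 <= 'D_('e_i) g y /\ \sum_j `|'D_('e_j) g y| <= K.
  exact: filterI (open_near oU Ua) (filterI Hc HK).
move=> /nbhs_ballP[rho /= rho0 H].
exists rho, ('D_('e_i) g a / 2), K; split=> //; first by rewrite divr_gt0.
- by move=> y /H[].
- by move=> y /H[_].
Qed.

(** The projection phi moves a point along the i-th axis until g vanishes. The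
    zero exists by the intermediate value theorem and is unique because g is
    strictly increasing along the axis. The mean value theorem makes phi
    Lipschitz, and with this a first order expansion of g at phi y gives the
    derivative of phi. *)
Lemma implicit_projection_diff : exists r (phi : 'rV[R]_n -> 'rV[R]_n), [/\ 0 < r,
  ball a r `<=` U, forall y, ball a r y -> U (phi y) /\ g (phi y) = 0,
  forall y, ball a r y -> g y = 0 -> phi y = y &
  forall y, ball a r y -> [/\ 'D_('e_i) g (phi y) != 0, differentiable phi y &
    forall v, 'D_v phi y = v - ('D_v g (phi y) / 'D_('e_i) g (phi y)) *: 'e_i]].
Proof.
have [rho [c [K [rho0 c0 K0 BU B]]]] := partial_bounds_ball.
have dg y : ball a rho y -> differentiable g y by move=> /BU; exact: gk.1.
have bseg y z t : 0 <= t <= 1 -> ball a rho y -> ball a rho z -> ball a rho (y + t *: (z - y)).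
  exact: ball_segment.
pose r2 := rho / 2.
have r20 : 0 < r2 by rewrite divr_gt0.
have r2rho : r2 < rho by rewrite ltr_pdivrMr// ltr_pMr// ltr1n.
(* The lower bound c on the partial derivative makes g increase along e_i. *)
have mono y (s : R) : ball a rho y -> ball a rho (y + s *: 'e_i) ->
    exists2 m, c <= m & g (y + s *: 'e_i) - g y = s * m.
  move=> By Bs; have [|t t01 ->] := @mean_value _ _ g y (y + s *: 'e_i).
    by move=> t t01; apply: dg; exact: bseg.
  have Bt := bseg _ _ _ t01 By Bs; set z := y + t *: _ in Bt *.
  exists ('D_('e_i) g z); first by have [] := B z Bt.
  by rewrite addrAC subrr add0r linearZ -deriveE//; exact: dg.
(* b y is the point with i-th coordinate a_i on the line through y along e_i. *)
pose b (y : 'rV[R]_n) := y + (a 0 i - y 0 i) *: 'e_i.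
have bcoord y u j : (b y + u *: 'e_i) 0 j = (if j == i then a 0 i + u else y 0 j).
  rewrite !mxE eqxx /=; case: eqP => [->|_]; rewrite ?mulr1 ?mulr0 ?addr0//.
  by rewrite [y 0 i + _]addrC subrK.
have bball y u : ball a r2 y -> `|u| <= r2 -> ball a rho (b y + u *: 'e_i).
  rewrite -!ball_normE /= => ay ur; apply: rV_norm_lt => // j.
  rewrite coordB bcoord.
  case: eqP => [->|_]; first by rewrite opprD addNKr normrN (le_lt_trans ur).
  rewrite -coordB; apply: (le_lt_trans (ler_coord _ j)).
  exact: lt_trans ay r2rho.
have bcont u : `|u| <= r2 -> {for a, continuous (fun y => g (b y + u *: 'e_i))}.
  move=> ur; apply: (@continuous_comp _ _ _ (fun y => b y + u *: 'e_i) g); last first.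
    apply: differentiable_continuous; apply: dg; apply: bball => //; exact: ballxx.
  have oT : open [set: 'rV[R]_n] by exact: openT.
  have C := CkD oT (CkD oT (Ck_id 0 oT) (CkZl 'e_i oT (CkB oT (Ck_cst 0 (a 0 i) oT) (Ck_coord 0 i oT))))
    (Ck_cst 0 (u *: 'e_i) oT).
  exact: Ck_continuous oT C _.
have ba : b a = a by rewrite /b subrr scale0r addr0.
have aa : ball a r2 a by exact: ballxx.
have nr2 : `|r2| <= r2 by rewrite ger0_norm// ltW.
have nr2m : `|- r2| <= r2 by rewrite normrN.
have rhoa : ball a rho a by exact: ballxx.
have Pp : 0 < g (b a + r2 *: 'e_i).
  have := bball a r2 aa nr2; rewrite ba => Br.
  have [m cm] := mono a r2 rhoa Br.
  by rewrite ga subr0 => ->; rewrite mulr_gt0// (lt_le_trans c0).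
have Pm : g (b a + (- r2) *: 'e_i) < 0.
  have := bball a (- r2) aa nr2m; rewrite ba => Br.
  have [m cm] := mono a (- r2) rhoa Br.
  by rewrite ga subr0 => ->; rewrite mulNr oppr_lt0 mulr_gt0// (lt_le_trans c0).
have [r r0 Hr] : exists2 r, 0 < r & forall y, ball a r y -> [/\ ball a r2 y,
    0 < g (b y + r2 *: 'e_i) & g (b y + (- r2) *: 'e_i) < 0].
  have N1 : \forall y \near a, 0 < g (b y + r2 *: 'e_i).
    by have := cvgr_gt _ (bcont r2 nr2); apply.
  have N2 : \forall y \near a, g (b y + (- r2) *: 'e_i) < 0.
    by have := cvgr_lt _ (bcont (- r2) nr2m); apply.
  have N3 : \forall y \near a, ball a r2 y by exact: nbhsx_ballx.
  have : \forall y \near a, ball a r2 y /\ 0 < g (b y + r2 *: 'e_i) /\ g (b y + (- r2) *: 'e_i) < 0.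
    exact: filterI N3 (filterI N1 N2).
  by move=> /near_ex_ball[r r0 H]; exists r => // y /H[? []].
(* The intermediate value theorem on the segment centred at b y. *)
have ex y : exists z, ball a r y -> [/\ exists s, z = y + s *: 'e_i, ball a rho z & g z = 0].
  have [yr|nyr] := pselect (ball a r y); last by exists 0 => /nyr.
  have [yr2 gp gm] := Hr y yr.
  have [|||u] := @IVT _ (fun u : R => g (b y + u *: 'e_i)) (- r2) r2 0.
  - by rewrite ge0_cp// ltW.
  - apply: continuous_in_subspaceT => u; rewrite inE/= in_itv/= -ler_norml => ur.
    have := line_is_derive (dg _ (bball y u yr2 ur)) => H.
    by apply/differentiable_continuous/derivable1_diffP; exact: ex_derive.
  - by rewrite ge_min le_max (ltW gp) (ltW gm) orbT.
  rewrite in_itv/= -ler_norml => ur gu; exists (b y + u *: 'e_i) => _; split=> //.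
    exists (a 0 i - y 0 i + u); by rewrite scalerDl addrA.
  exact: bball.
have {ex} [phi Hphi] := choice ex.
have Br2 y : ball a r y -> ball a rho y.
  by move=> /Hr[+ _ _]; apply: le_ball; exact: ltW.
have inc y y' : ball a r y -> ball a r y' -> exists s, phi y' - phi y = (y' - y) + s *: 'e_i.
  move=> /Hphi[[s ->] _ _] /Hphi[[s' ->] _ _]; exists (s' - s).
  by rewrite scalerBl opprD addrACA.
(* K / c bounds the displacement along e_i by the displacement of y. *)
pose Lc := 1 + K / c.
have Lc0 : 0 < Lc by rewrite addr_gt0// divr_gt0.
have nse (s : R) : `|s *: ('e_i : 'rV[R]_n)| <= `|s|.
  by rewrite normrZ ler_piMr// norm_delta_le1.
have lip y y' : ball a r y -> ball a r y' -> `|phi y' - phi y| <= Lc * `|y' - y|.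
  move=> By By'; have [_ Bz gz] := Hphi y By; have [_ Bz' gz'] := Hphi y' By'.
  have [s E] := inc y y' By By'.
  have [|t t01] := @mean_value _ _ g (phi y) (phi y').
    by move=> t t01; apply: dg; exact: bseg.
  rewrite gz gz' subr0; have Bt := bseg _ _ _ t01 Bz Bz'; set x := _ + t *: _ in Bt *.
  have [Dc DK] := B x Bt; have dgx := dg x Bt.
  rewrite E linearD linearZ -(deriveE 'e_i dgx) => /esym/eqP; rewrite addrC addr_eq0 => /eqP/(congr1 Num.norm).
  rewrite normrZ normrN => H.
  have D0 : 0 < 'D_('e_i) g x by exact: lt_le_trans Dc.
  have sK : `|s| <= K / c * `|y' - y|.
    rewrite mulrAC ler_pdivlMr//; apply: (@le_trans _ _ (`|s| * `|'D_('e_i) g x|)).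
      by rewrite ler_wpM2l// ger0_norm// ltW.
    by rewrite H (le_trans (diff_norm_le _ dgx))// ler_wpM2r.
  rewrite (le_trans (ler_normD _ _))// mulrDl mul1r lerD2l.
  exact: le_trans (nse s) sK.
exists r, phi; split=> //.
- by move=> y /Br2/BU.
- by move=> y /Hphi[_ /BU ? ?].
- move=> y By gy; have [[s E] Bz gz] := Hphi y By.
  have Bs := Bz; rewrite E in Bs; have [m cm] := mono y s (Br2 _ By) Bs.
  rewrite -E gz gy subrr => /esym/eqP; rewrite mulf_eq0 => /orP[/eqP s0|/eqP m0].
    by rewrite E s0 scale0r addr0.
  by move: (lt_le_trans c0 cm); rewrite m0 ltxx.
move=> y By; have [_ Bz gz] := Hphi y By; set z := phi y in Bz gz *.
have [Dc DK] := B z Bz; have dgz := dg z Bz.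
have D0 : 0 < 'D_('e_i) g z by exact: lt_le_trans Dc.
have [L Lcont LE] := linear_minus_rank1 (('D_('e_i) g z)^-1 *: 'e_i) (diff_continuous dgz).
have id : is_diff y phi L.
  apply: is_diff_eps => // e e0.
  have e'0 : 0 < e * c / Lc by rewrite divr_gt0// mulr_gt0.
  have [eta eta0 H] := near_ex_ball (differentiable_eps dgz e'0).
  have N1 : \forall h \near (0 : 'rV[R]_n), ball a r (h + y).
    have : \forall u \near y, ball a r u by apply: open_near => //; exact: ball_open.
    by rewrite (near_shift 0) subr0.
  have N2 : \forall h \near (0 : 'rV[R]_n), Lc * `|h| < eta.
    apply/nbhs_ballP; exists (eta / Lc) => [/=|h]; first by rewrite divr_gt0.
    by rewrite -ball_normE /= sub0r normrN ltr_pdivlMr// mulrC.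
  apply: filterS2 N1 N2 => h Bh Lh.
  have [s E] := inc _ _ By Bh; rewrite addrK in E.
  have := lip _ _ By Bh; rewrite addrK => lh.
  have [_ Bz' gz'] := Hphi _ Bh.
  have := H (phi (h + y) - z); rewrite subrK gz gz' subrr sub0r normrN.
  rewrite -ball_normE /= sub0r normrN => /(_ (le_lt_trans lh Lh)) H1.
  have -> : phi (h + y) - phi y - L h = (('d g z (phi (h + y) - z)) / 'D_('e_i) g z) *: 'e_i.
    rewrite E linearD linearZ -(deriveE 'e_i dgz) LE scalerA opprB addrA addrAC [h + _]addrC addrK.
    by rewrite mulrDl scalerDl addrC mulfK// gt_eqF.
  apply: (le_trans (nse _)); rewrite normrM normfV (gtr0_norm D0) ler_pdivrMr//.
  apply: (le_trans H1); apply: (@le_trans _ _ (e * c / Lc * (Lc * `|h|))).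
    by rewrite ler_wpM2l// ltW.
  rewrite mulrA divfK ?gt_eqF// -!mulrA ler_wpM2l ?(ltW e0)// mulrC.
  by rewrite ler_wpM2l.
have dphi := @ex_diff _ _ _ _ _ _ _ id.
split=> //; first by rewrite gt_eqF.
by move=> v; rewrite (deriveE v dphi) (@diff_val _ _ _ _ _ _ _ id) LE scalerA (deriveE v dgz).
Qed.

End core.

(** The implicit function theorem in projection form: near a regular zero a of
    g, sliding points along the i-th axis retracts a ball onto the zero set.
    The formula for the derivative of phi expresses it through phi and the first
    derivatives of g, so that phi gains one class of smoothness at a time. *)
Lemma implicit_projection n k (U : set 'rV[R]_n) (g : 'rV[R]_n -> R) a i :
  open U -> Ck k.+1 U g -> U a -> g a = 0 -> 'D_('e_i) g a != 0 ->
  exists r (phi : 'rV[R]_n -> 'rV[R]_n), [/\ 0 < r,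
    forall y, ball a r y -> [/\ U y, U (phi y) & 'D_('e_i) g (phi y) != 0],
    Ck k.+1 (ball a r) phi,
    forall y, ball a r y -> g y = 0 -> phi y = y &
    forall y, ball a r y -> forall v,
      'D_v phi y = v - ('D_v g (phi y) / 'D_('e_i) g (phi y)) *: 'e_i].
Proof.
move=> oU gk Ua ga gi.
(* Dividing g by its partial derivative at a makes that derivative positive. *)
pose s := ('D_('e_i) g a)^-1.
have s0 : s != 0 by rewrite invr_eq0.
pose g' y := s * g y.
have Dg' y v : U y -> 'D_v g' y = s * 'D_v g y.
  by move=> Uy; rewrite /g' (_ : (fun _ => _) = s *: g)// deriveZ//; exact/diff_derivable/gk.1.
have g'k : Ck k.+1 U g' by exact: CkZ.
have g'a : g' a = 0 by rewrite /g' ga mulr0.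
have g'i : 0 < 'D_('e_i) g' a by rewrite Dg'// mulVf// ltr01.
have [r [phi [r0 BU P fix_ D]]] := implicit_projection_diff oU g'k Ua g'a g'i.
have oB : open (ball a r) by exact: ball_open.
have PU y : ball a r y -> U (phi y) by move=> /P[].
have Di y : ball a r y -> 'D_('e_i) g (phi y) != 0.
  by move=> By; have [+ _ _] := D y By; rewrite Dg' ?mulf_eq0; [rewrite negb_or => /andP[]|exact: PU].
have E y v : ball a r y -> 'D_v phi y = v - ('D_v g (phi y) / 'D_('e_i) g (phi y)) *: 'e_i.
  move=> By; have [_ _ ->] := D y By; rewrite !Dg'; try exact: PU.
  by rewrite invfM mulrACA mulfV// mul1r.
exists r, phi; split=> //.
- by move=> y By; split; [exact: BU|exact: PU|exact: Di].
- have H l : (l <= k.+1)%N -> Ck l (ball a r) phi.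
    elim: l => [_|l IH lk].
      by apply/(Ck0P _ oB) => y By; apply: differentiable_continuous; have [] := D y By.
    have Cphi := IH (ltnW lk).
    split=> [y By|v]; first by have [] := D y By.
    have gl w : Ck l (ball a r) ('D_w g \o phi).
      have gw : Ck k U ('D_w g) by exact: gk.2.
      exact: (Ck_comp oB oU PU Cphi (Ck_le oU (lk : (l <= k)%N) gw)).
    have C := CkB oB (Ck_cst l v oB) (CkZl 'e_i oB (CkM oB (gl v) (CkV oB Di (gl 'e_i)))).
    by apply: (Ck_eq oB _ C) => y By; rewrite E.
  exact: H.
- by move=> y By gy; apply: fix_ => //; rewrite /g' gy mulr0.
- by move=> y By v; exact: E.
Qed.

End ImplicitProjection.

(** * Morse's decomposition of a common zero set *)

Section SigmaIdeals.
Context {R : realType}.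

(** The small sets below are those with a null image under a given function.
    Only the closure properties of this family matter for decomposing a set,
    and abstracting them avoids writing the decompositions down. *)
Definition sigma_ideal T (N : set (set T)) := [/\ N set0,
  forall A B : set T, A `<=` B -> N B -> N A &
  forall F : nat -> set T, (forall i, N (F i)) -> N (\bigcup_i F i)].

Lemma sigma_ideal_restr T (N : set (set T)) (A : set T) : sigma_ideal N ->
  sigma_ideal [set B | N (B `&` A)].
Proof.
case=> N0 NS NU; split=> [|B C BC NC|F NF] /=; first by rewrite set0I.
  by apply: NS NC; exact: setSI.
by rewrite setI_bigcupl; exact: NU.
Qed.

(** Balls with rational centres and radii 1/m form a countable base of R^n. *)
Lemma sigma_ideal_local n (N : set (set 'rV[R]_n)) (A : set 'rV[R]_n) : sigma_ideal N ->
  (forall a, A a -> exists2 r : R, 0 < r & N (A `&` ball a r)) -> N A.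
Proof.
case=> N0 NS NU H.
pose B (i : 'rV[rat]_n * nat) : set 'rV[R]_n := ball (map_mx ratr i.1 : 'rV[R]_n) i.2.+1%:R^-1.
pose F k := if unpickle k is Some i then
  if pselect (N (A `&` B i)) then A `&` B i else set0 else set0.
apply: (NS _ (\bigcup_k F k)); last first.
  by apply: NU => k; rewrite /F; case: unpickle => // i; case: pselect.
move=> a Aa; have [r r0 Nr] := H a Aa.
have [m Hm] : exists m, (m.+1%:R^-1 : R) < r / 2.
  exists (Num.truncn (r / 2)^-1).
  have r20 : 0 < r / 2 by rewrite divr_gt0.
  rewrite invf_plt ?posrE//.
  by have /andP[] := truncn_itv (ltW (eqbRL (invr_gt0 _) r20)).
have [q Hq] : exists q : 'I_n -> rat, forall j, ratr (q j) \in `](a 0 j - m.+1%:R^-1), (a 0 j)[.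
  have E j : exists q : rat, ratr q \in `](a 0 j - m.+1%:R^-1), (a 0 j)[.
    by apply: rat_in_itvoo; rewrite ltrBlDr ltrDl.
  by have [q Hq] := choice E; exists q.
pose i : 'rV[rat]_n * nat := (\row_j q j, m).
have qa : ball (map_mx ratr i.1 : 'rV[R]_n) m.+1%:R^-1 a.
  rewrite -ball_normE /=; apply: rV_norm_lt => // j; rewrite coordB !mxE.
  have := Hq j; rewrite in_itv /= => /andP[h1 h2].
  by rewrite ltr0_norm ?subr_lt0// opprB ltrBlDl -ltrBlDr.
have Bi : A `&` B i `<=` A `&` ball a r.
  move=> y [Ay By]; split=> //; move: qa By; rewrite /B -!ball_normE /= => qa By.
  rewrite -(subrK (map_mx ratr i.1) a) -addrA (le_lt_trans (ler_normD _ _))//.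
  rewrite [ltRHS](splitr r) distrC ltrD//; first exact: lt_trans Hm.
  exact: lt_trans Hm.
have NB : N (A `&` B i) by exact: NS Nr.
by exists (pickle i) => //; rewrite /F pickleK; case: pselect.
Qed.

(** Heine's theorem on closed balls: vanishing of a continuous function becomes
    flatness of order zero with a uniform modulus. *)
Lemma uniform_modulus n (f : 'rV[R]_n -> R) a r :
  (forall y, `|a - y| <= r -> {for y, continuous f}) ->
  forall e, 0 < e -> exists2 del, 0 < del &
    forall y z, `|a - y| <= r -> `|a - z| <= r -> `|y - z| < del -> `|f y - f z| < e.
Proof.
move=> cf e e0; pose K := [set y : 'rV[R]_n | `|a - y| <= r].
have cK : compact K.
  apply: bounded_closed_compact.
    exists (`|a| + r); split; first exact: num_real.
    move=> M aM y Ky; apply: ltW; apply: le_lt_trans aM.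
    by rewrite -(subKr a y) (le_trans (ler_normB _ _))// lerD2l.
  have oT : open [set: 'rV[R]_n] by exact: openT.
  have C := CkB oT (Ck_cst 0 a oT) (Ck_id 0 oT).
  apply: (@closed_comp _ _ (fun y => `|a - y|) [set t | t <= r]) => [y _|]; last exact: closed_le.
  apply: (@continuous_comp _ _ _ (fun y => a - y) Num.norm); last exact: norm_continuous.
  exact: Ck_continuous oT C _.
have NC := (compact_near_coveringP K).1 cK.
have /NC : forall x, K x -> \forall x' \near x & del \near (0 : R)^'+,
    forall z, K z -> `|x' - z| < del -> `|f x' - f z| < e.
  move=> x Kx.
  have [eta eta0 H] : exists2 eta : R, 0 < eta & forall y, ball x eta y -> `|f x - f y| < e / 2.
    apply: near_ex_ball; have := @cvgr_dist_lt _ _ _ _ _ f (f x) (cf x Kx) (e / 2).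
    by apply; rewrite divr_gt0.
  exists (ball x (eta / 2), [set d | 0 < d < eta / 2]) => /=.
    split; first by apply: nbhsx_ballx; rewrite divr_gt0.
    by near=> d; apply/andP; split; near: d; [exact: nbhs_right_gt|apply: nbhs_right_lt; rewrite divr_gt0].
  move=> [x' d] /= [Bx' /andP[d0 dl]] z Kz zd.
  have Bz : ball x eta z.
    move: Bx'; rewrite -!ball_normE /= => Bx'.
    by rewrite -(subrKA x') (le_lt_trans (ler_normD _ _))// (splitr eta) ltrD// (lt_trans zd).
  have Bx : ball x eta x' by apply: le_ball Bx'; rewrite ler_pdivrMr// ler_peMr ?ler1n// ltW.
  rewrite -(subrKA (f x)) (le_lt_trans (ler_normD _ _))// (splitr e) ltrD//; last exact: H.
  by rewrite distrC; exact: H.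
move=> near0.
have [del [del0 Hd]] : exists del : R, 0 < del /\ (K `<=` (fun x' => forall z, K z -> `|x' - z| < del -> `|f x' - f z| < e)).
  have [d] := @filter_ex _ _ _ _ (filterI (nbhs_right_gt (0 : R)) near0).
  by case=> d0 Hd; exists d.
by exists del => // y z Ky Kz yz; exact: Hd.
Unshelve. all: by end_near. Qed.

End SigmaIdeals.

Section Morse.
Context {R : realType}.
Variable n : nat.
Local Notation E := 'rV[R]_n.

(** Flatness to order k at the points of A, with a uniform modulus, of the
    functions of fs precomposed with a map psi. The functions themselves need
    not be flat: psi, a composite of projections onto graphs of implicit
    functions, removes the directions transverse to the graphs. As psi fixes A,
    the values of the functions on A are not affected. *)
Definition flat_on (k : nat) (fs : set (E -> R)) (U : set E) (A : set E) :=
  exists (c : E) (r L : R) (psi : E -> E), [/\ A `<=` ball c r,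
    forall y, ball c r y -> [/\ differentiable psi y, U (psi y) &
      forall v, `|'d psi y v| <= L * `|v|],
    forall a, A a -> psi a = a, 0 < L &
    forall f, fs f -> forall e, 0 < e -> exists2 del, 0 < del &
      forall a y, A a -> ball c r y -> `|y - a| < del -> `|f (psi y)| <= e * `|y - a| ^+ k].

Lemma flat_on_sub k fs U A B : B `<=` A -> flat_on k fs U A -> flat_on k fs U B.
Proof.
move=> BA [c [r [L [psi [Ac P fixp L0 H]]]]]; exists c, r, L, psi; split=> //.
- exact: subset_trans Ac.
- by move=> a /BA/fixp.
- move=> f ff e e0; have [del del0 Hd] := H f ff e e0; exists del => // a y /BA; exact: Hd.
Qed.

(** The mean value theorem on the segment from a to y turns flatness of order k
    of the first derivatives into flatness of order k + 1. *)
Lemma flat_on_integrate k (U A : set E) (f : E -> R) (c : E) (r L : R) (psi : E -> E) :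
  (forall x, U x -> differentiable f x) -> A `<=` ball c r ->
  (forall y, ball c r y -> [/\ differentiable psi y, U (psi y) &
      forall v, `|'d psi y v| <= L * `|v|]) -> 0 < L ->
  (forall i e, 0 < e -> exists2 del, 0 < del &
      forall a y, A a -> ball c r y -> `|y - a| < del ->
        `|'D_('e_i) f (psi y)| <= e * `|y - a| ^+ k) ->
  forall e, 0 < e -> exists2 del, 0 < del &
      forall a y, A a -> ball c r y -> `|y - a| < del ->
        `|f (psi y) - f (psi a)| <= e * `|y - a| ^+ k.+1.
Proof.
move=> df Ac P L0 H e e0.
pose e' := e / (n.+1%:R * L).
have e'0 : 0 < e' by rewrite divr_gt0// mulr_gt0.
have [del Hdel] := choice (fun i => (let: ex_intro2 d p q := H i e' e'0 in ex_intro _ d (conj p q))).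
pose d0 := \big[Order.min/1]_i del i.
exists d0; first by apply: lt_bigmin => // i _; have [] := Hdel i.
move=> a y Aa By yd.
have [|t t01 ->] := @mean_value _ _ (f \o psi) a y.
  move=> t t01; have Bt := ball_segment t01 (Ac a Aa) By.
  by have [dp Up _] := P _ Bt; apply: differentiable_comp => //; exact: df.
have Bt := ball_segment t01 (Ac a Aa) By; set z := _ + _ in Bt *.
have [dp Up HL] := P _ Bt; have dfz := df _ Up.
have za : `|z - a| <= `|y - a|.
  by rewrite /z addrAC subrr add0r normrZ; case/andP: t01 => t0 t1; rewrite ger0_norm// ler_piMl.
rewrite (diff_comp dp dfz) /=.
apply: (le_trans (diff_norm_le _ dfz)).
apply: (@le_trans _ _ ((n.+1%:R * (e' * `|y - a| ^+ k)) * (L * `|y - a|))).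
  apply: ler_pM => //; first by rewrite sumr_ge0.
  apply: (@le_trans _ _ (\sum_(i < n) (e' * `|y - a| ^+ k))).
    apply: ler_sum => i _; have [di0 Hd] := Hdel i.
    apply: (le_trans (Hd a z Aa Bt _)).
      apply: (le_lt_trans za); apply: (lt_le_trans yd); exact: bigmin_le_cond.
    by rewrite ler_wpM2l// ?(ltW e'0)// lerXn2r// nnegrE.
  rewrite sumr_const card_ord -[leLHS]mulr_natl ler_wpM2r ?ler_nat// mulr_ge0// ltW//.
rewrite exprS /e' le_eqVlt; apply/orP; left; apply/eqP; field.
by rewrite gt_eqF//=.
Qed.

Lemma flat_on0 (N : set (set E)) (U A : set E) (fs : set (E -> R)) : sigma_ideal N ->
  open U -> A `<=` U -> (forall f, fs f -> Ck 0 U f) ->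
  (forall f a, fs f -> A a -> f a = 0) ->
  (forall B, flat_on 0 fs U B -> N B) -> N A.
Proof.
move=> sN oU AU fk fA H; apply: sigma_ideal_local => // a Aa.
have [rho rho0 Hrho] := near_ex_ball (open_near oU (AU a Aa)).
have r0 : 0 < rho / 2 by rewrite divr_gt0.
have rrho : rho / 2 < rho by rewrite ltr_pdivrMr// ltr_pMr// ltr1n.
exists (rho / 2) => //; apply: H; exists a, (rho / 2), 1, id; split=> //.
- move=> y By; split=> //; first by apply: Hrho; apply: le_ball By; exact: ltW.
  by move=> v; rewrite diff_val mul1r.
- move=> f ff e e0.
  have [y yr|del del0 Hd] := @uniform_modulus _ _ f a (rho / 2) _ e e0.
    apply: (Ck_continuous oU (fk f ff)); apply: Hrho.
    by rewrite -ball_normE /=; exact: le_lt_trans rrho.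
  exists del => // b y [Ab Bb] By yb; rewrite expr0 mulr1 /=.
  move: Bb By; rewrite -!ball_normE /= => Bb By.
  by have := Hd y b (ltW By) (ltW Bb) yb; rewrite (fA f b)// subr0 => /ltW.
Qed.

Lemma flat_on_compose k (U : set E) (a : E) (r K : R) (phi : E -> E) (fs : set (E -> R)) (A : set E) :
  (forall y, ball a r y -> [/\ differentiable phi y, U (phi y) &
    forall v, `|'d phi y v| <= K * `|v|]) -> 0 < K ->
  (forall x, A x -> phi x = x) ->
  flat_on k [set h \o phi | h in fs] (ball a r) A -> flat_on k fs U A.
Proof.
move=> P K0 fixp [c [s [L [psi [Ac Q fixq L0 H]]]]].
exists c, s, (K * L), (phi \o psi); split=> //.
- move=> y By; have [dpsi Bpsi HL] := Q y By; have [dphi Uphi HK] := P _ Bpsi.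
  split; [exact: differentiable_comp|exact: Uphi|move=> v].
  rewrite (diff_comp dpsi dphi) /= (le_trans (HK _))// -mulrA ler_wpM2l// ?(ltW K0)//.
- by move=> b Ab /=; rewrite fixq// fixp.
- by rewrite mulr_gt0.
- move=> f ff e e0; have [|del del0 Hd] := H (f \o phi) _ e e0; first by exists f.
  by exists del => // b y Ab By yb; exact: Hd.
Qed.

(** Morse's decomposition: the common zero set A of functions of class C^k is
    a countable union of sets on which they are flat to order k. Where all
    first derivatives vanish, one integrates the flatness of order k - 1 of the
    derivatives; where some derivative does not vanish, A lies in the graph of
    an implicit function, and composing with the projection onto that graph
    removes one variable. *)
Lemma morse_decomposition k (N : set (set E)) (U A : set E) (fs : set (E -> R)) :
  sigma_ideal N -> open U -> A `<=` U -> (forall f, fs f -> Ck k U f) ->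
  (forall f a, fs f -> A a -> f a = 0) ->
  (forall B, B `<=` A -> flat_on k fs U B -> N B) -> N A.
Proof.
elim: k N U A fs => [|k IHk] N U A fs sN oU AU fk fA H.
  have := @flat_on0 _ U A fs (sigma_ideal_restr A sN) oU AU fk fA.
  rewrite /= setIid; apply=> B fB; apply: H; first by move=> x [].
  exact: flat_on_sub fB.
have flatpart N' (U' A' : set E) fs' : sigma_ideal N' -> open U' -> A' `<=` U' ->
    (forall f, fs' f -> Ck k.+1 U' f) -> (forall f a, fs' f -> A' a -> f a = 0) ->
    (forall f i a, fs' f -> A' a -> 'D_('e_i) f a = 0) ->
    (forall B, B `<=` A' -> flat_on k.+1 fs' U' B -> N' B) -> N' A'.
  move=> {N U A fs sN oU AU fk fA H} sN oU AU fk fA fD H.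
  apply: (IHk N' U' A' [set g | exists f i, fs' f /\ g = 'D_('e_i) f]) => //.
  - by move=> _ [f [i [ff ->]]]; have [_] := fk f ff; apply.
  - by move=> _ a [f [i [ff ->]]]; exact: fD.
  move=> B BA [c [r [L [psi [Bc P fixp L0 HB]]]]]; apply: H => //.
  exists c, r, L, psi; split=> // f ff e e0.
  have df x : U' x -> differentiable f x by have [+ _] := fk f ff; apply.
  have [|del del0 Hd] := flat_on_integrate (k := k) df Bc P L0 _ e0.
    by move=> i e1 e10; apply: (HB ('D_('e_i) f) _ e1 e10); exists f, i.
  exists del => // a y Ba By ya; have := Hd a y Ba By ya.
  by rewrite (fixp a Ba) (fA f a ff (BA _ Ba)) subr0.
(* J holds the directions along which the functions are already constant; each
   projection adds one, and when J is everything the derivatives all vanish. *)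
suff S (m : nat) N' (U' A' : set E) fs' (J : {set 'I_n}) :
    sigma_ideal N' -> open U' -> A' `<=` U' -> (forall f, fs' f -> Ck k.+1 U' f) ->
    (forall f a, fs' f -> A' a -> f a = 0) ->
    (forall B, B `<=` A' -> flat_on k.+1 fs' U' B -> N' B) ->
    (forall f j y, fs' f -> j \in J -> U' y -> 'D_('e_j) f y = 0) ->
    (#|~: J| <= m)%N -> N' A'.
  apply: (S _ N U A fs finset.set0) => // f j y _.
  by rewrite finset.in_set0.
elim: m N' U' A' fs' J => {N U A fs sN oU AU fk fA H} [|m IHm] N U A fs J sN oU AU fk fA H indep HJ.
  apply: (flatpart N U A fs) => // f i a ff Aa; apply: (indep f) => //; last exact: AU.
  by move: HJ; rewrite leqn0 cards_eq0 => /eqP/setP/(_ i); rewrite !inE => /negbFE.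
have [N0 NS NU] := sN.
pose A1 := A `&` [set a | forall f i, fs f -> 'D_('e_i) f a = 0].
have NA1 : N A1.
  apply: (flatpart N U A1 fs) => //.
  - by move=> a [/AU].
  - by move=> f a ff [Aa _]; exact: fA.
  - by move=> f i a ff [_]; apply.
  - by move=> B BA; apply: H => a /BA[].
have NA2 : N (A `\` A1).
  apply: sigma_ideal_local => // a [Aa nA1].
  have [f [i [ff Dfi]]] : exists f i, fs f /\ 'D_('e_i) f a != 0.
    apply: contrapT => nE; apply: nA1; split=> // f i ff; apply/eqP; apply: contrapT => /negP Df.
    by apply: nE; exists f, i.
  have iJ : i \notin J.
    by apply: contraNN Dfi => iJ; apply/eqP; apply: (indep f) => //; exact: AU.
  have [r [phi [r0 P Cphi fixp Dphi]]] := implicit_projection oU (fk f ff) (AU a Aa) (fA f a ff Aa) Dfi.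
  have oBr : open (ball a r) by exact: ball_open.
  have Cphi1 : Ck 1 (ball a r) phi by exact: Ck_le oBr _ Cphi.
  have [K K0 HK] := Ck1_diff_bounded oBr Cphi1 (ballxx a r0).
  have [s s0 Hs] := near_ex_ball HK.
  pose t := Num.min r s; have t0 : 0 < t by rewrite lt_min r0.
  have tr : ball a t `<=` ball a r by apply: le_ball; rewrite ge_min lexx.
  have ts : ball a t `<=` ball a s by apply: le_ball; rewrite ge_min lexx orbT.
  exists t => //.
  have fixA x : (A `&` ball a t) x -> phi x = x.
    by move=> [Ax Bx]; apply: fixp; [exact: tr|exact: fA].
  apply: (NS _ (A `&` ball a t)); first by move=> x [[]].
  apply: (IHm N (ball a t) (A `&` ball a t) [set h \o phi | h in fs] (i |: J)) => //.
  - exact: ball_open.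
  - have oB : open (ball a t) by exact: ball_open.
    move=> _ [h fh <-]; apply: (Ck_comp oB oU); last exact: fk.
      by move=> y /tr/P[].
    exact: Ck_sub oBr oB tr Cphi.
  - move=> _ x [h fh <-] Ax /=; rewrite fixA//; apply: fA => //; by case: Ax.
  - move=> B BA flatB; apply: H; first by move=> x /BA[].
    apply: (flat_on_compose (a := a) (r := t) (K := K) (phi := phi)) => //.
      move=> y By; have [_ Uy _] := P y (tr _ By); split=> //; first exact: Cphi1.1 _ (tr _ By).
      exact: Hs (ts _ By).
    by move=> x /BA; exact: fixA.
  - move=> _ j y [h fh <-] jJ By; have Bry := tr _ By; have [_ Uy Dfy] := P y Bry.
    have dphi := Cphi1.1 y Bry; have dh := (fk h fh).1 _ Uy.
    rewrite deriveE; last exact: differentiable_comp.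
    rewrite (diff_comp dphi dh) /= -(deriveE _ dphi) Dphi//.
    move: jJ; rewrite !inE => /orP[/eqP ->|jJ].
      by rewrite divff// scale1r subrr linear0.
    rewrite (indep f)// mul0r scale0r subr0 -(deriveE _ dh); exact: indep.
  - have : (#|~: (i |: J)| < #|~: J|)%N.
      apply: proper_card; apply/properP; split.
        by rewrite finset.setCS finset.subsetUr.
      by exists i; rewrite !inE ?eqxx.
    by move=> h; rewrite -ltnS (leq_trans h).
apply: (NS _ (\bigcup_k (if k == 0%N then A1 else A `\` A1))).
  move=> a Aa; case: (pselect (A1 a)) => h; first by exists 0%N.
  by exists 1%N => //.
by apply: NU => -[|l].
Qed.

End Morse.

(** * Sard's theorem for real functions *)

Section Sard.
Context {R : realType}.
Local Notation mu := (@lebesgue_measure R).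

Lemma negligible_small (S : set R) :
  (forall e : R, 0 < e -> exists C : set R, [/\ measurable C, S `<=` C & (mu C <= e%:E)%E]) ->
  mu.-negligible S.
Proof.
move=> H.
have H' (k : nat) : exists C : set R, [/\ measurable C, S `<=` C & (mu C <= (k.+1%:R^-1)%:E)%E].
  by apply: H; rewrite invr_gt0.
have [C HC] := choice H'.
have mC : measurable (\bigcap_k C k) by apply: bigcapT_measurable => k; have [] := HC k.
exists (\bigcap_k C k); split => //; last by move=> x Sx k _; have [_ + _] := HC k; apply.
apply/eqP; rewrite eq_le measure_ge0 andbT; apply/lee_addgt0Pr => e e0.
have [k Hk] : exists k, (k.+1%:R^-1 : R) < e.
  exists (Num.truncn e^-1); rewrite invf_plt ?posrE//.
  by have /andP[] := truncn_itv (ltW (eqbRL (invr_gt0 _) e0)).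
rewrite add0e; have [mCk _ muC] := HC k.
apply: (@le_trans _ _ (mu (C k))); first by apply: le_measure; rewrite ?inE//; exact: bigcap_inf.
by apply: (le_trans muC); rewrite lee_fin ltW.
Qed.

Lemma negligible_interval (S : set R) (a b : R) : a < b -> mu.-negligible S ->
  `[a, b]%classic `<=` S -> False.
Proof.
move=> ab [C [mC C0 SC]] sub.
have : (mu `[a, b]%classic <= mu C)%E.
  apply: le_measure; [by apply/mem_set; exact: measurable_itv|exact/mem_set|].
  exact: subset_trans sub SC.
rewrite C0 lebesgue_measure_itv /= lte_fin ab -EFinD lee_fin.
by rewrite subr_le0 leNgt ab.
Qed.

(** A map that is o(|x - y|^n) on a bounded subset of R^n has a null image:
    a cube of side 2r cut into N^n cubes of side h = 2r / N has an image covered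
    by N^n intervals of length o(h^n). *)
Lemma negligible_image n (A : set 'rV[R]_n) (F : 'rV[R]_n -> R) c r : 0 < r ->
  A `<=` ball c r ->
  (forall e, 0 < e -> exists2 del, 0 < del & forall a b, A a -> A b ->
    `|a - b| < del -> `|F a - F b| <= e * `|a - b| ^+ n) ->
  mu.-negligible (F @` A).
Proof.
move=> r0 Ac H; apply: negligible_small => e e0.
(* The N^n intervals, of length 2 (e / D) h^n each, have total length e. *)
pose D := 2 * (2 * r) ^+ n.
have D0 : 0 < D by rewrite mulr_gt0// exprn_gt0// mulr_gt0.
have [del del0 Hd] := H (e / D) (divr_gt0 e0 D0).
pose N := (Num.truncn (2 * r / del)).+1.
have N0 : (0 : R) < N%:R by rewrite ltr0n.
pose h := 2 * r / N%:R.
have h0 : 0 < h by rewrite divr_gt0// mulr_gt0.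
have hdel : h < del.
  rewrite /h ltr_pdivrMr// [del * _]mulrC -ltr_pdivrMr//.
  by have /andP[] := truncn_itv (ltW (divr_gt0 (mulr_gt0 (ltr0n R 2) r0) del0)).
pose idx (y : 'rV[R]_n) : {ffun 'I_n -> 'I_N} :=
  [ffun i => inord (Num.truncn ((y 0 i - c 0 i + r) / h))].
have idxP a b : A a -> A b -> idx a = idx b -> `|a - b| < h.
  move=> Aa Ab E; apply: rV_norm_lt => // i; rewrite coordB.
  have P y : A y -> exists2 m, (m < N)%N & Num.truncn ((y 0 i - c 0 i + r) / h) = m /\
      m%:R * h <= y 0 i - c 0 i + r < m.+1%:R * h.
    move=> Ay; have By := Ac y Ay; move: By; rewrite -ball_normE /= => By.
    have := le_lt_trans (ler_coord (c - y) i) By; rewrite coordB ltr_norml => /andP[l1 l2].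
    have p0 : 0 <= y 0 i - c 0 i + r by lra.
    have p1 : y 0 i - c 0 i + r < 2 * r by lra.
    have q0 : 0 <= (y 0 i - c 0 i + r) / h by rewrite divr_ge0// ltW.
    exists (Num.truncn ((y 0 i - c 0 i + r) / h)).
      by rewrite truncn_lt_nat// ltr_pdivrMr// /h mulrCA divff ?mulr1// gt_eqF.
    by split=> //; rewrite -ler_pdivlMr// -ltr_pdivrMr//; exact: truncn_itv.
  have [m mN [ma /andP[a1 a2]]] := P a Aa; have [m' mN' [mb /andP[b1 b2]]] := P b Ab.
  have := congr1 (fun u : {ffun 'I_n -> 'I_N} => val (u i)) E; rewrite !ffunE /= ma mb !inordK// => mm.
  move: a1 a2 b1 b2; rewrite mm -natr1 mulrDl mul1r => *.
  by rewrite ltr_norml; apply/andP; split; lra.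
pose T := {ffun 'I_n -> 'I_N}.
pose I (u : T) : set R := if pselect (exists a, A a /\ idx a = u) is left ex then
  `[F (projT1 (cid ex)) - e / D * h ^+ n, F (projT1 (cid ex)) + e / D * h ^+ n]%classic else set0.
have mI u : measurable (I u) by rewrite /I; case: pselect => // ?; exact: measurable_itv.
have muI u : (mu (I u) <= (2 * (e / D * h ^+ n))%:E)%E.
  have p : 0 < e / D * h ^+ n by rewrite mulr_gt0// ?divr_gt0// exprn_gt0.
  rewrite /I; case: pselect => [?|_]; last by rewrite measure0 lee_fin mulr_ge0// ltW.
  rewrite lebesgue_measure_itv /= lte_fin; case: ifP => _; last by rewrite lee_fin mulr_ge0// ltW.
  by rewrite -EFinD lee_fin; lra.
pose u0 : T := [ffun=> ord0].
pose J k := I (nth u0 (enum T) k).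
exists (\big[setU/set0]_(k < #|T|) J k); split.
- by apply: bigsetU_measurable => k _; exact: mI.
- move=> _ [a Aa <-]; rewrite -bigcup_mkord.
  exists (index (idx a) (enum T)); first by rewrite /= cardE index_mem mem_enum.
  rewrite /J nth_index ?mem_enum// /I; case: pselect => [ex|[]]; last by exists a.
  case: (cid ex) => b [Ab iab] /=; rewrite in_itv/=.
  have ab := idxP a b Aa Ab (esym iab).
  have := Hd a b Aa Ab (lt_trans ab hdel).
  have : e / D * `|a - b| ^+ n <= e / D * h ^+ n.
    by rewrite ler_wpM2l ?divr_ge0 ?(ltW e0) ?(ltW D0)// lerXn2r// ?nnegrE// ltW.
  by move=> h1 /le_trans/(_ h1); rewrite ler_norml => /andP[*]; apply/andP; split; lra.
apply: (le_trans (Boole_inequality _ _)); first by move=> k _; exact: mI.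
apply: (@le_trans _ _ (\sum_(k < #|T|) (2 * (e / D * h ^+ n))%:E)%E).
  by apply: lee_sum => k _; exact: muI.
rewrite sumEFin lee_fin sumr_const card_ord card_ffun !card_ord -[leLHS]mulr_natl natrX.
rewrite le_eqVlt; apply/orP; left; apply/eqP.
rewrite /h /D !exprMn exprVn; field.
by rewrite !expf_neq0// ?gt_eqF.
Qed.

Lemma sigma_ideal_negligible_image T (F : T -> R) :
  sigma_ideal [set B : set T | mu.-negligible (F @` B)].
Proof.
split=> [|A B AB|G NG] /=; first by rewrite image_set0; exact: negligible_set0.
  by apply: negligibleS; exact: image_subset.
by rewrite image_bigcup; exact: negligible_bigcup.
Qed.

(** Sard's theorem for real functions of n variables, in the class C^n. The
    first derivatives are of class C^(n-1) and vanish on A, so A is a countable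
    union of sets where they are flat to order n - 1; on these F is flat to
    order n, which makes the image null. *)
Lemma sard n (U A : set 'rV[R]_n) (F : 'rV[R]_n -> R) : (0 < n)%N ->
  open U -> A `<=` U -> Ck n U F ->
  (forall a i, A a -> 'D_('e_i) F a = 0) -> mu.-negligible (F @` A).
Proof.
case: n U A F => // n U A F _ oU AU Fk crit.
apply: (morse_decomposition (k := n) (U := U) (A := A) (fs := [set g | exists i, g = 'D_('e_i) F])
  (sigma_ideal_negligible_image F)) => //.
- by move=> _ [i ->]; exact: Fk.2.
- by move=> _ a [i ->]; exact: crit.
move=> B BA [c [r [L [psi [Bc P fixp L0 H]]]]].
have [[b Bb]|B0] := pselect (exists b, B b); last first.
  rewrite /= (_ : _ @` _ = set0); first exact: negligible_set0.
  by rewrite predeqE => x; split => // -[b Bb _]; apply: B0; exists b.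
have r0 : 0 < r by have := Bc b Bb; rewrite -ball_normE /= => /(le_lt_trans (normr_ge0 _)).
apply: (negligible_image r0 Bc) => e e0.
have [|del del0 Hd] := flat_on_integrate (k := n) Fk.1 Bc P L0 _ e0.
  by move=> i e1 e10; apply: (H ('D_('e_i) F) _ e1 e10); exists i.
exists del => // x y Bx By xy; have := Hd y x By (Bc x Bx) xy.
by rewrite !fixp.
Qed.

End Sard.

(** * Gronwall's inequality *)

Section Gronwall.
Context {R : realType}.
Variable d : nat.

Lemma Ck1_lipschitz m (U : set 'rV[R]_d) (F : 'rV[R]_d -> 'rV[R]_m) q :
  open U -> Ck 1 U F -> U q ->
  exists r L : R, [/\ 0 < r, 0 < L, forall y, `|y - q| <= r -> U y &
    forall y z, `|y - q| <= r -> `|z - q| <= r -> `|F y - F z| <= L * `|y - z|].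
Proof.
move=> oU F1 Uq; have [K K0 HK] := Ck1_diff_bounded oU F1 Uq.
have : \forall y \near q, U y /\ forall v, `|'d F y v| <= K * `|v|.
  exact: filterI (open_near oU Uq) HK.
move=> /near_ex_ball[s s0 Hs]; pose r := s / 2.
have rs : r < s by rewrite ltr_pdivrMr// ltr_pMr// ltr1n.
have B y : `|y - q| <= r -> ball q s y by rewrite -ball_normE /= distrC => /le_lt_trans; apply.
exists r, K; split; first by rewrite divr_gt0.
- by [].
- by move=> y /B/Hs[].
move=> y z yr zr; apply: rV_norm_le => [|j]; first by rewrite mulr_ge0// ltW.
have sg t : 0 <= t <= 1 -> U (z + t *: (y - z)) /\ forall v, `|'d F (z + t *: (y - z)) v| <= K * `|v|.
  by move=> t01; apply: Hs; apply: (ball_segment t01); exact: B.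
have df t : 0 <= t <= 1 -> differentiable F (z + t *: (y - z)).
  by move=> /sg[+ _]; exact: F1.1.
have [|t t01 E] := @mean_value _ _ (fun x => F x 0 j) z y.
  by move=> t t01; apply: differentiable_comp_coord; exact: df.
rewrite coordB E diff_coord; last exact: df.
by apply: (le_trans (ler_coord _ _)); have [_] := sg t t01; apply.
Qed.

(** Gronwall's inequality, on the unit time interval. The norm is the supremum
    norm, which is not differentiable; the argument runs on the sum w of the
    squares of the coordinates, for which (w + K^2) exp(- a t) decreases. *)
Lemma gronwall (L : R) : 0 <= L -> exists2 C : R, 1 <= C &
  forall (u du : R -> 'rV[R]_d) (K s : R), 0 <= K -> 0 <= s <= 1 ->
    (forall t, 0 <= t <= s -> is_derive t 1 u (du t) /\ `|du t| <= L * `|u t| + K) ->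
    `|u s| <= C * (`|u 0| + K).
Proof.
move=> L0; pose a : R := d%:R * (2 * L + 1).
have a0 : 0 <= a by rewrite mulr_ge0// addr_ge0// mulr_ge0.
pose C : R := (d%:R + 1) * expR a.
have C1 : 1 <= C.
  rewrite -[leLHS]mulr1 /C ler_pM//; first by rewrite lerDr.
  by rewrite -expR0 ler_expR.
exists C => // u du K s K0 s01 H.
pose w t := \sum_i (u t 0 i) ^+ 2.
have wu t : `|u t| ^+ 2 <= w t.
  have [->|un0] := eqVneq (u t) 0; first by rewrite normr0 expr0n /= sumr_ge0// => i _; exact: sqr_ge0.
  have [i Hi] : exists i : 'I_d, `|u t| = `|u t 0 i|.
    have [|[k i] /= E] := @mx_norm_neq0 R 1 d (u t); first by rewrite -[mx_norm _]/(`|u t|) normr_eq0.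
    by exists i; rewrite -(ord1 k).
  by rewrite Hi real_normK ?num_real// /w (bigD1 i)//= lerDl sumr_ge0// => j _; exact: sqr_ge0.
have uw t : w t <= d%:R * `|u t| ^+ 2.
  apply: (@le_trans _ _ (\sum_(i < d) `|u t| ^+ 2)); last first.
    by rewrite sumr_const card_ord -[leLHS]mulr_natl.
  apply: ler_sum => i _; rewrite -real_normK ?num_real// lerXn2r ?nnegrE//; exact: ler_coord.
pose dw t := \sum_i (2 * u t 0 i * du t 0 i).
have Dw t : 0 <= t <= s -> is_derive t 1 w (dw t).
  move=> ts; have [Hu _] := H t ts.
  have ui i : is_derive t 1 (fun t => u t 0 i) (du t 0 i).
    have du' : differentiable u t by apply/derivable1_diffP; exact: ex_derive.
    apply: DeriveDef; first by apply: diff_derivable; exact: differentiable_comp_coord.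
    by rewrite derive_coord// derive_val.
  have -> : w = \sum_i (fun t => u t 0 i) ^+ 2.
    by rewrite funeqE => x; rewrite fct_sumE.
  apply: is_derive_eq; apply: eq_bigr => i _.
  by rewrite expr1 /GRing.scale /= mulr2n mulrDl mul1r mulrDl.
have dw_le t : 0 <= t <= s -> dw t <= a * (w t + K ^+ 2).
  move=> ts; have [_ Hd] := H t ts.
  have n0 := normr_ge0 (u t).
  apply: (@le_trans _ _ (d%:R * (2 * `|u t| * (L * `|u t| + K)))).
    apply: (@le_trans _ _ (\sum_(i < d) 2 * `|u t| * (L * `|u t| + K))); last first.
      by rewrite sumr_const card_ord -[leLHS]mulr_natl.
    apply: ler_sum => i _; rewrite -!mulrA ler_wpM2l// (le_trans (ler_norm _))// normrM.
    by rewrite ler_pM//; [exact: ler_coord|exact: le_trans (ler_coord _ _) Hd].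
  have -> : a * (w t + K ^+ 2) = d%:R * ((2 * L + 1) * (w t + K ^+ 2)) by rewrite mulrA.
  rewrite ler_wpM2l//.
  have : `|u t| ^+ 2 <= w t by [].
  set v := `|u t| in n0 *; set W := w t => vW.
  have h1 : 2 * v * K <= v ^+ 2 + K ^+ 2 by rewrite -subr_ge0; have := sqr_ge0 (v - K); lra.
  have h2 : 2 * L * v ^+ 2 <= 2 * L * W by rewrite ler_wpM2l// mulr_ge0.
  have h3 : 0 <= 2 * L * K ^+ 2 by rewrite mulr_ge0 ?sqr_ge0// mulr_ge0.
  nra.
pose g t := (w t + K ^+ 2) * expR (- a * t).
have De (t : R) : is_derive t 1 (fun t : R => expR (- a * t)) (- a * expR (- a * t)).
  have D1 : is_derive t 1 (fun t : R => - a * t) (- a).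
    by apply: is_derive_eq; rewrite /GRing.scale /= mulr1.
  have D2 := is_derive_expR (- a * t).
  have := @is_derive1_comp _ expR (fun t : R => - a * t) t _ _ D2 D1.
  by rewrite mulrC.
have Dg (t : R) : 0 <= t <= s -> is_derive t 1 g ((dw t - a * (w t + K ^+ 2)) * expR (- a * t)).
  move=> ts; have Dwt := Dw t ts; have Det := De t.
  have D1 : is_derive t 1 (fun t => w t + K ^+ 2) (dw t).
    by apply: is_derive_eq; rewrite addr0.
  rewrite /g; apply: is_derive_eq; rewrite /GRing.scale /=; ring.
have [s0 s1] := andP s01.
have itvE t : t \in `]0, s[ -> 0 <= t <= s.
  by rewrite in_itv /= => /andP[/ltW -> /ltW ->].
have gs : g s <= g 0.
  have i0 : 0 \in `[0, s] by rewrite in_itv /= lexx.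
  have i1 : s \in `[0, s] by rewrite in_itv /= s0 lexx.
  refine (@ler0_derive1_le_cc _ g 0 s _ _ _ _ _ i1 i0 s0).
  - by move=> t /itvE/Dg Dt; exact: ex_derive.
  - move=> t /itvE ts; have Dt := Dg t ts; rewrite derive1E derive_val.
    by rewrite mulr_le0_ge0 ?expR_ge0// subr_le0; exact: dw_le.
  - apply: continuous_in_subspaceT => t; rewrite inE/= in_itv/= => /Dg Dt.
    by apply/differentiable_continuous/derivable1_diffP; exact: ex_derive.
have ws : w s + K ^+ 2 <= (w 0 + K ^+ 2) * expR a.
  move: gs; rewrite /g mulr0 expR0 mulr1 mulNr expRN ler_pdivrMr ?expR_gt0// => /le_trans; apply.
  by rewrite ler_wpM2l ?addr_ge0 ?sqr_ge0 ?sumr_ge0// ?ler_expR ?ler_piMr// => i _; exact: sqr_ge0.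
have X0 : 0 <= `|u 0| + K by rewrite addr_ge0.
have CX : 0 <= C * (`|u 0| + K) by rewrite mulr_ge0// (le_trans ler01).
rewrite -(@ler_sqr _ (`|u s|)) ?nnegrE//.
apply: (le_trans (wu s)).
have e1 : 1 <= expR a by rewrite -expR0 ler_expR.
apply: (@le_trans _ _ (C * (`|u 0| + K) ^+ 2)); last first.
  by rewrite exprMn ler_wpM2r ?sqr_ge0// expr2 ler_peMl// (le_trans ler01).
apply: (@le_trans _ _ (w s + K ^+ 2)); first by rewrite lerDl sqr_ge0.
apply: (le_trans ws); rewrite /C mulrAC ler_wpM2r ?expR_ge0//.
apply: (@le_trans _ _ (d%:R * `|u 0| ^+ 2 + K ^+ 2)); first by rewrite lerD2r.
rewrite mulrDl mul1r lerD//.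
  by rewrite ler_wpM2l// lerXn2r ?nnegrE// lerDl.
by rewrite lerXn2r ?nnegrE// lerDr.
Qed.

End Gronwall.

(** * Charts and tangent vectors *)

Section LocalChainRule.
Context {R : realType}.
Implicit Types V W Z : normedModType R.

Lemma diff_comp_near V W Z (f : V -> Z) (g : V -> W) (h : W -> Z) x y : g x = y ->
  differentiable g x -> differentiable h y -> (\forall z \near x, h (g z) = f z) ->
  differentiable f x /\ forall v, 'd f x v = 'd h y ('d g x v).
Proof.
move=> gxy dg dh N; subst y.
have dc : differentiable (h \o g) x by exact: differentiable_comp.
have N' : \forall z \near x, (h \o g) z = f z by [].
split; first exact: near_eq_differentiable N' dc.
by move=> v; rewrite (near_eq_diff N' dc) diff_comp.
Qed.

Lemma diff_near_id V (f : V -> V) x v : (\forall z \near x, f z = z) -> 'd f x v = v.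
Proof.
move=> N; have did : differentiable (fun y : V => y) x by exact: (@ex_diff _ _ _ _ _ id).
have N' : \forall z \near x, (fun y : V => y) z = f z by apply: filterS N => z ->.
by rewrite (near_eq_diff N' did) (@diff_val _ _ _ _ _ id id).
Qed.

Lemma derive_comp_near V W (f : R -> W) (g : R -> V) (h : V -> W) (t : R) y v : g t = y ->
  is_derive t 1 g v -> differentiable h y -> (\forall s \near t, h (g s) = f s) ->
  is_derive t 1 f ('d h y v).
Proof.
move=> gt Dg dh N.
have dg : differentiable g t by apply/derivable1_diffP; exact: ex_derive.
have [df E] := diff_comp_near gt dg dh N.
apply: DeriveDef; first exact: diff_derivable.
have E1 : 'd g t 1 = v by rewrite -(deriveE _ dg) derive_val.
by rewrite (deriveE _ df) E E1.
Qed.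

Lemma is_derive_affine V (g : R -> V) (t0 s t : R) v : is_derive (t0 + s * t) 1 g v ->
  is_derive t 1 (fun t : R => g (t0 + s * t)) (s *: v).
Proof.
move=> Dg; have dg : differentiable g (t0 + s * t) by apply/derivable1_diffP; exact: ex_derive.
have D1 : is_derive t 1 (fun t : R => s * t) s.
  by apply: is_derive_eq; rewrite /GRing.scale /= mulr1.
have D2 : is_derive t 1 (fun _ : R => t0) 0 by exact: is_derive_cst.
have Da : is_derive t 1 (fun t : R => t0 + s * t) s.
  by have := is_deriveD D2 D1; rewrite add0r.
have E1 : 'd g (t0 + s * t) 1 = v by rewrite -(deriveE _ dg) derive_val.
have E : 'd g (t0 + s * t) s = s *: v.
  by rewrite -E1 -linearZ; congr ('d g _ _); rewrite /GRing.scale /= mulr1.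
rewrite -E; have N : \forall u \near t, g ((fun t : R => t0 + s * t) u) = (fun t : R => g (t0 + s * t)) u.
  exact: filterE.
exact: (derive_comp_near (g := fun t : R => t0 + s * t) erefl Da dg N).
Qed.

End LocalChainRule.

Section Charts.
Context {R : realType} {d : nat} {M : manifold R d}.
Implicit Types (c : chart R d M) (x : M).

Lemma chart_continuous c x : chart_dom c x -> {for x, continuous c}.
Proof.
have := @chart_fun_continuous _ _ _ c.
by rewrite (continuous_open_subspace _ (chart_dom_open c)) => H /mem_set/H.
Qed.

Lemma chart_inv_continuous_at c y : chart_cod c y -> {for y, continuous (chart_inv c)}.
Proof.
have := @chart_inv_continuous _ _ _ c.
by rewrite (continuous_open_subspace _ (@chart_cod_open _ _ _ c)) => H /mem_set/H.
Qed.

Lemma chartK c x : chart_dom c x -> chart_inv c (c x) = x.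
Proof. by move=> /mem_set/(chart_funK (c := c)). Qed.

Lemma chart_invKe c y : chart_cod c y -> c (chart_inv c y) = y.
Proof. by move=> /mem_set/(chart_invK (c := c)). Qed.

Lemma chart_codP c x : chart_dom c x -> chart_cod c (c x).
Proof. exact: chart_fun_cod. Qed.

Lemma chart_domP c y : chart_cod c y -> chart_dom c (chart_inv c y).
Proof. exact: chart_inv_dom. Qed.

Lemma transition_open c c' : open (chart_cod c `&` chart_inv c @^-1` chart_dom c').
Proof.
have /(continuous_inP _ (@chart_cod_open _ _ _ c)) : {in chart_cod c, continuous (chart_inv c)}.
  by move=> y /set_mem; exact: chart_inv_continuous_at.
by apply; exact: chart_dom_open.
Qed.

Lemma chart_preimage_open c (V : set 'rV[R]_d) : open V -> open (chart_dom c `&` c @^-1` V).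
Proof.
move=> oV; have /(continuous_inP _ (chart_dom_open c)) : {in chart_dom c, continuous c}.
  by move=> y /set_mem; exact: chart_continuous.
exact.
Qed.

Lemma transition_differentiable c c' y : atlas c -> atlas c' -> chart_cod c y ->
  chart_dom c' (chart_inv c y) -> differentiable (c' \o chart_inv c) y.
Proof. by move=> Ac Ac' cy dy; have [+ _] := atlas_smooth Ac Ac' 1; apply. Qed.

Lemma to_chart_id x (v : 'rV[R]_d) : to_chart (chart_at x) x v = v.
Proof.
have Dx := chart_at_dom x; apply: diff_near_id.
apply: filterS (open_near (@chart_cod_open _ _ _ (chart_at x)) (chart_codP Dx)) => y Cy.
by rewrite /= chart_invKe.
Qed.

Lemma local_rep_at (X : vector_field M) x : local_rep (chart_at x) X (chart_at x x) = X x.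
Proof. by rewrite /local_rep chartK ?to_chart_id//; exact: chart_at_dom. Qed.

Lemma local_repE (X : vector_field M) c x : chart_dom c x -> local_rep c X (c x) = to_chart c x (X x).
Proof. by move=> Dx; rewrite /local_rep chartK. Qed.

Definition dform (f : M -> R) (x : M) : 'rV[R]_d -> R := 'd (f \o chart_inv (chart_at x)) (chart_at x x).

Lemma near_chart c c' y : chart_cod c y -> chart_dom c' (chart_inv c y) ->
  \forall z \near y, chart_cod c z /\ chart_dom c' (chart_inv c z).
Proof. by move=> Cy Dy; have := open_near (@transition_open c c') (conj Cy Dy). Qed.

Lemma function_change_chart (W : normedModType R) (f : M -> W) c c' x : atlas c -> atlas c' ->
  chart_dom c x -> chart_dom c' x ->
  differentiable (f \o chart_inv c') (c' x) ->
  differentiable (f \o chart_inv c) (c x) /\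
  forall v, 'd (f \o chart_inv c) (c x) v =
    'd (f \o chart_inv c') (c' x) ('d (c' \o chart_inv c) (c x) v).
Proof.
move=> Ac Ac' Dx Dx' df.
have Cx := chart_codP Dx.
have Dx2 : chart_dom c' (chart_inv c (c x)) by rewrite chartK.
have dt := transition_differentiable Ac Ac' Cx Dx2.
have E : (c' \o chart_inv c) (c x) = c' x by rewrite /= chartK.
apply: (diff_comp_near E dt df).
by apply: filterS (near_chart Cx Dx2) => z [Cz Dz]; rewrite /= chartK.
Qed.

Lemma of_chartK c x (v : 'rV[R]_d) : atlas c -> chart_dom c x -> to_chart c x (of_chart c x v) = v.
Proof.
move=> Ac Dx; have Dx' := chart_at_dom x.
have D2 : chart_dom c (chart_inv (chart_at x) (chart_at x x)) by rewrite chartK.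
have dt := transition_differentiable (chart_at_atlas x) Ac (chart_codP Dx') D2.
have [_ /(_ v)] := function_change_chart (f := c) Ac (chart_at_atlas x) Dx Dx' dt.
rewrite /to_chart /of_chart => <-; apply: diff_near_id.
apply: filterS (open_near (@chart_cod_open _ _ _ c) (chart_codP Dx)) => y Cy.
by rewrite /= chart_invKe.
Qed.

Lemma to_chartK c x (v : 'rV[R]_d) : atlas c -> chart_dom c x -> of_chart c x (to_chart c x v) = v.
Proof.
move=> Ac Dx; have Dx' := chart_at_dom x.
have D2 : chart_dom (chart_at x) (chart_inv c (c x)) by rewrite chartK.
have dt := transition_differentiable Ac (chart_at_atlas x) (chart_codP Dx) D2.
have [_ /(_ v)] := function_change_chart (f := chart_at x) (chart_at_atlas x) Ac Dx' Dx dt.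
by rewrite /to_chart /of_chart => <-; exact: to_chart_id.
Qed.

Lemma integral_curve_chart (X : vector_field M) (gam : R -> M) c (t : R) :
  integral_curve X gam -> atlas c -> chart_dom c (gam t) ->
  is_derive t 1 (c \o gam) (local_rep c X (c (gam t))).
Proof.
move=> Xg Ac Dc; have [cg Dg] := Xg t; set c0 := chart_at (gam t) in Dg *.
have D0 : chart_dom c0 (gam t) by exact: chart_at_dom.
have D2 : chart_dom c (chart_inv c0 (c0 (gam t))) by rewrite chartK.
have dt := transition_differentiable (chart_at_atlas (gam t)) Ac (chart_codP D0) D2.
rewrite local_repE//; apply: (derive_comp_near (g := c0 \o gam) erefl Dg dt).
have : \forall s \near t, chart_dom c0 (gam s).
  by apply: cg; apply: open_nbhs_nbhs; split => //; exact: chart_dom_open.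
by apply: filterS => s Ds; rewrite /= chartK.
Qed.

End Charts.

(** * Integral curves and flows *)

Section Uniqueness.
Context {R : realType} {d : nat} {M : manifold R d}.
Implicit Types (c : chart R d M) (x : M) (X : vector_field M).

Definition chart_ball c (q : 'rV[R]_d) (r : R) := [set z | chart_dom c z /\ `|c z - q| < r].

Lemma chart_ball_open c q r : open (chart_ball c q r).
Proof.
have := @chart_preimage_open _ _ _ c (ball q r) (ball_open _ _).
congr open; rewrite predeqE => z; rewrite /chart_ball /= -ball_normE /=.
by rewrite distrC.
Qed.

(** A closed ball of the chart is the image of a compact set, hence closed in
    all of M and not only in the domain of the chart, as M is Hausdorff. *)
Lemma chart_closed_ball_closed c q r : (forall y, `|y - q| <= r -> chart_cod c y) ->
  closed [set z | chart_dom c z /\ `|c z - q| <= r].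
Proof.
move=> H; have -> : [set z | chart_dom c z /\ `|c z - q| <= r] =
    chart_inv c @` [set y | `|y - q| <= r].
  rewrite predeqE => z; split=> [[Dz zr]|[y yr <-]]; first by exists (c z) => //; rewrite chartK.
  by split; [exact: chart_domP (H y yr)|rewrite chart_invKe//; exact: H].
apply: compact_closed; first exact: manifold_hausdorff.
apply: continuous_compact.
  apply: continuous_in_subspaceT => y /set_mem /H; exact: chart_inv_continuous_at.
have := closed_ballE q; have [r0|r0] := ltP 0 r; last first.
  move=> _; have [r0'|] := ltP r 0.
    rewrite (_ : [set _ | _] = set0); first exact: compact0.
    by rewrite predeqE => y; split => //= /le_lt_trans/(_ r0'); rewrite normr_lt0.
  move=> r0'; rewrite (_ : [set _ | _] = [set q]); first exact: compact_set1.
  rewrite predeqE => y; have -> : r = 0 by apply/eqP; rewrite eq_le r0.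
  rewrite /= normr_le0 subr_eq0; split=> [/eqP//|-> //].
move=> _; apply: bounded_closed_compact.
  exists (`|q| + r); split; first exact: num_real.
  move=> B qB y yr; apply: ltW; apply: le_lt_trans qB.
  by rewrite -(subrK q y) addrC (le_trans (ler_normD _ _))// lerD2l.
have -> : [set y | `|y - q| <= r] = closed_ball q r.
  by rewrite closed_ballE// /closed_ball_; rewrite predeqE => y /=; rewrite distrC.
exact: closed_ball_closed.
Qed.

(** A first exit time argument: at the infimum of the exit times the curve is
    still in the closed ball, and the a priori estimate puts it in the open
    one. *)
Lemma no_escape (eta : R -> M) c q r : (forall y, `|y - q| <= r -> chart_cod c y) ->
  (forall s, 0 <= s <= 1 -> {for s, continuous eta}) ->
  chart_ball c q r (eta 0) ->
  (forall s, 0 <= s <= 1 -> (forall t, 0 <= t <= s -> chart_dom c (eta t) /\ `|c (eta t) - q| <= r) ->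
    `|c (eta s) - q| < r) ->
  forall s, 0 <= s <= 1 -> chart_ball c q r (eta s).
Proof.
move=> Hr ceta eta0 H s s01; apply: contrapT => ns.
pose B := [set t | 0 <= t <= 1 /\ ~ chart_ball c q r (eta t)].
have Bs : B s by [].
have B0 : has_inf B.
  by split; [exists s|exists 0 => t [/andP[]]].
pose m := inf B.
have m0 : 0 <= m by apply: lb_le_inf; [exists s|move=> t [/andP[]]].
have ms : m <= s by apply: ge_inf => //; exact: B0.2.
have m01 : 0 <= m <= 1 by rewrite m0 (le_trans ms)//; case/andP: s01.
have below t : 0 <= t < m -> chart_ball c q r (eta t).
  move=> /andP[t0 tm]; apply: contrapT => nt.
  have : B t by split=> //; rewrite t0 (ltW (lt_le_trans tm _))//; case/andP: m01.
  by move=> /(ge_inf B0.2); rewrite leNgt tm.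
have open_at t : 0 <= t <= 1 -> chart_ball c q r (eta t) ->
    exists2 e : R, 0 < e & forall u, `|t - u| < e -> chart_ball c q r (eta u).
  move=> t01 Bt; have : \forall u \near t, chart_ball c q r (eta u).
    by apply: (ceta t t01); apply: open_nbhs_nbhs; split => //; exact: chart_ball_open.
  by move=> /near_ex_ball[e e0 He]; exists e => // u tu; apply: He; rewrite -ball_normE.
have [Bm|nBm] := pselect (chart_ball c q r (eta m)).
  have [e e0 He] := open_at m m01 Bm.
  have [b [b01 nb] bm] := inf_adherent e0 B0.
  have mb : m <= b by apply: ge_inf; [exact: B0.2|split].
  apply: nb; apply: He; rewrite -/m in bm.
  by rewrite ler0_norm ?subr_le0// opprB ltrBlDl.
have m_gt0 : 0 < m.
  rewrite lt_neqAle m0 andbT; apply/eqP => m0'; apply: nBm.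
  by rewrite -m0'.
pose K := [set z | chart_dom c z /\ `|c z - q| <= r].
have cK : closed K by exact: chart_closed_ball_closed.
have Km : K (eta m).
  apply: cK => V /= nV; have : \forall u \near m, V (eta u) by exact: (ceta m m01).
  move=> /near_ex_ball[e e0 He].
  pose t := Num.max 0 (m - e / 2).
  have tm : t < m by rewrite gt_max m_gt0/= ltrBlDr ltrDl divr_gt0.
  have t0 : 0 <= t by rewrite le_max lexx.
  exists (eta t); split; last first.
    apply: He; rewrite -ball_normE /= gtr0_norm ?subr_gt0//.
    rewrite ltrBlDr -ltrBlDl lt_max; apply/orP; right.
    by rewrite ltrD2l ltrN2 ltr_pdivrMr// ltr_pMr// ltr1n.
  by have [Dt rt] := below t (introT andP (conj t0 tm)); split=> //; exact: ltW.
apply: nBm; split; first exact: Km.1.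
apply: H => // t /andP[t0]; rewrite le_eqVlt => /orP[/eqP ->//|tm].
by have [Dt rt] := below t (introT andP (conj t0 tm)); split=> //; exact: ltW.
Qed.

Lemma integral_curve_chart_speed X (gam : R -> M) c (t0 s t : R) :
  integral_curve X gam -> atlas c -> chart_dom c (gam (t0 + s * t)) ->
  is_derive t 1 (fun t => c (gam (t0 + s * t))) (s *: local_rep c X (c (gam (t0 + s * t)))).
Proof.
move=> Xg Ac D.
exact: (is_derive_affine (integral_curve_chart Xg Ac D)).
Qed.

(** Gronwall's inequality for the difference of two integral curves in a chart.
    The factor s rescales time, of either sign, to the unit interval. *)
Lemma curves_diverge (S L : R) : 0 <= S -> 0 <= L -> exists2 C : R, 1 <= C &
  forall X c q r (gam1 gam2 : R -> M) (t1 t2 s : R),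
  integral_curve X gam1 -> integral_curve X gam2 -> atlas c ->
  (forall y z, `|y - q| <= r -> `|z - q| <= r ->
    `|local_rep c X y - local_rep c X z| <= L * `|y - z|) -> `|s| <= S ->
  (forall t, 0 <= t <= 1 -> chart_ball c q r (gam1 (t1 + s * t)) /\ chart_ball c q r (gam2 (t2 + s * t))) ->
  `|c (gam1 (t1 + s)) - c (gam2 (t2 + s))| <= C * `|c (gam1 t1) - c (gam2 t2)|.
Proof.
move=> S0 L0; have [C C1 HC] := gronwall d (mulr_ge0 S0 L0).
exists C => // X c q r g1 g2 t1 t2 s X1 X2 Ac lip sS B.
pose u t := c (g1 (t1 + s * t)) - c (g2 (t2 + s * t)).
have := HC u (fun t => s *: local_rep c X (c (g1 (t1 + s * t))) - s *: local_rep c X (c (g2 (t2 + s * t)))) 0 1 (lexx _).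
rewrite /u !mulr1 !mulr0 !addr0 ler01 lexx; apply=> // t t01.
have [[D1 B1] [D2 B2]] := B t t01.
split.
  have d1 := integral_curve_chart_speed X1 Ac D1.
  have d2 := integral_curve_chart_speed X2 Ac D2.
  exact: is_deriveB d1 d2.
rewrite addr0 -scalerBr normrZ -mulrA ler_pM//; apply: lip; exact: ltW.
Qed.

End Uniqueness.

Section FlowProperties.
Context {R : realType} {d : nat} {M : manifold R d}.
Implicit Types (c : chart R d M) (x : M).

Lemma real_clopen (S : set R) t0 : S t0 ->
  (forall t, S t -> exists2 e : R, 0 < e & forall u, `|t - u| < e -> S u) ->
  (forall t, (forall e : R, 0 < e -> exists2 u, `|t - u| < e & S u) -> S t) -> forall t, S t.
Proof.
move=> S0 So Sc t.
have cT : connected [set: R] by apply/connected_intervalP => x y _ _ z _.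
have -> // : S = setT; apply: cT; first by exists t0.
  exists S; last by rewrite setTI.
  rewrite openE => u Su; have [e e0 He] := So u Su.
  by apply/nbhs_ballP; exists e => // z; rewrite -ball_normE; exact: He.
exists S; last by rewrite setTI.
move=> u clu; apply: Sc => e e0.
by have [z [Sz Bz]] := clu _ (nbhsx_ballx u _ e0); exists z => //; move: Bz; rewrite -ball_normE.
Qed.

Variables (X : vector_field M) (X1 : Ck_vector_field 1 X).

Lemma chart_lipschitz (q : M) : exists r L : R, [/\ 0 < r, 0 < L,
    forall y, `|y - chart_at q q| <= r -> chart_cod (chart_at q) y &
    forall y z, `|y - chart_at q q| <= r -> `|z - chart_at q q| <= r ->
      `|local_rep (chart_at q) X y - local_rep (chart_at q) X z| <= L * `|y - z|].
Proof.
apply: Ck1_lipschitz (@chart_cod_open _ _ _ (chart_at q)) _ _.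
  exact: X1 (chart_at_atlas q).
exact/chart_codP/chart_at_dom.
Qed.

Lemma chart_ball_center (q : M) r : 0 < r -> chart_ball (chart_at q) (chart_at q q) r q.
Proof. by move=> r0; split; [exact: chart_at_dom|rewrite subrr normr0]. Qed.

(** The set of times where the curves agree is open by the estimate on their
    distance, which vanishes initially, and closed as M is Hausdorff. *)
Lemma integral_curve_unique gam1 gam2 t0 : integral_curve X gam1 -> integral_curve X gam2 ->
  gam1 t0 = gam2 t0 -> forall t, gam1 t = gam2 t.
Proof.
move=> C1 C2 E0; apply: (real_clopen E0) => t.
  move=> Et; set q := gam1 t in Et; have [r [L [r0 L0 _ lip]]] := chart_lipschitz q.
  have N1 : \forall u \near t, chart_ball (chart_at q) (chart_at q q) r (gam1 u).
    apply: (C1 t).1; apply: open_nbhs_nbhs; split; first exact: chart_ball_open.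
    exact: chart_ball_center.
  have N2 : \forall u \near t, chart_ball (chart_at q) (chart_at q q) r (gam2 u).
    apply: (C2 t).1; apply: open_nbhs_nbhs; split; first exact: chart_ball_open.
    by rewrite -Et; exact: chart_ball_center.
  have [e e0 He] : exists2 e : R, 0 < e & forall u, ball t e u ->
      chart_ball (chart_at q) (chart_at q q) r (gam1 u) /\ chart_ball (chart_at q) (chart_at q q) r (gam2 u).
    by apply: near_ex_ball; exact: filterI N1 N2.
  exists e => // u tu.
  have [C _ HC] := @curves_diverge R d M e L (ltW e0) (ltW L0).
  have seg s : 0 <= s <= 1 -> ball t e (t + (u - t) * s).
    move=> /andP[s0 s1]; rewrite -ball_normE /= opprD addNKr normrN normrM (ger0_norm s0).
    by apply: le_lt_trans tu; rewrite distrC ler_piMr.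
  have ut : `|u - t| <= e by rewrite distrC ltW.
  have := HC X (chart_at q) (chart_at q q) r gam1 gam2 t t (u - t) C1 C2 (chart_at_atlas q) lip ut
    (fun s s01 => He _ (seg s s01)).
  rewrite -Et subrr normr0 mulr0 [t + _]addrC subrK normr_le0 subr_eq0 => /eqP E.
  have tu' : ball t e u by rewrite -ball_normE.
  have [[D1 _] [D2 _]] := He u tu'.
  by rewrite -(chartK D1) E chartK.
move=> Ht; apply: contrapT => /eqP ne.
have := manifold_hausdorff (m := M); rewrite open_hausdorff => /(_ _ _ ne)[[A B] /= [Ax By] [oA oB AB]].
have N1 : \forall u \near t, A (gam1 u).
  by apply: (C1 t).1; apply: open_nbhs_nbhs; split => //; exact/set_mem.
have N2 : \forall u \near t, B (gam2 u).
  by apply: (C2 t).1; apply: open_nbhs_nbhs; split => //; exact/set_mem.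
have [e e0 He] : exists2 e : R, 0 < e & forall u, ball t e u -> A (gam1 u) /\ B (gam2 u).
  by apply: near_ex_ball; exact: filterI N1 N2.
have [u tu Eu] := Ht e e0.
have [|Au Bu] := He u; first by rewrite -ball_normE.
by have : (A `&` B) (gam1 u); [split=> //; rewrite Eu|move/eqP: AB => ->].
Qed.

Lemma integral_curve_shift gam t : integral_curve X gam -> integral_curve X (fun s => gam (t + s)).
Proof.
move=> C s; have [cg Dg] := C (t + s); split.
  apply: (@continuous_comp _ _ _ (fun s => t + s) gam) => //.
  by apply: continuousD; [exact: cst_continuous|exact: cvg_id].
have E : gam \o (fun s => t + 1 * s) = (fun s => gam (t + s)).
  by rewrite funeqE => u /=; rewrite mul1r.
have Dg' : is_derive (t + 1 * s) 1 (chart_at (gam (t + s)) \o gam) (X (gam (t + s))).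
  by rewrite mul1r.
have := is_derive_affine Dg'; rewrite scale1r.
by rewrite (_ : (fun u : R => _) = chart_at (gam (t + s)) \o (fun s => gam (t + s)))// funeqE => u /=; rewrite mul1r.
Qed.

Lemma integral_curve_singular p : X p = 0 -> integral_curve X (fun=> p).
Proof.
move=> Xp t; split; first exact: cst_continuous.
by rewrite Xp; exact: is_derive_cst.
Qed.

Variables (Phi : R -> M -> M) (fl : is_flow X Phi).

Lemma flow0 x : Phi 0 x = x. Proof. by have [] := fl x. Qed.

Lemma flow_curve x : integral_curve X (Phi ^~ x). Proof. by have [] := fl x. Qed.

Lemma flow_add t s x : Phi (t + s) x = Phi s (Phi t x).
Proof.
apply: (integral_curve_unique (integral_curve_shift t (flow_curve x)) (flow_curve (Phi t x)) (t0 := 0)).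
by rewrite /= addr0 flow0.
Qed.

Lemma flow_time_continuous t x : {for t, continuous (Phi ^~ x)}.
Proof. by have [] := flow_curve x t. Qed.

Lemma flow_singular p t : X p = 0 -> Phi t p = p.
Proof.
move=> Xp; apply: (integral_curve_unique (flow_curve p) (integral_curve_singular Xp) (t0 := 0)).
exact: flow0.
Qed.

Lemma flow_regular x t : X x != 0 -> X (Phi t x) != 0.
Proof.
apply: contra_neq => X0.
have := flow_singular (- t) X0; rewrite -flow_add subrr flow0 => ->.
exact: X0.
Qed.

Lemma speed_continuous x (s t : R) : {for t, continuous (fun t => Phi (s * t) x)}.
Proof.
apply: (@continuous_comp _ _ _ (fun t => s * t) (Phi ^~ x)); last exact: flow_time_continuous.
by apply: continuousM; [exact: cst_continuous|exact: cvg_id].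
Qed.

Lemma speed_is_derive x c (s t : R) : atlas c -> chart_dom c (Phi (s * t) x) ->
  is_derive t 1 (fun t => c (Phi (s * t) x)) (s *: local_rep c X (c (Phi (s * t) x))).
Proof.
move=> Ac; rewrite -[s * t]add0r => D.
have := integral_curve_chart_speed (flow_curve x) Ac D.
by under eq_fun do rewrite add0r.
Qed.

End FlowProperties.

Section FixedVector.
Context {R : realType}.
Implicit Types V W : normedModType R.

(** Along the ray q + t v, the function F is o(t), so G moves the points of the
    ray by o(t) only. *)
Lemma diff_fixed_vector V W (F : V -> W) (G : V -> V) q v (K r : R) :
  differentiable F q -> F q = 0 -> 'd F q v = 0 ->
  differentiable G q -> G q = q -> 0 <= K -> 0 < r ->
  (forall y, `|y - q| < r -> `|G y - y| <= K * `|F y|) -> 'd G q v = v.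
Proof.
move=> dF Fq0 Fv dG G0 K0 r0 move_le.
apply/esym/subr0_eq/eqP; rewrite -normr_le0; apply/ler_addgt0Pr => e e0; rewrite add0r.
pose k := K + 1.
have k0 : 0 < k by rewrite ltr_wpDl.
pose e' := e / (k * (`|v| + 1)).
have v1 : 0 < `|v| + 1 by rewrite ltr_wpDl.
have e'0 : 0 < e' by rewrite divr_gt0// mulr_gt0.
have [e1 e10 H1] := near_ex_ball (differentiable_eps dF e'0).
have [e2 e20 H2] := near_ex_ball (differentiable_eps dG e'0).
pose rho := Num.min (Num.min e1 e2) r.
have rho0 : 0 < rho by rewrite !lt_min e10 e20.
pose t := rho / (2 * (`|v| + 1)).
have t0 : 0 < t by rewrite divr_gt0// mulr_gt0.
have tv : `|t *: v| < rho.
  rewrite normrZ gtr0_norm// /t mulrAC ltr_pdivrMr ?mulr_gt0// ltr_pM2l//.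
  by have := normr_ge0 v; lra.
move: (tv); rewrite !lt_min => /andP[/andP[tv1 tv2] tv3].
have b0 x : `|t *: v| < x -> ball 0 x (t *: v) by rewrite -ball_normE /= sub0r normrN.
have dFt : 'd F q (t *: v) = 0 by rewrite linearZ /= Fv scaler0.
have dGt : 'd G q (t *: v) = t *: 'd G q v by rewrite linearZ.
have := H1 _ (b0 _ tv1); rewrite Fq0 dFt !subr0 => B1.
have := H2 _ (b0 _ tv2); rewrite G0 dGt => B2.
have := move_le (t *: v + q); rewrite addrK => /(_ tv3) B3.
have : t * `|v - 'd G q v| <= t * e; last by rewrite ler_pM2l.
rewrite -[t in leLHS]gtr0_norm// -normrZ scalerBr.
have -> : t *: v - t *: 'd G q v = (G (t *: v + q) - q - t *: 'd G q v) - (G (t *: v + q) - (t *: v + q)).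
  set g := G _; set w := t *: v; set D := t *: _.
  rewrite opprB [RHS]addrAC; congr (_ - _).
  by rewrite -[w + q - g]addrA [RHS]addrCA -[q - g]opprB subrr addr0.
apply: (le_trans (ler_normB _ _)).
apply: (@le_trans _ _ (e' * `|t *: v| + K * (e' * `|t *: v|))).
  by apply: lerD B2 _; apply: (le_trans B3); rewrite ler_wpM2l.
rewrite normrZ (gtr0_norm t0).
rewrite (_ : _ + _ = t * (e' * k * `|v|)); last by rewrite /k; ring.
rewrite ler_pM2l// (_ : e' * k = e / (`|v| + 1)); last first.
  by rewrite /e'; field; rewrite !gt_eqF.
by rewrite mulrAC ler_pdivrMr// ler_pM2l// lerDl.
Qed.

End FixedVector.

Section FlowContinuity.
Context {R : realType} {d : nat} {M : manifold R d}.
Variables (X : vector_field M) (X1 : Ck_vector_field 1 X).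
Variables (Phi : R -> M -> M) (fl : is_flow X Phi).

Lemma flow_continuous_short (q : M) : exists (V : set M) (del : R), [/\ open V, V q, 0 < del &
  forall z s, V z -> `|s| < del -> {for z, continuous (Phi s)}].
Proof.
have [r [L [r0 L0 Hr lip]]] := chart_lipschitz X1 q.
set c := chart_at q in Hr lip *; set q0 := c q in Hr lip.
pose F := local_rep c X.
have [C0 C01 HC0] := gronwall d (lexx (0 : R)).
pose m := `|F q0| + L * r.
have Fm y : `|y - q0| <= r -> `|F y| <= m.
  move=> yr; rewrite -(subrK (F q0) (F y)) addrC (le_trans (ler_normD _ _))// lerD2l.
  have rr : `|q0 - q0| <= r by rewrite subrr normr0 ltW.
  by apply: (le_trans (lip y q0 yr rr)); rewrite ler_wpM2l// ltW.
have m0 : 0 <= m by rewrite addr_ge0// mulr_ge0// ltW.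
have C0_gt0 : 0 < C0 by exact: lt_le_trans C01.
pose del := r / (2 * C0 * (m + 1)).
have m1 : 0 < m + 1 by rewrite ltr_wpDl.
have dd : 0 < 2 * C0 * (m + 1) by rewrite !mulr_gt0.
have del0 : 0 < del by rewrite divr_gt0.
have r20 : 0 < r / 2 by rewrite divr_gt0.
pose V := chart_ball c q0 (r / 2).
have stay z s : V z -> `|s| < del -> forall t, 0 <= t <= 1 -> chart_ball c q0 r (Phi (s * t) z).
  move=> [Dz zr] sdel.
  apply: (no_escape Hr) => [t _||t t01 H]; first exact: speed_continuous.
    rewrite mulr0 (flow0 fl); split => //; apply: (lt_trans zr).
    by rewrite ltr_pdivrMr// ltr_pMr// ltr1n.
  have K0 : 0 <= `|s| * m by rewrite mulr_ge0.
  have := HC0 (fun t => c (Phi (s * t) z) - c z) (fun t => s *: F (c (Phi (s * t) z)) - 0) (`|s| * m) t K0 t01.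
  rewrite mulr0 (flow0 fl) subrr normr0 add0r => /(_ _)/le_lt_trans B.
  rewrite -(subrKA (c z)) (le_lt_trans (ler_normD _ _))// (splitr r) ltrD//.
  apply: B => [u ut|].
    have [Du Bu] := H u ut; split.
      exact: is_deriveB (speed_is_derive fl (chart_at_atlas q) Du) (is_derive_cst (c z) u 1).
    by rewrite mul0r add0r subr0 normrZ ler_wpM2l// Fm.
  have h1 : `|s| * (2 * C0 * (m + 1)) < r by rewrite -ltr_pdivlMr.
  rewrite ltr_pdivlMr//; apply: le_lt_trans h1.
  rewrite (_ : C0 * (`|s| * m) * 2 = `|s| * (2 * C0 * m)); last by ring.
  by rewrite ler_wpM2l// ler_wpM2l ?lerDl// mulr_ge0// ltW.
have [C C1 HC] := @curves_diverge R d M del L (ltW del0) (ltW L0).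
have C_gt0 : 0 < C by exact: lt_le_trans C1.
exists V, del; split => //; first exact: chart_ball_open.
  exact: chart_ball_center.
move=> z s Vz sdel W nW.
have [Ds _] : chart_ball c q0 r (Phi s z) by have := stay z s Vz sdel 1; rewrite mulr1 ler01 lexx; apply.
have icont := chart_inv_continuous_at (chart_codP Ds).
have : \forall y \near c (Phi s z), W (chart_inv c y).
  by apply: icont; rewrite /= chartK.
move=> /near_ex_ball[e e0 He].
have N1 : \forall z' \near z, V z' by apply: open_nbhs_nbhs; split => //; exact: chart_ball_open.
have N2 : \forall z' \near z, `|c z' - c z| < e / C.
  have eC : 0 < e / C by rewrite divr_gt0.
  have cc := @chart_continuous _ _ _ c z Vz.1.
  have B : nbhs (c z) (ball (c z) (e / C)) by exact: nbhsx_ballx.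
  have : \forall z' \near z, ball (c z) (e / C) (c z') by exact: (cc _ B).
  by apply: filterS => z'; rewrite -ball_normE /= distrC.
apply: filterS2 N1 N2 => z' Vz' zz'.
have := HC X c q0 r (Phi ^~ z') (Phi ^~ z) 0 0 s (flow_curve fl z') (flow_curve fl z) (chart_at_atlas q) lip (ltW sdel).
rewrite /= !add0r !(flow0 fl) => /(_ _)/le_lt_trans B.
have [Ds' _] : chart_ball c q0 r (Phi s z') by have := stay z' s Vz' sdel 1; rewrite mulr1 ler01 lexx; apply.
rewrite -(chartK Ds'); apply: He; rewrite -ball_normE /= distrC; apply: B.
  by move=> t t01; rewrite !add0r; split; exact: stay.
by rewrite mulrC -ltr_pdivlMr.
Qed.

(** The times t at which Phi t is continuous at x form an open and closed set,
    since short time maps are continuous near Phi t x and times add up. *)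
Lemma flow_continuous t : continuous (Phi t).
Proof.
move=> x; move: t.
apply: (@real_clopen _ [set t | {for x, continuous (Phi t)}] 0) => /=.
- have -> : Phi 0 = id by rewrite funeqE => y; exact: flow0.
  exact: cvg_id.
- move=> t ct; have [V [del [oV Vq del0 HV]]] := flow_continuous_short (Phi t x).
  exists del => // u tu.
  have -> : Phi u = Phi (u - t) \o Phi t.
    by rewrite funeqE => y /=; rewrite -(flow_add X1 fl) addrC subrK.
  by apply: (continuous_comp ct); apply: HV => //; rewrite distrC.
- move=> t Ht; have [V [del [oV Vq del0 HV]]] := flow_continuous_short (Phi t x).
  have : \forall u \near t, V (Phi u x).
    have nV : nbhs (Phi t x) V by exact: open_nbhs_nbhs.
    exact: (flow_time_continuous fl nV).
  move=> /near_ex_ball[e e0 He].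
  have [|u tu cu] := Ht (Num.min e del); first by rewrite lt_min e0.
  move: tu; rewrite lt_min => /andP[te td].
  have -> : Phi t = Phi (t - u) \o Phi u.
    by rewrite funeqE => y /=; rewrite -(flow_add X1 fl) addrC subrK.
  by apply: (continuous_comp cu); apply: HV => //; apply: He; rewrite -ball_normE.
Qed.

(** In time T a point y near the zero p moves by at most a multiple of the
    norm of X at y, which is o(h) at p + h v when the linear part of X kills v.
    So only the existence of the differential of the flow is needed to know
    its value on v. *)
Lemma flow_diff_singular p (v : 'rV[R]_d) (T : R) : X p = 0 ->
  'D_v (local_rep (chart_at p) X) (chart_at p p) = 0 ->
  differentiable (chart_at (Phi T p) \o Phi T \o chart_inv (chart_at p)) (chart_at p p) ->
  tangent_map (Phi T) p v = v.
Proof.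
move=> Xp; rewrite /tangent_map (flow_singular X1 fl T Xp).
have [r [L [r0 L0 Hr lip]]] := chart_lipschitz X1 p.
have Dp := chart_at_dom p.
set c := chart_at p in Hr lip Dp *; set q0 := c p in Hr lip *.
pose F := local_rep c X; rewrite -/F.
set G := (c \o Phi T) \o chart_inv c.
have Fq0 : F q0 = 0 by rewrite /F /q0 /c local_rep_at.
have Cq0 : chart_cod c q0 by exact: chart_codP.
have dF : differentiable F q0 by have [+ _] := X1 (chart_at_atlas p); apply.
rewrite (deriveE _ dF) => Fv dG.
have [C C1 HC] := gronwall d (mulr_ge0 (normr_ge0 T) (ltW L0)).
have C_gt0 : 0 < C by exact: lt_le_trans C1.
have G0 : G q0 = q0 by rewrite /G /= chartK// (flow_singular X1 fl T Xp).
have rr : `|q0 - q0| <= r by rewrite subrr normr0 ltW.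
have move_le y : `|y - q0| < r / C -> `|G y - y| <= C * (`|T| * `|F y|).
  move=> yr; have yr' : `|y - q0| <= r.
    by apply: (le_trans (ltW yr)); rewrite ler_pdivrMr// ler_peMr// ltW.
  have Cy := Hr y yr'; pose z := chart_inv c y.
  have Dz : chart_dom c z by exact: chart_domP.
  have cz : c z = y by exact: chart_invKe.
  have Flip w : `|w - q0| <= r -> `|F w| <= L * `|w - q0|.
    by move=> wr; have := lip w q0 wr rr; rewrite -/F Fq0 subr0.
  have stay : forall t, 0 <= t <= 1 -> chart_ball c q0 r (Phi (T * t) z).
    apply: (no_escape Hr) => [t _||t t01 H]; first exact: speed_continuous.
      by rewrite mulr0 (flow0 fl); split => //; rewrite cz (lt_le_trans yr)// ler_pdivrMr// ler_peMr// ltW.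
    have := HC (fun t => c (Phi (T * t) z) - q0) (fun t => T *: F (c (Phi (T * t) z)) - 0) 0 t (lexx _) t01.
    rewrite mulr0 (flow0 fl) cz addr0 => /(_ _)/le_lt_trans; apply; last by rewrite mulrC -ltr_pdivlMr.
    move=> u ut; have [Du Bu] := H u ut; split.
      exact: is_deriveB (speed_is_derive fl (chart_at_atlas p) Du) (is_derive_cst q0 u 1).
    by rewrite addr0 subr0 normrZ -mulrA ler_wpM2l// Flip.
  have K0 : 0 <= `|T| * `|F y| by rewrite mulr_ge0.
  have i01 : is_true ((0 : R) <= 1 <= (1 : R)).
    by apply/andP; split; [exact: ler01|exact: lexx].
  have := HC (fun t => c (Phi (T * t) z) - y) (fun t => T *: F (c (Phi (T * t) z)) - 0) _ 1 K0 i01.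
  rewrite mulr0 mulr1 (flow0 fl) cz subrr normr0 add0r; apply=> t t01.
  have [Dt Bt] := stay t t01; split.
    exact: is_deriveB (speed_is_derive fl (chart_at_atlas p) Dt) (is_derive_cst y t 1).
  rewrite subr0 normrZ -mulrA -mulrDr ler_wpM2l//.
  have := lip _ y (ltW Bt) yr'; rewrite -/F => h.
  by rewrite -(subrK (F y) (F (c _))) (le_trans (ler_normD _ _))// lerD2r.
have rC : 0 < r / C by rewrite divr_gt0.
apply: (diff_fixed_vector dF Fq0 Fv dG G0 (mulr_ge0 (ltW C_gt0) (normr_ge0 T)) rC) => y yr.
by rewrite -mulrA; exact: move_le.
Qed.

End FlowContinuity.

(** * Linear algebra of collinear fields *)

Section LinearAlgebra.
Context {R : realType} {d : nat}.
Implicit Types u v : 'rV[R]_d.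

(** Collinearity as polynomial equations, which can be differentiated. *)
Lemma collinear_minors u v : (\dim <<[:: u; v]>>%VS <= 1)%N ->
  forall i j, u 0 i * v 0 j = u 0 j * v 0 i.
Proof.
move=> H i j; have : ~~ free [:: u; v].
  by apply/negP => /eqP/= E; rewrite E in H.
rewrite free_cons negb_and negbK.
have -> : <<[:: v]>>%VS = <[v]>%VS by exact: span_seq1.
case/orP=> [/vlineP[k ->]|]; first by rewrite !mxE; ring.
by rewrite seq1_free negbK => /eqP ->; rewrite !mxE !mulr0.
Qed.

Lemma minors_proportional u v : u != 0 -> (forall i j, u 0 i * v 0 j = u 0 j * v 0 i) ->
  exists k, v = k *: u.
Proof.
move=> u0 H; have [i ui] : exists i, u 0 i != 0.
  apply: contrapT => nE; move/eqP: u0; apply; apply/rowP => i; rewrite mxE.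
  by apply/eqP; apply: contrapT => /negP ui; apply: nE; exists i.
exists (v 0 i / u 0 i); apply/rowP => j; rewrite mxE.
by apply: (mulfI ui); rewrite H mulrA [u 0 i * _]mulrC divfK// mulrC.
Qed.

(** Each B v is a multiple of A v; that the factor is the same for v and v0 is
    seen on v + v0, unless v and v0 are themselves proportional. *)
Lemma proportional_maps (A B : {linear 'rV[R]_d -> 'rV[R]_d}) : (forall v, A v = 0 -> v = 0) ->
  (forall v i j, (A v) 0 i * (B v) 0 j = (A v) 0 j * (B v) 0 i) ->
  exists k, forall v, B v = k *: A v.
Proof.
move=> Ainj H.
have A0 v : v != 0 -> A v != 0 by apply: contra_neq; exact: Ainj.
have mu v : v != 0 -> exists k, B v = k *: A v.
  by move=> v0; apply: minors_proportional (A0 v v0) (H v).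
have [[v0 v0N]|N] := pselect (exists v0 : 'rV[R]_d, v0 != 0); last first.
  exists 0 => v; have -> : v = 0 by apply/eqP; apply: contrapT => /negP v0; apply: N; exists v.
  by rewrite (linear0 A) (linear0 B) scaler0.
have [k Hk] := mu v0 v0N; exists k => v.
have [->|vN] := eqVneq v 0; first by rewrite (linear0 A) (linear0 B) scaler0.
have [kv Hkv] := mu v vN.
have Hs : exists l, B (v + v0) = l *: A (v + v0).
  have [->|sN] := eqVneq (v + v0) 0; last exact: mu.
  by exists 0; rewrite (linear0 A) (linear0 B) scaler0.
have [l Hl] := Hs.
have E : kv *: A v + k *: A v0 = l *: A v + l *: A v0.
  by rewrite -Hkv -Hk -(linearD B) Hl (linearD A) scalerDr.
have E' : (kv - l) *: A v = (l - k) *: A v0.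
  by rewrite !scalerBl; apply/eqP; rewrite subr_eq addrAC -subr_eq opprK E addrC.
have [lk|lk] := eqVneq l k.
  move: E'; rewrite lk subrr scale0r => /eqP; rewrite scaler_eq0 (negbTE (A0 v vN)) orbF subr_eq0.
  by move=> /eqP <-.
have l0 : l - k != 0 by rewrite subr_eq0.
have Ev0 : v0 = ((l - k)^-1 * (kv - l)) *: v.
  apply/eqP; rewrite -subr_eq0; apply/eqP; apply: Ainj.
  by rewrite linearB linearZ /= -scalerA E' scalerA mulVf// scale1r subrr.
set c := _ * _ in Ev0; have c0 : c != 0 by apply: contraNneq v0N => c0; rewrite Ev0 c0 scale0r.
have LA : A (c *: v) = c *: A v by rewrite linearZ.
have LB : B (c *: v) = c *: B v by rewrite linearZ.
by apply: (scalerI c0); rewrite -LB -Ev0 Hk Ev0 LA !scalerA mulrC.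
Qed.

Definition dot u v : R := \sum_i u 0 i * v 0 i.

Lemma dotZl k u v : dot (k *: u) v = k * dot u v.
Proof. by rewrite /dot mulr_sumr; apply: eq_bigr => i _; rewrite mxE mulrA. Qed.

Lemma dot_neq0 u : u != 0 -> dot u u != 0.
Proof.
apply: contra_neq => E; apply/rowP => i; rewrite mxE.
have /eqP := E; rewrite /dot psumr_eq0 => [/allP/(_ i)|j _]; last by rewrite -expr2 sqr_ge0.
by rewrite mem_index_enum => /(_ isT); rewrite mulf_eq0 orbb => /eqP.
Qed.

Lemma Ck_dot (V : normedModType R) k (U : set V) (f g : V -> 'rV[R]_d) : open U ->
  Ck k U f -> Ck k U g -> Ck k U (fun x => dot (f x) (g x)).
Proof.
move=> oU fk gk.
exact: (Ck_sum oU (fun i => CkM oU (Ck_comp_coord i oU fk) (Ck_comp_coord i oU gk))).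
Qed.

End LinearAlgebra.

(** * Norms of a Riemannian metric *)

Section Metric.
Context {R : realType}.

Definition qform d (H : 'M[R]_d) (u : 'rV[R]_d) : R := (u *m H *m u^T) 0 0.

Lemma qformE d (H : 'M[R]_d) u : qform H u = \sum_i \sum_j (u 0 j * H j i * u 0 i).
Proof.
rewrite /qform mxE; apply: eq_bigr => i _; rewrite !mxE mulr_suml.
by apply: eq_bigr => j _.
Qed.

Lemma qformZ d (H : 'M[R]_d) k u : qform H (k *: u) = k ^+ 2 * qform H u.
Proof.
rewrite !qformE mulr_sumr; apply: eq_bigr => i _; rewrite mulr_sumr.
by apply: eq_bigr => j _; rewrite !mxE; ring.
Qed.

Lemma qform0 d (H : 'M[R]_d) : qform H 0 = 0.
Proof. by rewrite /qform !mul0mx mxE. Qed.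

Lemma qform_continuous d (H : 'M[R]_d) : continuous (qform H).
Proof.
move=> u; have oT : open [set: 'rV[R]_d] by exact: openT.
have C := Ck_sum oT (fun i => Ck_sum oT (fun j =>
  CkM oT (CkM oT (Ck_coord 0 j oT) (Ck_cst 0 (H j i) oT)) (Ck_coord 0 i oT))).
have -> : qform H = fun u => \sum_i \sum_j (u 0 j * H j i * u 0 i).
  by rewrite funeqE => v; exact: qformE.
exact: Ck_continuous oT C _.
Qed.

Lemma qform_norm_le d (H : 'M[R]_d) u : `|qform H u| <= (\sum_i \sum_j `|H j i|) * `|u| ^+ 2.
Proof.
rewrite qformE mulr_suml (le_trans (ler_norm_sum _ _ _))//.
apply: ler_sum => i _; rewrite mulr_suml (le_trans (ler_norm_sum _ _ _))//.
apply: ler_sum => j _; rewrite !normrM [`|u 0 j| * _]mulrC -mulrA ler_wpM2l// expr2.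
by rewrite ler_pM// ler_coord.
Qed.

(** The minimum over the unit sphere, which is compact. *)
Lemma qform_bound d (H : 'M[R]_d) : (forall u, u != 0 -> 0 < qform H u) ->
  exists2 m : R, 0 < m & forall u, m * `|u| ^+ 2 <= qform H u.
Proof.
move=> Hpos; pose S := [set u : 'rV[R]_d | `|u| = 1].
have [[u0 Su0]|S0] := pselect (S !=set0); last first.
  exists 1 => // u; have [->|un0] := eqVneq u 0; first by rewrite normr0 qform0 expr0n mulr0.
  case: S0; exists (`|u|^-1 *: u); rewrite /S /= normrZ ger0_norm ?invr_ge0//.
  by rewrite mulVf// normr_eq0.
have cS : compact S.
  apply: bounded_closed_compact.
    by exists 1; split; [exact: num_real|move=> M M1 u /= ->; exact: ltW].
  apply: (@closed_comp _ _ (fun u : 'rV[R]_d => `|u|) [set t | t = 1]) => [u _|]; last exact: closed_eq.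
  exact: norm_continuous.
have [|u1 /set_mem Su1 Hu1] := @EVT_min_rV R d (qform H) S (ex_intro _ u0 Su0) cS.
  by apply: continuous_subspaceT => u; exact: qform_continuous.
have u10 : u1 != 0 by rewrite -normr_eq0 Su1 oner_neq0.
exists (qform H u1); first exact: Hpos.
move=> u; have [->|un0] := eqVneq u 0; first by rewrite normr0 qform0 expr0n mulr0.
have nu : `|u| != 0 by rewrite normr_eq0.
have Sw : S (`|u|^-1 *: u) by rewrite /S /= normrZ ger0_norm ?invr_ge0// mulVf.
rewrite -[u in leRHS]scale1r -(divff nu) -scalerA qformZ mulrC ler_wpM2l ?sqr_ge0//.
by apply: Hu1; exact/mem_set.
Qed.

End Metric.

Section RiemannianMetric.
Context {R : realType} {d : nat} {M : manifold R d}.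
Variable g : riemannian_metric M.

Lemma riem_normE x v : riem_norm g x v = Num.sqrt (qform (riem_mx g x) v).
Proof. by []. Qed.

Lemma riem_qform_ge0 x v : 0 <= qform (riem_mx g x) v.
Proof.
have [->|v0] := eqVneq v 0; first by rewrite qform0.
exact/ltW/riem_pos.
Qed.

Lemma riem_norm_sqr x v : riem_norm g x v ^+ 2 = qform (riem_mx g x) v.
Proof. by rewrite riem_normE sqr_sqrtr// riem_qform_ge0. Qed.

Lemma riem_norm_ge0 x v : 0 <= riem_norm g x v. Proof. exact: sqrtr_ge0. Qed.

Lemma riem_normZ x k v : riem_norm g x (k *: v) = `|k| * riem_norm g x v.
Proof. by rewrite !riem_normE qformZ sqrtrM ?sqr_ge0// sqrtr_sqr. Qed.

Lemma riem_norm_eq0 x v : riem_norm g x v = 0 -> v = 0.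
Proof.
move=> E; apply/eqP; apply: contrapT => /negP v0.
by have := riem_pos g x v0; rewrite -[X in 0 < X]riem_norm_sqr E expr0n ltxx.
Qed.

(** The set of which the operator norm is the supremum is bounded, as the unit
    ball of the metric is; without this the supremum would be the default value
    0 and would bound nothing. *)
Lemma op_norm_contracts x y (E : {vspace 'rV[R]_d}) (A : {linear 'rV[R]_d -> 'rV[R]_d}) (k : R) :
  op_norm g x y E A < k -> forall v, v \in E -> riem_norm g y (A v) <= k * riem_norm g x v.
Proof.
move=> Ak v vE.
have [v0|v0] := eqVneq (riem_norm g x v) 0.
  by rewrite (riem_norm_eq0 v0) (linear0 A) riem_normE qform0 sqrtr0 riem_normE qform0 sqrtr0 mulr0.
move: Ak; rewrite /op_norm; set S := image _ _ => Ak.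
have [m m0 Hm] := qform_bound (riem_pos g x).
have [K K0 HK] : exists2 K : R, 0 <= K & forall w, `|A w| <= K * `|w|.
  exists (\sum_j `|A 'e_j|) => [|w]; first exact: sumr_ge0.
  rewrite {1}(row_sum_delta w) linear_sum mulr_suml (le_trans (ler_norm_sum _ _ _))//.
  by apply: ler_sum => j _; rewrite linearZ normrZ mulrC ler_wpM2l// ler_coord.
pose H := \sum_i \sum_j `|riem_mx g y j i|.
have H0 : 0 <= H by apply: sumr_ge0 => i _; exact: sumr_ge0.
have supS : has_sup S.
  split; first by exists (riem_norm g y (A 0)), 0; split => //; [exact: mem0v|rewrite riem_normE qform0 sqrtr0].
  exists (Num.sqrt (H * (K ^+ 2 / m))) => _ [w [wE w1] <-].
  rewrite riem_normE ler_wsqrtr// (le_trans (ler_norm _))// (le_trans (qform_norm_le _ _))//.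
  rewrite ler_wpM2l// (@le_trans _ _ ((K * `|w|) ^+ 2))//.
    by rewrite lerXn2r ?nnegrE// mulr_ge0.
  rewrite exprMn ler_wpM2l ?sqr_ge0// -[m^-1]mul1r ler_pdivlMr// mulrC (le_trans (Hm w))//.
  by rewrite -/(qform _ _) -riem_norm_sqr expr_le1// riem_norm_ge0.
have n0 : 0 < riem_norm g x v by rewrite lt_neqAle eq_sym v0 riem_norm_ge0.
have : S (riem_norm g y (A ((riem_norm g x v)^-1 *: v))).
  exists ((riem_norm g x v)^-1 *: v) => //; split; first exact: memvZ.
  by rewrite riem_normZ ger0_norm ?invr_ge0 ?riem_norm_ge0// mulVf.
move=> /(ub_le_sup supS.2)/le_lt_trans/(_ Ak).
rewrite linearZ riem_normZ ger0_norm ?invr_ge0 ?riem_norm_ge0// mulrC ltr_pdivrMr//.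
exact: ltW.
Qed.

End RiemannianMetric.

(** * The quotient of two collinear commuting fields *)

Section ScaledField.
Context {R : realType}.

Lemma linear_formZ (V : normedModType R) (l : {linear V -> R}) k v : l (k *: v) = k * l v.
Proof. by rewrite linearZ. Qed.

Lemma derive_scaled_scalar (V : normedModType R) (F al be : V -> R) q v :
  differentiable F q -> differentiable al q -> (\forall y \near q, be y = F y * al y) ->
  'D_v be q - 'D_(F q *: v) al q = 'd F q v * al q.
Proof.
move=> dF da N.
have N' : \forall y \near q, (F * al) y = be y by apply: filterS N => y ->.
have dFa := differentiableM dF da.
have E1 : 'D_(F q *: v) al q = F q * 'd al q v := etrans (deriveE _ da) (linear_formZ _ _ _).
have E3 : 'd (F * al) q v = F q * 'd al q v + al q * 'd F q v := congr1 (fun h : V -> R => h v) (diffM dF da).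
have E2 : 'D_v be q = F q * 'd al q v + al q * 'd F q v.
  exact: etrans (esym (near_eq_derive v N')) (etrans (deriveE v dFa) E3).
apply: (etrans (f_equal2 (fun x y => x - y) E2 E1)).
move: ('d al q v) ('d F q v) => x y.
by rewrite addrAC subrr add0r mulrC.
Qed.

(** The Leibniz rule; for v = a q the left side is the bracket of a with F a,
    in which the derivatives of a cancel. *)
Lemma derive_scaled_field (V : normedModType R) m (F : V -> R) (a b : V -> 'rV[R]_m) q v :
  differentiable F q -> differentiable a q -> (\forall y \near q, b y = F y *: a y) ->
  'D_v b q - 'D_(F q *: v) a q = 'd F q v *: a q.
Proof.
move=> dF da N.
have daj j := differentiable_comp_coord j da.
have Nj j : \forall y \near q, b y 0 j = F y * a y 0 j.
  by apply: filterS N => y ->; rewrite mxE.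
have Nj' j : \forall y \near q, (F * (fun y => a y 0 j)) y = b y 0 j.
  by apply: filterS (Nj j) => y ->.
have dbj j : differentiable (fun y => b y 0 j) q.
  exact: near_eq_differentiable (Nj' j) (differentiableM dF (daj j)).
have db : differentiable b q := differentiable_rV dbj.
apply/rowP => j; rewrite coordB [RHS]mxE -(derive_coord j v db) -(derive_coord j _ da).
exact: derive_scaled_scalar dF (daj j) (Nj j).
Qed.

End ScaledField.

Section Quotient.
Context {R : realType} {d : nat} {M : manifold R d}.
Implicit Types (c : chart R d M) (x : M).
Variables (X Y : vector_field M).
Hypotheses (d_gt0 : (0 < d)%N) (Xd : Ck_vector_field d X) (Yd : Ck_vector_field d Y).
Hypothesis bracket0 : forall x, lie_bracket X Y x = 0.
Hypothesis collinear : forall x, (\dim <<[:: X x; Y x]>>%VS <= 1)%N.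

(** The function f with Y = f X; at a zero of X its value is the factor
    between the linear parts of Y and X, as continuity requires when the linear
    part of X is injective. *)
Definition quotient x : R :=
  if X x == 0 then
    xget 0 [set k | forall v, 'd (local_rep (chart_at x) Y) (chart_at x x) v =
      k *: 'd (local_rep (chart_at x) X) (chart_at x x) v]
  else dot (Y x) (X x) / dot (X x) (X x).

Lemma quotientE x : X x != 0 -> Y x = quotient x *: X x.
Proof.
move=> Xx; have [k Ek] := minors_proportional Xx (collinear_minors (collinear x)).
by rewrite /quotient (negbTE Xx) {2}Ek dotZl mulfK ?dot_neq0.
Qed.

Lemma to_chart0 c x : to_chart c x 0 = 0 :> 'rV[R]_d.
Proof. by rewrite /to_chart linear0. Qed.

Lemma local_rep_eq0 (Z : vector_field M) c y : atlas c -> chart_cod c y ->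
  (local_rep c Z y == 0) = (Z (chart_inv c y) == 0).
Proof.
move=> Ac Cy; apply/eqP/eqP => [E|E]; last by rewrite /local_rep E to_chart0.
rewrite -(to_chartK (Z (chart_inv c y)) Ac (chart_domP Cy)) -/(local_rep c Z y) E.
by rewrite /of_chart linear0.
Qed.

Lemma local_rep_quotient c y : chart_cod c y -> X (chart_inv c y) != 0 ->
  local_rep c Y y = quotient (chart_inv c y) *: local_rep c X y.
Proof.
by move=> Cy Xy; rewrite {1}/local_rep quotientE// /to_chart linearZ.
Qed.

Definition regular_cod c := [set y | chart_cod c y /\ local_rep c X y != 0].

Lemma regular_cod_open c : atlas c -> open (regular_cod c).
Proof.
move=> Ac; have oC := @chart_cod_open _ _ _ c.
have : {in chart_cod c, continuous (local_rep c X)}.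
  by move=> y /set_mem Cy; exact: Ck_continuous oC (Xd Ac) Cy.
move=> /(continuous_inP _ oC)/(_ [set v : 'rV[R]_d | v != 0]); apply.
have -> : [set v : 'rV[R]_d | v != 0] = ~` [set 0].
  by rewrite predeqE => v; split=> [/eqP //|/eqP].
by apply: closed_openC; apply: accessible_closed_set1; apply: hausdorff_accessible; exact: norm_hausdorff.
Qed.

(** In coordinates f is the quotient of the inner products (Y, X) and (X, X), so
    no derivative is lost. *)
Lemma quotient_Ck c : atlas c -> Ck d (regular_cod c) (quotient \o chart_inv c).
Proof.
move=> Ac; have oC := @chart_cod_open _ _ _ c; have oU := regular_cod_open Ac.
have sub : regular_cod c `<=` chart_cod c by move=> y [].
have CX := Ck_sub oC oU sub (Xd Ac); have CY := Ck_sub oC oU sub (Yd Ac).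
have n0 y : regular_cod c y -> dot (local_rep c X y) (local_rep c X y) != 0.
  by move=> [_]; exact: dot_neq0.
have C := CkM oU (Ck_dot oU CY CX) (CkV oU n0 (Ck_dot oU CX CX)).
apply: (Ck_eq oU _ C) => y Uy; have [Cy Xy] := Uy.
have Xy' : X (chart_inv c y) != 0 by rewrite -local_rep_eq0.
by rewrite (local_rep_quotient Cy Xy') dotZl mulfK// n0.
Qed.

Lemma regular_codP c x : atlas c -> chart_dom c x -> X x != 0 -> regular_cod c (c x).
Proof.
move=> Ac Dx Xx; split; first exact: chart_codP.
by rewrite local_rep_eq0 ?chartK//; exact: chart_codP.
Qed.

Lemma quotient_differentiable c x : atlas c -> chart_dom c x -> X x != 0 ->
  differentiable (quotient \o chart_inv c) (c x).
Proof.
move=> Ac Dx Xx; have [+ _] := Ck_le (regular_cod_open Ac) d_gt0 (quotient_Ck Ac).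
by apply; exact: regular_codP.
Qed.

Lemma quotient_continuous_regular x : X x != 0 -> {for x, continuous quotient}.
Proof.
move=> Xx; set c := chart_at x; have Dx : chart_dom c x by exact: chart_at_dom.
have df := quotient_differentiable (chart_at_atlas x) Dx Xx.
move=> W nW.
have cf : {for c x, continuous (quotient \o chart_inv c)} by exact: differentiable_continuous df.
have nW' : nbhs ((quotient \o chart_inv c) (c x)) W by rewrite /= chartK.
have N1 : \forall y \near c x, W (quotient (chart_inv c y)) by exact: (cf _ nW').
have N2 : \forall z \near x, W (quotient (chart_inv c (c z))) by exact: (chart_continuous Dx N1).
have N3 : \forall z \near x, chart_dom c z.
  by apply: open_nbhs_nbhs; split => //; exact: chart_dom_open.
by apply: filterS2 N2 N3 => z Wz Dz; rewrite chartK in Wz.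
Qed.

(** The bracket of X with f X is (df X) X. *)
Lemma dform_field x : X x != 0 -> dform quotient x (X x) = 0.
Proof.
move=> Xx; set c := chart_at x; have Dx : chart_dom c x by exact: chart_at_dom.
have Ac : atlas c by exact: chart_at_atlas.
set q := c x; have Cq : chart_cod c q by exact: chart_codP.
pose F := quotient \o chart_inv c.
have dF : differentiable F q by exact: quotient_differentiable.
have oU := regular_cod_open Ac; have Uq : regular_cod c q by exact: regular_codP.
have oC := @chart_cod_open _ _ _ c.
have dX : differentiable (local_rep c X) q by have [+ _] := Ck_le oC d_gt0 (Xd Ac); apply.
have dY : differentiable (local_rep c Y) q by have [+ _] := Ck_le oC d_gt0 (Yd Ac); apply.
have N : \forall y \near q, local_rep c Y y = F y *: local_rep c X y.
  apply: filterS (open_near oU Uq) => y [Cy Xy]; apply: local_rep_quotient => //.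
  by rewrite -local_rep_eq0.
have EX : local_rep c X q = X x by exact: local_rep_at.
have Fq : F q = quotient x by rewrite /F /= chartK.
have := bracket0 x; rewrite /lie_bracket -/c -/q quotientE// -Fq => B.
have := derive_scaled_field (X x) dF dX N; rewrite B EX => /esym/eqP.
by rewrite scaler_eq0 (negbTE Xx) orbF => /eqP.
Qed.

End Quotient.

Section SingularAux.
Context {R : realType}.

Lemma linear_bounded_below d (A : {linear 'rV[R]_d -> 'rV[R]_d}) : (forall v, A v = 0 -> v = 0) ->
  exists2 m : R, 0 < m & forall v, m * `|v| <= `|A v|.
Proof.
move=> Ainj; pose J := lin1_mx A.
have Q u : qform (J *m J^T) u = dot (A u) (A u).
  rewrite /qform mulmxA -mulmxA -trmx_mul mul_rV_lin1 mxE /dot.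
  by apply: eq_bigr => i _; rewrite mxE.
have [|m m0 Hm] := @qform_bound _ _ (J *m J^T).
  move=> u u0; rewrite Q lt_neqAle eq_sym dot_neq0/=; last by apply: contra_neq u0; exact: Ainj.
  by apply: sumr_ge0 => i _; rewrite -expr2 sqr_ge0.
have d1 : 0 < d.+1%:R :> R by rewrite ltr0n.
exists (Num.sqrt (m / d.+1%:R)) => [|v]; first by rewrite sqrtr_gt0 divr_gt0.
have p0 : 0 <= m / d.+1%:R by rewrite divr_ge0// ltW.
rewrite -ler_sqr ?nnegrE ?mulr_ge0 ?sqrtr_ge0// exprMn sqr_sqrtr// mulrAC ler_pdivrMr//.
apply: (le_trans (Hm v)); rewrite Q.
apply: (@le_trans _ _ (\sum_(i < d) `|A v| ^+ 2)).
  apply: ler_sum => i _; rewrite -expr2 -real_normK ?num_real// lerXn2r ?nnegrE//.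
  exact: ler_coord.
by rewrite sumr_const card_ord -[leLHS]mulr_natr ler_wpM2l ?sqr_ge0// ler_nat.
Qed.

Lemma differentiable_near (V W : normedModType R) (f : V -> W) x : differentiable f x ->
  forall e : R, 0 < e -> \forall y \near x, `|f y - f x - 'd f x (y - x)| <= e * `|y - x|.
Proof.
move=> df e e0; have [r r0 Hr] := near_ex_ball (differentiable_eps df e0).
have : \forall y \near x, ball x r y by exact: nbhsx_ballx.
apply: filterS => y xy; have := Hr (y - x); rewrite subrK; apply.
by move: xy; rewrite -!ball_normE /= sub0r normrN distrC.
Qed.

(** Compare the terms of order h^2 on both sides at q + h v. *)
Lemma minors_derivative (V : normedModType R) (a b a' b' : V -> R) q v :
  differentiable a q -> differentiable b q -> differentiable a' q -> differentiable b' q ->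
  a q = 0 -> b q = 0 -> a' q = 0 -> b' q = 0 ->
  (\forall y \near q, a y * b' y = a' y * b y) ->
  'd a q v * 'd b' q v = 'd a' q v * 'd b q v.
Proof.
move=> da db da' db' a0 b0 a'0 b'0 N.
have L (f : V -> R) : differentiable f q -> f q = 0 ->
    (fun h : R => h^-1 * f (h *: v + q)) @ (0 : R)^' --> 'd f q v.
  move=> df f0; have Df : derivable f q v by exact: diff_derivable.
  rewrite -(deriveE _ df); move: Df; rewrite /derivable /derive.
  have -> : (fun h : R => h^-1 *: ((f \o shift q) (h *: v) - f q)) = (fun h : R => h^-1 * f (h *: v + q)).
    by rewrite funeqE => h; rewrite f0 subr0.
  exact.
pose G1 h : R := (h^-1 * a (h *: v + q)) * (h^-1 * b' (h *: v + q)).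
pose G2 h : R := (h^-1 * a' (h *: v + q)) * (h^-1 * b (h *: v + q)).
have A : G1 h @[h --> (0 : R)^'] --> 'd a q v * 'd b' q v by exact: cvgM (L a da a0) (L b' db' b'0).
have B : G2 h @[h --> (0 : R)^'] --> 'd a' q v * 'd b q v by exact: cvgM (L a' da' a'0) (L b db b0).
have N0 : \forall h \near (0 : R), a (h *: v + q) * b' (h *: v + q) = a' (h *: v + q) * b (h *: v + q).
  have C : {for (0 : R), continuous (fun h : R => h *: v + q)}.
    apply: (@continuousD _ _ _ (fun h : R => h *: v) (fun=> q)); last exact: cst_continuous.
    by apply: cvgZr_tmp; exact: cvg_id.
  have N' : \forall y \near (0 : R) *: v + q, a y * b' y = a' y * b y by rewrite scale0r add0r.
  exact: (C _ N').
have B' : G1 h @[h --> (0 : R)^'] --> 'd a' q v * 'd b q v.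
  have E12 : \forall h \near (0 : R)^', G2 h = G1 h.
    apply: nbhs_dnbhs; apply: filterS N0 => h E.
    by rewrite /G1 /G2 mulrACA -E mulrACA.
  by apply: cvg_trans B; exact: near_eq_cvg E12.
exact: (cvg_unique (@norm_hausdorff _ _) A B').
Qed.

End SingularAux.

Section QuotientSingular.
Context {R : realType} {d : nat} {M : manifold R d}.
Implicit Types (c : chart R d M) (x : M).
Variables (X Y : vector_field M).
Hypotheses (d_gt0 : (0 < d)%N) (Xd : Ck_vector_field d X) (Yd : Ck_vector_field d Y).
Hypothesis bracket0 : forall x, lie_bracket X Y x = 0.
Hypothesis collinear : forall x, (\dim <<[:: X x; Y x]>>%VS <= 1)%N.
Variable p : M.
Let c := chart_at p.
Let q := c p.
Let FX := local_rep c X.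
Let FY := local_rep c Y.
Hypothesis Xp : X p = 0.
Hypothesis X_nondegenerate : forall v, 'd FX q v = 0 -> v = 0.

Let Dp : chart_dom c p. Proof. exact: chart_at_dom. Qed.
Let Cq : chart_cod c q. Proof. exact: chart_codP. Qed.
Let oC : open (chart_cod c). Proof. exact: chart_cod_open. Qed.
Let Ac : atlas c. Proof. exact: chart_at_atlas. Qed.
Let dX : differentiable FX q. Proof. by have [+ _] := Ck_le oC d_gt0 (Xd Ac); apply. Qed.
Let dY : differentiable FY q. Proof. by have [+ _] := Ck_le oC d_gt0 (Yd Ac); apply. Qed.
Let FXq : FX q = 0. Proof. by rewrite /FX /q local_rep_at. Qed.

(** At a zero of X the bracket is the image of - Y under the linear part of X. *)
Lemma commuting_field_singular : Y p = 0.
Proof.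
have := bracket0 p; rewrite /lie_bracket Xp derive0 sub0r => /eqP; rewrite oppr_eq0 => /eqP.
by rewrite deriveE//; exact: X_nondegenerate.
Qed.

Let FYq : FY q = 0. Proof. by rewrite /FY /q local_rep_at commuting_field_singular. Qed.

(** At a common zero the collinearity equations are quadratic to leading order,
    so that they pass to the linear parts. *)
Lemma linear_parts_proportional : exists k, forall v, 'd FY q v = k *: 'd FX q v.
Proof.
apply: proportional_maps; first exact: X_nondegenerate.
move=> v i j.
have N : \forall y \near q, FX y 0 i * FY y 0 j = FX y 0 j * FY y 0 i.
  apply: filterS (open_near oC Cq) => y Cy.
  have [X0|Xy] := eqVneq (X (chart_inv c y)) 0.
    by rewrite /FX /local_rep X0 to_chart0 !mxE !mul0r.
  by rewrite /FY (local_rep_quotient collinear Cy Xy) !mxE -/FX; ring.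
have E0 (f : 'rV[R]_d -> 'rV[R]_d) l : f q = 0 -> f q 0 l = 0 by move=> ->; rewrite mxE.
have H := minors_derivative v (differentiable_comp_coord i dX) (differentiable_comp_coord i dY)
  (differentiable_comp_coord j dX) (differentiable_comp_coord j dY)
  (E0 _ i FXq) (E0 _ i FYq) (E0 _ j FXq) (E0 _ j FYq) N.
exact: etrans (f_equal2 (fun s t => s * t) (esym (diff_coord i v dX)) (esym (diff_coord j v dY)))
  (etrans H (f_equal2 (fun s t => s * t) (diff_coord j v dX) (diff_coord i v dY))).
Qed.

Lemma field_bounded_below : exists2 m : R, 0 < m & \forall y \near q, m * `|y - q| <= `|FX y|.
Proof.
have [m m0 Hm] := linear_bounded_below X_nondegenerate.
have m20 : 0 < m / 2 by rewrite divr_gt0.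
exists (m / 2) => //; apply: filterS (differentiable_near dX m20) => y.
rewrite FXq subr0 => Hy; have := Hm (y - q) => Hq.
have := ler_normD (FX y) ('d FX q (y - q) - FX y); rewrite addrC subrK distrC => T.
by lra.
Qed.

Let near_chart_q (P : set 'rV[R]_d) : (\forall y \near q, P y) -> \forall z \near p, P (c z).
Proof. by move=> N; exact: (chart_continuous Dp N). Qed.

Let near_dom : \forall z \near p, chart_dom c z.
Proof. by apply: open_nbhs_nbhs; split => //; exact: chart_dom_open. Qed.

Lemma singularity_isolated : \forall z \near p, z != p -> X z != 0.
Proof.
have [m m0 /near_chart_q N] := field_bounded_below.
apply: filterS2 near_dom N => z Dz Hz zp.
have cz : c z != q.
  by apply: contra_neq zp => E; rewrite -(chartK Dz) E /q chartK.
have : FX (c z) != 0.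
  by rewrite -normr_gt0 (lt_le_trans _ Hz)// mulr_gt0// normr_gt0 subr_eq0.
by rewrite (local_rep_eq0 X Ac (chart_codP Dz)) chartK.
Qed.

(** With l the factor between the linear parts, Y - l X is o(h) at distance h
    from p, while the norm of X is at least m h. *)
Lemma quotient_continuous_singular : {for p, continuous (quotient X Y)}.
Proof.
set l := quotient X Y p.
have Hl v : 'd FY q v = l *: 'd FX q v.
  have [k Hk] := linear_parts_proportional.
  have := @xgetPex _ 0 [set k | forall v, 'd FY q v = k *: 'd FX q v] (ex_intro _ k Hk).
  by rewrite /l /quotient Xp eqxx; apply.
have [m m0 /near_chart_q Nm] := field_bounded_below.
apply/cvgrPdist_lt => e e0 /=; rewrite -/l.
have l1 : 0 < 1 + `|l| by rewrite ltr_wpDr.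
pose e1 := e * m / (2 * (1 + `|l|)).
have e10 : 0 < e1 by rewrite divr_gt0// ?mulr_gt0.
have /near_chart_q NX := differentiable_near dX e10.
have /near_chart_q NY := differentiable_near dY e10.
have N := filterI near_dom (filterI singularity_isolated (filterI Nm (filterI NX NY))).
have FF : Filter (nbhs p) by exact: nbhs_filter.
suff S : nbhs p [set z | `|l - quotient X Y z| < e] by exact: S.
apply: filterS (N FF FF FF FF) => z [Dz [iso [Hm [HX HY]]]] /=.
have [->|zp] := eqVneq z p; first by rewrite subrr normr0.
have Xz : X z != 0 by exact: iso.
have cz : c z != q.
  by apply: contra_neq zp => E; rewrite -(chartK Dz) E /q chartK.
have h0 : 0 < `|c z - q| by rewrite normr_gt0 subr_eq0.
have E : FY (c z) = quotient X Y z *: FX (c z).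
  by rewrite /FY (local_rep_quotient collinear (chart_codP Dz)) chartK.
rewrite FXq subr0 in HX; rewrite FYq subr0 Hl E in HY.
set h := `|c z - q| in h0 Hm HX HY; set a := FX (c z) in Hm HX HY; set b := 'd FX q (c z - q) in HX HY.
have S : `|l - quotient X Y z| * `|a| <= (1 + `|l|) * (e1 * h).
  rewrite -normrZ scalerBl -normrN opprB.
  have -> : quotient X Y z *: a - l *: a = (quotient X Y z *: a - l *: b) - l *: (a - b).
    by rewrite scalerBr opprB addrA subrK.
  by rewrite (le_trans (ler_normB _ _))// mulrDl mul1r lerD// normrZ ler_wpM2l.
have T : `|l - quotient X Y z| * (m * h) <= (1 + `|l|) * (e1 * h).
  by apply: le_trans S; rewrite ler_wpM2l.
have T' : `|l - quotient X Y z| * (m * h) <= e / 2 * (m * h).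
  apply: (le_trans T); rewrite le_eqVlt; apply/orP; left; apply/eqP; rewrite /e1; field.
  by rewrite gt_eqF.
rewrite ler_pM2r ?mulr_gt0// in T'.
by apply: (le_lt_trans T'); rewrite ltr_pdivrMr// ltr_pMr// ltr1n.
Qed.

End QuotientSingular.

(** * The flow, or the identity in its absence *)

Section TameFlow.
Context {R : realType} {d : nat} {M : manifold R d}.

(** What the proof uses of the flow. Existence of the global flow is never
    established: a field without one has the identity for flow by definition,
    and the identity has these properties too. *)
Record tame_flow (X : vector_field M) (Phi : R -> M -> M) : Prop := TameFlow {
  tame0 : forall x, Phi 0 x = x;
  tameD : forall t s x, Phi (t + s) x = Phi s (Phi t x);
  tame_continuous : forall t, continuous (Phi t);
  tame_time_continuous : forall x, continuous (Phi ^~ x);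
  tame_singular : forall p t, X p = 0 -> Phi t p = p;
  tame_diff_singular : forall p v t, X p = 0 ->
    'd (local_rep (chart_at p) X) (chart_at p p) v = 0 ->
    differentiable (chart_at (Phi t p) \o Phi t \o chart_inv (chart_at p)) (chart_at p p) ->
    tangent_map (Phi t) p v = v;
  tame_invariant : forall f : M -> R,
    (forall x, X x != 0 -> differentiable (f \o chart_inv (chart_at x)) (chart_at x x)) ->
    (forall x, X x != 0 -> dform f x (X x) = 0) ->
    forall x t, X x != 0 -> f (Phi t x) = f x
}.

Variable X : vector_field M.
Hypothesis X1 : Ck_vector_field 1 X.

Lemma tame_regular Phi x t : tame_flow X Phi -> X x != 0 -> X (Phi t x) != 0.
Proof.
move=> tf; apply: contra_neq => X0.
have := tame_singular tf (- t) X0; rewrite -(tameD tf) subrr (tame0 tf) => ->.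
exact: X0.
Qed.

Lemma is_flow_tame Phi : is_flow X Phi -> tame_flow X Phi.
Proof.
move=> fl; split.
- move=> x; exact (flow0 fl x).
- move=> t s x; exact (flow_add X1 fl t s x).
- move=> t; exact (flow_continuous X1 fl (t := t)).
- move=> x t; exact (flow_time_continuous fl (t := t) (x := x)).
- move=> p t Xp; exact (flow_singular X1 fl t Xp).
- move=> p v t Xp Dv; apply: (flow_diff_singular X1 fl) => //.
  by rewrite deriveE//; have [+ _] := X1 (chart_at_atlas p); apply; exact/chart_codP/chart_at_dom.
- move=> f df Df x t Xx.
  have D (s : R) : is_derive s 1 (fun s => f (Phi s x)) 0.
    have [cg Dg] := flow_curve fl x s.
    have Xs : X (Phi s x) != 0 by exact: (flow_regular X1 fl s Xx).
    rewrite -(Df _ Xs); apply: (derive_comp_near (g := chart_at (Phi s x) \o Phi ^~ x) erefl Dg (df _ Xs)).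
    have : \forall u \near s, chart_dom (chart_at (Phi s x)) (Phi u x).
      apply: cg; apply: open_nbhs_nbhs; split; first exact: chart_dom_open.
      exact: chart_at_dom.
    by apply: filterS => u Du; rewrite /= chartK.
  by have := is_derive_0_is_cst t 0 D; rewrite /= (flow0 fl).
Qed.

Lemma identity_tame : tame_flow X (fun _ x => x).
Proof.
split=> //.
- by move=> t x; exact: cvg_id.
- by move=> x t; exact: cst_continuous.
- move=> p v t _ _ _; rewrite /tangent_map; apply: diff_near_id.
  have Cp := chart_codP (chart_at_dom p).
  apply: filterS (open_near (@chart_cod_open _ _ _ (chart_at p)) Cp) => y Cy.
  by rewrite /= chart_invKe.
Qed.

Lemma flow_tame : tame_flow X (flow X).
Proof.
have [[phi fl]|N] := pselect (exists phi, is_flow X phi).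
  have H : is_flow X (flow X).
    exact: (@xgetPex (R -> M -> M) (fun _ x => x) [set phi | is_flow X phi] (ex_intro _ phi fl)).
  exact: is_flow_tame H.
rewrite /flow xgetPN; first exact: identity_tame.
by move=> phi fl; apply: N; exists phi.
Qed.

End TameFlow.

(** * Local bounds in terms of the metric *)

Section RiemannianLocal.
Context {R : realType} {d : nat} {M : manifold R d}.
Variable g : riemannian_metric M.

Lemma ler_mx_entry m n (A : 'M[R]_(m, n)) i j : `|A i j| <= `|A|.
Proof. by rewrite [leRHS]/Num.Def.normr/= mx_normrE; exact: (le_bigmax _ _ (i, j)). Qed.

Lemma qformB n (A B : 'M[R]_n) u : qform (A - B) u = qform A u - qform B u.
Proof. by rewrite /qform mulmxBr mulmxBl !mxE. Qed.

Lemma chart_inv_near (c : chart R d M) x (P : M -> Prop) : chart_dom c x ->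
  (\forall z \near x, P z) -> \forall y \near c x, P (chart_inv c y).
Proof.
move=> Dx N; have N' : \forall z \near chart_inv c (c x), P z by rewrite chartK.
exact: (chart_inv_continuous_at (chart_codP Dx) N').
Qed.

Lemma dform_chart (f : M -> R) (c : chart R d M) x v : atlas c -> chart_dom c x ->
  differentiable (f \o chart_inv c) (c x) ->
  dform f x v = 'd (f \o chart_inv c) (c x) (to_chart c x v).
Proof.
move=> Ac Dx df; have Dx' := chart_at_dom x.
by have [_] := function_change_chart (chart_at_atlas x) Ac Dx' Dx df; apply.
Qed.

Let half_bound (a b s m : R) : m * s <= a -> - (m / 2 * s) <= a - b -> a - b <= m / 2 * s ->
  m / 2 * s <= b.
Proof. by lra. Qed.

(** Positive definiteness at x gives a bound in the chart, which survives with
    half the constant nearby because the Gram matrices vary continuously. *)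
Lemma riem_local_bound x : exists2 m : R, 0 < m & \forall z \near x, forall v,
  m * `|to_chart (chart_at x) z v| ^+ 2 <= qform (riem_mx g z) v.
Proof.
set c := chart_at x; have Dx : chart_dom c x by exact: chart_at_dom.
have Ac : atlas c by exact: chart_at_atlas.
pose H y := lin1_mx (of_chart c (chart_inv c y)) *m riem_mx g (chart_inv c y) *m
  (lin1_mx (of_chart c (chart_inv c y)))^T.
have QH z w : chart_dom c z -> qform (H (c z)) w = qform (riem_mx g z) (of_chart c z w).
  move=> Dz; rewrite /H chartK// /qform.
  have -> : of_chart c z w = w *m lin1_mx (of_chart c z).
    by rewrite /of_chart (mul_rV_lin1 ('d _ _)).
  by rewrite trmx_mul !mulmxA.
have oC := @chart_cod_open _ _ _ c.
have cH : {for c x, continuous H}.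
  exact: Ck_continuous oC (riem_smooth g Ac 0) (chart_codP Dx).
have [|m m0 Hm] := @qform_bound _ _ (H (c x)).
  move=> u u0; rewrite QH//; apply: riem_pos.
  by apply: contra_neq u0 => E; rewrite -(of_chartK u Ac Dx) E to_chart0.
exists (m / 2); first by rewrite divr_gt0.
pose e := m / (2 * (d%:R * d%:R + 1)).
have dd : (0 : R) < d%:R * d%:R + 1 by rewrite ltr_wpDl// mulr_ge0.
have e0 : 0 < e by rewrite divr_gt0// mulr_gt0.
have N1 : \forall y \near c x, `|H (c x) - H y| < e.
  by have := @cvgr_dist_lt _ _ _ _ _ H (H (c x)) cH; apply.
have N1' : \forall z \near x, `|H (c x) - H (c z)| < e by exact: (chart_continuous Dx N1).
have N2 : \forall z \near x, chart_dom c z.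
  by apply: open_nbhs_nbhs; split => //; exact: chart_dom_open.
have FF : Filter (nbhs x) by exact: nbhs_filter.
apply: filterS2 N1' N2 => z Hz Dz v.
set w := to_chart c z v.
have -> : qform (riem_mx g z) v = qform (H (c z)) w by rewrite QH// to_chartK.
have Hq := Hm w.
have : `|qform (H (c x) - H (c z)) w| <= m / 2 * `|w| ^+ 2.
  apply: (le_trans (qform_norm_le _ _)); rewrite ler_wpM2r ?sqr_ge0//.
  apply: (@le_trans _ _ (\sum_(i < d) \sum_(j < d) e)).
    by apply: ler_sum => i _; apply: ler_sum => j _; rewrite (le_trans (ler_mx_entry _ _ _))// ltW.
  rewrite !sumr_const card_ord -mulrnA -[leLHS]mulr_natl natrM.
  rewrite /e mulrA ler_pdivrMr ?mulr_gt0//.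
  have := mulr_ge0 (ler0n R d) (ler0n R d); nra.
rewrite qformB ler_norml => /andP[h h'].
exact: half_bound Hq h h'.
Qed.

End RiemannianLocal.

Section Regular.
Context {R : realType} {d : nat} {M : manifold R d}.
Variables (g : riemannian_metric M) (X : vector_field M).
Hypothesis Xd : Ck_vector_field d X.

Lemma regular_near x : X x != 0 -> \forall z \near x, X z != 0.
Proof.
move=> Xx; set c := chart_at x; have Dx : chart_dom c x by exact: chart_at_dom.
have Ac : atlas c by exact: chart_at_atlas.
have oU := regular_cod_open Xd Ac.
have N1 : \forall y \near c x, regular_cod X c y by apply: open_near => //; exact: regular_codP.
have N1' : \forall z \near x, regular_cod X c (c z) by exact: (chart_continuous Dx N1).
have N2 : \forall z \near x, chart_dom c z.
  by apply: open_nbhs_nbhs; split => //; exact: chart_dom_open.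
have FF : Filter (nbhs x) by exact: nbhs_filter.
apply: filterS2 N1' N2 => z [Cz Xz] Dz.
by rewrite (local_rep_eq0 X Ac Cz) chartK in Xz.
Qed.

Variable f : M -> R.
Hypothesis f1 : forall c, atlas c -> Ck 1 (regular_cod X c) (f \o chart_inv c).

Lemma regular_differentiable c x : atlas c -> chart_dom c x -> X x != 0 ->
  differentiable (f \o chart_inv c) (c x).
Proof. by move=> Ac Dx Xx; have [+ _] := f1 Ac; apply; exact: regular_codP. Qed.

(** Both the partial derivatives of f and the metric are locally comparable with
    the norm of the chart. *)
Lemma dform_local_bound x : X x != 0 -> exists2 C : R, 0 < C & \forall z \near x,
  forall v, `|dform f z v| <= C * riem_norm g z v.
Proof.
move=> Xx; set c := chart_at x; have Dx : chart_dom c x by exact: chart_at_dom.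
have Ac : atlas c by exact: chart_at_atlas.
have [m m0 Nm] := riem_local_bound g x; rewrite -/c in Nm.
have oU := regular_cod_open Xd Ac.
have [K K0 NK] := Ck1_partials_bounded oU (f1 Ac) (regular_codP Ac Dx Xx).
have NK' : \forall z \near x, \sum_j `|'D_('e_j) (f \o chart_inv c) (c z)| <= K.
  exact: (chart_continuous Dx NK).
have ND : \forall z \near x, chart_dom c z.
  by apply: open_nbhs_nbhs; split => //; exact: chart_dom_open.
have sm : 0 < Num.sqrt m by rewrite sqrtr_gt0.
exists (K / Num.sqrt m); first by rewrite divr_gt0.
have FF : Filter (nbhs x) by exact: nbhs_filter.
have N : \forall z \near x, chart_dom c z /\ X z != 0 /\ \sum_j `|'D_('e_j) (f \o chart_inv c) (c z)| <= K /\
   (forall v, m * `|to_chart c z v| ^+ 2 <= qform (riem_mx g z) v).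
  exact: (filterI ND (filterI (regular_near Xx) (filterI NK' Nm))).
apply: filterS N => z [Dz [Xz [Kz Hz]]] v.
have dfz := regular_differentiable Ac Dz Xz.
rewrite (dform_chart v Ac Dz dfz).
set w := to_chart c z v.
apply: (le_trans (diff_norm_le w dfz)).
apply: (@le_trans _ _ (K * `|w|)); first by rewrite ler_wpM2r.
rewrite -mulrA ler_wpM2l ?(ltW K0)// mulrC ler_pdivlMr//.
rewrite -ler_sqr ?nnegrE ?mulr_ge0 ?riem_norm_ge0 ?sqrtr_ge0// exprMn (sqr_sqrtr (ltW m0)) riem_norm_sqr mulrC.
exact: Hz.
Qed.

End Regular.

(** * Consequences of hyperbolicity *)

Section HyperbolicSingularity.
Context {R : realType} {d : nat} {M : manifold R d}.
Variables (g : riemannian_metric M) (X : vector_field M).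
Hypothesis X1 : Ck_vector_field 1 X.

Lemma directv_outer_capv (Es E0 Eu : {vspace 'rV[R]_d}) : directv (Es + E0 + Eu) -> (Es :&: Eu = 0)%VS.
Proof.
rewrite directv_addE => /and3P[_ _ /eqP H].
by apply/eqP; rewrite -subv0 -H capvS// addvSl.
Qed.

Lemma tangent_map_nondifferentiable t x v : ~ differentiable (chart_at (flow X t x) \o flow X t \o chart_inv (chart_at x)) (chart_at x x) ->
  tangent_map (flow X t) x v = 0.
Proof. exact: diff_nondifferentiable. Qed.

Lemma invariant_mem gamma E t x v : flow_invariant X gamma E -> gamma x -> v \in E x ->
  tangent_map (flow X t) x v \in E (flow X t x).
Proof.
move=> inv gx vE; have /predeqP/(_ (tangent_map (flow X t) x v))[+ _] := inv t x gx.
by apply; exists v.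
Qed.

(** The differential P of the flow fixes a + b and preserves two independent
    subspaces, hence fixes a; but it also contracts a. *)
Lemma singular_component p t Es Eu : X p = 0 ->
  flow_invariant X [set p] Es -> flow_invariant X [set p] Eu -> (Es p :&: Eu p = 0)%VS ->
  op_norm g p (flow X t p) (Es p) (tangent_map (flow X t) p) < 2^-1 ->
  forall a b, a \in Es p -> b \in Eu p -> 'd (local_rep (chart_at p) X) (chart_at p p) (a + b) = 0 ->
  a = 0.
Proof.
move=> Xp inv_s inv_u cap0 contr a b aE bE Dab.
have tf := flow_tame X1; have fp := tame_singular tf t Xp.
have [df|ndf] := pselect (differentiable (chart_at (flow X t p) \o flow X t \o chart_inv (chart_at p)) (chart_at p p)).
  have Pab := tame_diff_singular tf Xp Dab df.
  pose P : {linear 'rV[R]_d -> 'rV[R]_d} := 'd (chart_at (flow X t p) \o flow X t \o chart_inv (chart_at p)) (chart_at p p).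
  have PabE : P a + P b = a + b by rewrite -(linearD P); exact: Pab.
  have Pa : P a \in Es p by have := invariant_mem t inv_s (erefl p) aE; rewrite fp.
  have Pb : P b \in Eu p by have := invariant_mem t inv_u (erefl p) bE; rewrite fp.
  have E : P a - a = b - P b.
    by apply/eqP; rewrite subr_eq addrAC [b + a]addrC -PabE addrK.
  have : P a - a \in (Es p :&: Eu p)%VS by rewrite memv_cap {2}E !memvB.
  rewrite cap0 memv0 subr_eq0 => /eqP Paa.
  have := op_norm_contracts (A := P) contr aE; rewrite fp Paa => H.
  apply: (riem_norm_eq0 (g := g) (x := p)); apply/eqP; rewrite eq_le riem_norm_ge0 andbT.
  by move: H; lra.
have /predeqP/(_ a)[_] := inv_s t p erefl; rewrite fp => /(_ aE)[v _ <-].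
exact: tangent_map_nondifferentiable.
Qed.

(** A vector in the kernel of the linear part of X is fixed by the differentials
    of the flow at all times, whereas its stable and unstable components are
    contracted in the future and in the past. *)
Lemma hyperbolic_singularity_nondegenerate p : X p = 0 -> hyperbolic g X [set p] ->
  forall v, 'd (local_rep (chart_at p) X) (chart_at p p) v = 0 -> v = 0.
Proof.
move=> Xp [Es [Eu [_ [inv_s inv_u] split [T T0 contr]]]] v Dv.
have [full dir] := split p erefl; have [cs cu] := contr p erefl.
have cap0 := directv_outer_capv dir.
have : v \in (Es p + <[X p]> + Eu p)%VS by rewrite full memvf.
move=> /memv_addP[w /memv_addP[a aE [z /vlineP[k ->] ->]] [b bE vE]].
rewrite Xp scaler0 addr0 in vE.
have a0 : a = 0.
  by apply: (singular_component Xp inv_s inv_u cap0 cs aE bE); rewrite -vE.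
have b0 : b = 0.
  by apply: (singular_component Xp inv_u inv_s _ cu bE aE); [rewrite capvC|rewrite addrC -vE].
by rewrite vE a0 b0 addr0.
Qed.

End HyperbolicSingularity.

Section HyperbolicOrbit.
Context {R : realType} {d : nat} {M : manifold R d}.
Variables (g : riemannian_metric M) (X : vector_field M).
Hypotheses (X1 : Ck_vector_field 1 X) (Xd : Ck_vector_field d X).
Variable f : M -> R.
Hypothesis f1 : forall c, atlas c -> Ck 1 (regular_cod X c) (f \o chart_inv c).
Hypothesis dfX : forall x, X x != 0 -> dform f x (X x) = 0.

Lemma flow_preserves t x : X x != 0 -> f (flow X t x) = f x.
Proof.
apply: (tame_invariant (flow_tame X1) _ dfX) => z Xz.
by apply: (regular_differentiable f1) => //; [exact: chart_at_atlas|exact: chart_at_dom].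
Qed.

Lemma dform_invariant t x v : X x != 0 ->
  differentiable (chart_at (flow X t x) \o flow X t \o chart_inv (chart_at x)) (chart_at x x) ->
  dform f (flow X t x) (tangent_map (flow X t) x v) = dform f x v.
Proof.
move=> Xx dP; have tf := flow_tame X1.
have Xy := tame_regular t tf Xx; set y := flow X t x in dP Xy *.
set c := chart_at x; set c' := chart_at y.
have Dx : chart_dom c x by exact: chart_at_dom.
have dfy : differentiable (f \o chart_inv c') (c' y).
  by apply: (regular_differentiable f1) => //; [exact: chart_at_atlas|exact: chart_at_dom].
have E : (c' \o flow X t \o chart_inv c) (c x) = c' y by rewrite /= chartK.
have N : \forall z \near c x, (f \o chart_inv c') ((c' \o flow X t \o chart_inv c) z) = (f \o chart_inv c) z.
  have N1 : \forall z \near c x, X (chart_inv c z) != 0.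
    exact: (chart_inv_near Dx (regular_near Xd Xx)).
  have ND : \forall z \near y, chart_dom c' z.
    by apply: open_nbhs_nbhs; split; [exact: chart_dom_open|exact: chart_at_dom].
  have N2 : \forall z \near x, chart_dom c' (flow X t z) by exact: (tame_continuous (t := t) tf (x := x) ND).
  have N3 : \forall z \near c x, chart_dom c' (flow X t (chart_inv c z)).
    exact: (chart_inv_near Dx N2).
  by apply: filterS2 N1 N3 => z Xz Dz; rewrite /= chartK// flow_preserves.
have [_ H] := diff_comp_near E dP dfy N.
by have := H v => /esym.
Qed.

(** The form df is invariant under the flow. On a vector v of E it takes the
    value that it takes on the images of v under the iterated tangent map,
    which tend to 0 while df stays bounded along gamma. *)
Lemma contracted_dform0 gamma E t (C : R) : (forall x, gamma x -> X x != 0) ->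
  (forall x, gamma x -> gamma (flow X t x)) -> flow_invariant X gamma E ->
  (forall x v, gamma x -> `|dform f x v| <= C * riem_norm g x v) ->
  (forall x, gamma x -> op_norm g x (flow X t x) (E x) (tangent_map (flow X t) x) < 2^-1) ->
  forall x v, gamma x -> v \in E x -> dform f x v = 0.
Proof.
move=> reg stab inv bnd contr.
have tf := flow_tame X1.
have step x v : gamma x -> v \in E x -> v = 0 \/ exists w,
    [/\ w \in E (flow X t x), riem_norm g (flow X t x) w <= 2^-1 * riem_norm g x v &
    dform f (flow X t x) w = dform f x v].
  move=> gx vE.
  have [df|ndf] := pselect (differentiable (chart_at (flow X t x) \o flow X t \o chart_inv (chart_at x)) (chart_at x x)).
    right; exists (tangent_map (flow X t) x v); split; first exact: invariant_mem inv gx vE.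
      exact: (op_norm_contracts (A := 'd (chart_at (flow X t x) \o flow X t \o chart_inv (chart_at x)) (chart_at x x))) (contr x gx) v vE.
    exact: dform_invariant (reg x gx) df.
  left; have E0 w : w \in E (flow X t x) -> w = 0.
    move=> wE; have /predeqP/(_ w)[_ /(_ wE)[u _ <-]] := inv t x gx.
    exact: tangent_map_nondifferentiable.
  have back : flow X (- t) (flow X t x) = x by rewrite -(tameD tf) subrr (tame0 tf).
  have /predeqP/(_ v)[_] := inv (- t) _ (stab x gx); rewrite back => /(_ vE)[w /E0 -> <-].
  exact: (linear0 ('d _ _)).
have iter n : forall x v, gamma x -> v \in E x -> `|dform f x v| <= 2^-1 ^+ n * (C * riem_norm g x v).
  elim: n => [x v gx vE|n IH x v gx vE]; first by rewrite expr0 mul1r bnd.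
  have [->|[w [wE wv <-]]] := step x v gx vE.
    rewrite /dform (linear0 ('d _ _)) normr0 mulr_ge0 ?exprn_ge0 ?invr_ge0//.
    by have := bnd x 0 gx; apply: le_trans.
  apply: (le_trans (IH _ _ (stab x gx) wE)); rewrite exprSr -mulrA ler_wpM2l ?exprn_ge0 ?invr_ge0//.
  have [C0|C0] := leP 0 C; first by rewrite [leRHS]mulrCA ler_wpM2l.
  have nz := riem_norm_ge0 g x v; have nw := riem_norm_ge0 g (flow X t x) w.
  have := le_trans (normr_ge0 _) (bnd x v gx); have := le_trans (normr_ge0 _) (bnd _ w (stab x gx)).
  by nra.
move=> x v gx vE; apply/eqP; rewrite -normr_le0.
have cv : (fun n => 2^-1 ^+ n * (C * riem_norm g x v)) @ \oo --> (0 : R).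
  rewrite -[X in _ --> X](mul0r (C * riem_norm g x v)).
  apply: cvgM; last exact: cvg_cst.
  apply: cvg_expr.
  by rewrite ger0_norm ?invr_ge0// invf_lt1// ltr1n.
have := limr_ge (cvgP _ cv) (nearW _ (fun n => iter n x v gx vE)).
by rewrite (cvg_lim (@norm_hausdorff _ _) cv); exact.
Qed.

End HyperbolicOrbit.

Section PeriodicPoints.
Context {R : realType} {d : nat} {M : manifold R d}.
Variables (g : riemannian_metric M) (X : vector_field M).
Hypotheses (X1 : Ck_vector_field 1 X) (Xd : Ck_vector_field d X).

(** The orbit is already covered by the times in [0, T]. *)
Lemma periodic_orbit_compact T p : 0 < T -> flow X T p = p -> compact (orbit_of X p).
Proof.
move=> T0 Tp; have tf := flow_tame X1.
have nat_period n : flow X (T *+ n) p = p.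
  by elim: n => [|n IH]; rewrite ?mulr0n ?(tame0 tf)// mulrS (tameD tf) Tp.
have int_period (k : int) : flow X (T *~ k) p = p.
  case: k => n; first exact: nat_period.
  rewrite NegzE mulrNz -pmulrn -{1}(nat_period n.+1) -(tameD tf).
  by rewrite subrr (tame0 tf).
suff -> : orbit_of X p = (fun t => flow X t p) @` `[0, T].
  apply: continuous_compact; last exact: segment_compact.
  by apply: continuous_subspaceT => t; exact: (tame_time_continuous tf (x := p) (x0 := t)).
apply/seteqP; split=> [_ [t _ <-]|_ [t _ <-]]; last by exists t.
pose k := Num.floor (t / T); pose r := t - T *~ k.
exists r; last by rewrite -[in LHS](int_period k) -(tameD tf) addrC subrK.
rewrite /= in_itv /= /r -[T *~ k]mulrzr subr_ge0 mulrC -ler_pdivlMr// floor_le/=.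
rewrite -[leRHS]mul1r lerBlDr -mulrDl -ler_pdivrMr// addrC -[1 in leRHS]/(1%:~R) -intrD.
exact: (ltW (floorD1_gt _)).
Qed.

Variable f : M -> R.
Hypothesis f1 : forall c, atlas c -> Ck 1 (regular_cod X c) (f \o chart_inv c).
Hypothesis dfX : forall x, X x != 0 -> dform f x (X x) = 0.

Let linear_form_vanishes (V : normedModType R) (D : {linear V -> R}) a k x b :
  D a = 0 -> D x = 0 -> D b = 0 -> D (a + k *: x + b) = 0.
Proof. by move=> Da Dx Db; rewrite !linearD linear_formZ Da Dx Db mulr0 !addr0. Qed.

Lemma dform_bounded gamma : compact gamma -> (forall x, gamma x -> X x != 0) ->
  exists C : R, forall x v, gamma x -> `|dform f x v| <= C * riem_norm g x v.
Proof.
move=> /compact_near_coveringP cg reg.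
have H := cg R (pinfty_nbhs R) (fun C x => forall v, `|dform f x v| <= C * riem_norm g x v) (@filter_filter R _ (@proper_pinfty_nbhs R)).
have {}H : \forall C \near pinfty_nbhs R, forall x, gamma x -> forall v, `|dform f x v| <= C * riem_norm g x v.
  apply: H => x gx; have [C C0 N] := dform_local_bound g Xd f1 (reg x gx).
  exists ([set z | forall v, `|dform f z v| <= C * riem_norm g z v], [set K | C < K]) => /=.
    by split=> //; exists C; split => //; exact: num_real.
  move=> [z K] [/= Hz CK] v; apply: (le_trans (Hz v)).
  by rewrite ler_wpM2r ?riem_norm_ge0// ltW.
have [C HC] := filter_ex H.
by exists C => x v gx; exact: HC.
Qed.

(** The form df vanishes on the stable and on the unstable directions because
    they are contracted, and on X because f is constant along orbits. *)
Lemma periodic_dform0 p : X p != 0 -> periodic_points X p -> hyperbolic g X (orbit_of X p) ->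
  forall v, dform f p v = 0.
Proof.
move=> Xp [T0 T0gt Tp] [Es [Eu [_ [inv_s inv_u] split [T Tgt contr]]]] v.
have tf := flow_tame X1.
have reg x : orbit_of X p x -> X x != 0 by move=> [t _ <-]; exact: tame_regular.
have stab t x : orbit_of X p x -> orbit_of X p (flow X t x).
  by move=> [s _ <-]; exists (s + t) => //; rewrite (tameD tf).
have op : orbit_of X p p by exists 0 => //; exact: (tame0 tf).
have [C HC] := dform_bounded (periodic_orbit_compact T0gt Tp) reg.
have Ks := contracted_dform0 X1 Xd f1 dfX reg (stab T) inv_s HC (fun x gx => (contr x gx).1).
have Ku := contracted_dform0 X1 Xd f1 dfX reg (stab (- T)) inv_u HC (fun x gx => (contr x gx).2).
have [full _] := split p op.
have : v \in (Es p + <[X p]> + Eu p)%VS by rewrite full memvf.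
move=> /memv_addP[w /memv_addP[a aE [z /vlineP[k ->] ->]] [b bE ->]].
exact: (linear_form_vanishes (D := 'd _ _) k (Ks _ _ op aE) (dfX Xp) (Ku _ _ op bE)).
Qed.

(** The partial derivatives of f are continuous on the regular part. *)
Lemma closure_dform0 (P : set M) y : X y != 0 -> closure P y ->
  (forall p, P p -> X p != 0 -> forall v, dform f p v = 0) ->
  forall c, atlas c -> chart_dom c y -> forall i, 'D_('e_i) (f \o chart_inv c) (c y) = 0.
Proof.
move=> Xy cl P0 c Ac Dy i.
have oU := regular_cod_open Xd Ac.
have [_ /(_ 'e_i) D0] := f1 Ac.
have cD := Ck_continuous (k := 0) oU D0 (regular_codP Ac Dy Xy).
apply/eqP; rewrite -normr_le0; apply/ler_addgt0Pr => e e0; rewrite add0r.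
have N1 : \forall z \near c y, `|'D_('e_i) (f \o chart_inv c) (c y) - 'D_('e_i) (f \o chart_inv c) z| < e.
  by have := @cvgr_dist_lt _ _ _ _ _ _ _ cD; apply.
have N1' : nbhs y [set z | `|'D_('e_i) (f \o chart_inv c) (c y) - 'D_('e_i) (f \o chart_inv c) (c z)| < e].
  exact: (chart_continuous Dy N1).
have N2 : nbhs y (chart_dom c).
  by apply: open_nbhs_nbhs; split => //; exact: chart_dom_open.
have N3 : nbhs y [set z | X z != 0] by exact: (regular_near Xd Xy).
have [z [Pz [Hz [Dz Xz]]]] := cl _ (filterI N1' (filterI N2 N3)).
have dz := regular_differentiable f1 Ac Dz Xz.
have Z : 'D_('e_i) (f \o chart_inv c) (c z) = 0.
  rewrite (deriveE _ dz) -[X in 'd _ _ X](of_chartK _ Ac Dz) -(dform_chart _ Ac Dz dz).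
  exact: P0.
by move: Hz; rewrite /= Z subr0 => /ltW.
Qed.

End PeriodicPoints.

(** * Limit points and critical values *)

Section LimitSets.
Context {R : realType} {d : nat} {M : manifold R d}.
Variable X : vector_field M.
Hypothesis X1 : Ck_vector_field 1 X.
Hypothesis Mcompact : compact [set: M].

(** Any limit point of the sequence of the images of x at integer times will do:
    a neighbourhood of it is visited at arbitrarily late times, and f is
    constant along the orbit of x. *)
Lemma omega_limit (f : M -> R) x : continuous f -> (forall t, f (flow X t x) = f x) ->
  exists2 y, nonwandering_set X y & f y = f x.
Proof.
move=> cf fx; have tf := flow_tame X1.
have [|y [_ cy]] := Mcompact (F := (fun n : nat => flow X n%:R x) @ \oo).
  exact: filterT.
exists y.
  move=> U oU Uy T T0; have nU : nbhs y U by exact: open_nbhs_nbhs.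
  have A1 : ((fun n : nat => flow X n%:R x) @ \oo) (range (fun n : nat => flow X n%:R x)).
    by exists 0%N => // n _; exists n.
  have [_ [[n _ <-] Un]] := cy _ _ A1 nU.
  pose late := [set z | exists2 m : nat, T + n%:R < m%:R & z = flow X m%:R x].
  have A2 : ((fun n : nat => flow X n%:R x) @ \oo) late.
    by apply: filterS (nbhs_infty_gtr (T + n%:R)) => m Hm; exists m.
  have [_ [[m Hm ->] Um]] := cy _ _ A2 nU.
  exists (m%:R - n%:R); first by rewrite ltrBrDr.
  exists (flow X m%:R x); split => //; exists (flow X n%:R x) => //.
  by rewrite -(tameD tf) addrC subrK.
apply/eqP; apply: contrapT => /negP ne.
have e0 : 0 < `|f y - f x| by rewrite normr_gt0 subr_eq0.
have N : nbhs y [set z | `|f y - f z| < `|f y - f x|].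
  by have := @cvgr_dist_lt _ _ _ _ _ f (f y) (cf y); apply.
have A : ((fun n : nat => flow X n%:R x) @ \oo) [set z | f z = f x].
  by exists 0%N => // n _; exact: fx.
by have [z [/= -> ]] := cy _ _ A N; rewrite ltxx.
Qed.

End LimitSets.

Section CriticalValues.
Context {R : realType}.

Lemma sigma_ideal_second_countable (T : topologicalType) (N : set (set T)) (A : set T) :
  @second_countable T -> sigma_ideal N ->
  (forall a, A a -> exists2 V, nbhs a V & N (A `&` V)) -> N A.
Proof.
move=> [B /countable_injP[h injh] [oB basisB]] [N0 NS NU] H.
pose F k := \bigcup_(V in [set V | [/\ B V, h V = k & N (A `&` V)]]) (A `&` V).
apply: (NS _ (\bigcup_k F k)).
  move=> a Aa; have [V nV NV] := H a Aa; have [W [BW Wa] WV] := basisB a V nV.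
  exists (h W) => //; exists W => //; split=> //.
  by apply: NS NV; exact: setIS.
apply: NU => k.
have [[V [BV hV NV]]|nE] := pselect (exists V, [/\ B V, h V = k & N (A `&` V)]).
  apply: NS NV => a [W [BW hW _]].
  by rewrite (injh W V _ _ (etrans hW (esym hV)))//; exact/mem_set.
by apply: NS N0 => a [W HW]; case: nE; exists W.
Qed.

Context {d : nat} {M : manifold R d}.
Variable X : vector_field M.
Hypotheses (d_gt0 : (0 < d)%N) (Xd : Ck_vector_field d X).
Variable f : M -> R.
Hypothesis fd : forall c, atlas c -> Ck d (regular_cod X c) (f \o chart_inv c).

Definition singular_or_critical := [set x | X x = 0 \/ X x != 0 /\
  forall c, atlas c -> chart_dom c x -> forall i, 'D_('e_i) (f \o chart_inv c) (c x) = 0].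

(** Around each point there is at most one zero of X, and the critical points
    are handled by Sard's theorem in a chart. *)
Lemma singular_or_critical_values : (forall p, X p = 0 -> \forall z \near p, z != p -> X z != 0) ->
  (@lebesgue_measure R).-negligible (f @` singular_or_critical).
Proof.
move=> iso.
apply: (sigma_ideal_second_countable (manifold_second_countable M) (sigma_ideal_negligible_image f)).
move=> x _; set c := chart_at x.
have Dx : chart_dom c x by exact: chart_at_dom.
have Ac : atlas c by exact: chart_at_atlas.
have ND : \forall z \near x, chart_dom c z.
  by apply: open_nbhs_nbhs; split => //; exact: chart_dom_open.
have Nx : \forall z \near x, z != x -> X z != 0.
  have [Xx|Xx] := eqVneq (X x) 0; first exact: iso.
  have FF : Filter (nbhs x) by exact: nbhs_filter.
  by apply: filterS (regular_near Xd Xx).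
exists [set z | chart_dom c z /\ (z != x -> X z != 0)]; first exact: filterI ND Nx.
pose A := [set y | regular_cod X c y /\ forall i, 'D_('e_i) (f \o chart_inv c) y = 0].
have S := sard d_gt0 (regular_cod_open Xd Ac) (fun y (Ay : A y) => Ay.1) (fd Ac)
  (fun y i (Ay : A y) => Ay.2 i).
have Nfx : (@lebesgue_measure R).-negligible [set f x].
  by exists [set f x]; split => //; exact: lebesgue_measure_set1.
apply: (negligibleS _ (negligibleU Nfx S)).
move=> _ [z [[Xz|[Xz crit]] [Dz iz]] <-].
  left; rewrite /=; have [->//|zx] := eqVneq z x.
  by have := iz zx; rewrite Xz eqxx.
right; exists (c z); last by rewrite /= chartK.
by split; [exact: regular_codP|exact: crit].
Qed.

End CriticalValues.

Section ConnectedValues.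
Context {R : realType}.

(** A connected range with two values contains an interval. *)
Lemma negligible_range_constant (T : topologicalType) (f : T -> R) : connected [set: T] ->
  continuous f -> (@lebesgue_measure R).-negligible (range f) -> forall x y, f x = f y.
Proof.
move=> cT cf N.
have I : is_interval (range f).
  by apply/connected_intervalP/connected_continuous_connected => //; exact: continuous_subspaceT.
have H x y : f x < f y -> False.
  move=> xy; apply: (negligible_interval xy N) => z /=; rewrite in_itv /= => /andP[xz zy].
  by apply: (I (f x) (f y)); [exists x|exists y|rewrite xz].
by move=> x y; have [/H|/H|] := ltgtP (f x) (f y).
Qed.

End ConnectedValues.

(** * Triviality of the centralizer *)

Section Multiples.
Context {R : realType}.

Lemma derive_multiple (V W : normedModType R) (F : V -> W) q v k : differentiable F q ->
  'D_v (fun x => k *: F x) q = 'D_(k *: v) F q.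
Proof.
move=> dF; have -> : (fun x => k *: F x) = k *: F by rewrite funeqE.
rewrite deriveZ; last exact: diff_derivable.
by rewrite !deriveE// linearZ.
Qed.

Context {d : nat} {M : manifold R d}.

Lemma multiple_in_centralizer (X : vector_field M) (k : R) : (0 < d)%N -> Ck_vector_field d X ->
  centralizer d X (fun x => k *: X x).
Proof.
move=> d_gt0 Xd.
have E c : local_rep c (fun x => k *: X x) = fun y => k *: local_rep c X y.
  by rewrite funeqE => y; exact: (linearZZ ('d _ _)).
split=> [c Ac|x]; first by rewrite E; exact: CkZ (@chart_cod_open _ _ _ c) (Xd c Ac).
have Ac := chart_at_atlas x; have oC := @chart_cod_open _ _ _ (chart_at x).
rewrite /lie_bracket E derive_multiple ?subrr//.
by have [+ _] := Ck_le oC d_gt0 (Xd _ Ac); apply; exact: chart_codP (chart_at_dom x).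
Qed.

End Multiples.

Section TrivialCentralizer.
Context {R : realType} {d : nat} {M : manifold R d}.
Variables (g : riemannian_metric M) (X Y : vector_field M).
Hypotheses (d_gt0 : (0 < d)%N) (Xd : Ck_vector_field d X) (Yd : Ck_vector_field d Y).
Hypotheses (Mcompact : compact [set: M]) (Mconnected : connected [set: M]).
Hypothesis Xhyp : forall gamma, singularity_or_periodic_orbit X gamma -> hyperbolic g X gamma.
Hypothesis XOmega : nonwandering_set X = closure (periodic_points X).
Hypothesis bracket0 : forall x, lie_bracket X Y x = 0.
Hypothesis collinear : forall x, (\dim <<[:: X x; Y x]>>%VS <= 1)%N.

Let f := quotient X Y.

Let X1 : Ck_vector_field 1 X.
Proof. by move=> c Ac; exact: Ck_le (@chart_cod_open _ _ _ c) d_gt0 (Xd Ac). Qed.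

Let fd c : atlas c -> Ck d (regular_cod X c) (f \o chart_inv c).
Proof. exact: quotient_Ck. Qed.

Let f1 c : atlas c -> Ck 1 (regular_cod X c) (f \o chart_inv c).
Proof. by move=> Ac; exact: Ck_le (regular_cod_open Xd Ac) d_gt0 (fd Ac). Qed.

Let dfX x : X x != 0 -> dform f x (X x) = 0.
Proof. exact: dform_field. Qed.

Let nondegenerate p : X p = 0 ->
  forall v, 'd (local_rep (chart_at p) X) (chart_at p p) v = 0 -> v = 0.
Proof.
move=> Xp; apply: (hyperbolic_singularity_nondegenerate (g := g) X1 Xp).
by apply: Xhyp; left; exists p.
Qed.

Let f_continuous : continuous f.
Proof.
move=> x; have [Xx|Xx] := eqVneq (X x) 0.
  exact: quotient_continuous_singular (nondegenerate Xx).
exact: quotient_continuous_regular.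
Qed.

(** A regular point shares its value with a limit point y of its orbit. As y is
    non-wandering, it is a limit of periodic points, at which df vanishes if
    they are regular; so y is either a zero of X or a critical point of f. *)
Lemma quotient_value x : exists2 y, singular_or_critical X f y & f y = f x.
Proof.
have [Xx|Xx] := eqVneq (X x) 0; first by exists x => //; left.
have [y Oy fy] := omega_limit X1 Mcompact f_continuous
  (fun t => flow_preserves X1 f1 dfX t Xx).
exists y => //; have [Xy|Xy] := eqVneq (X y) 0; [by left|right; split=> //].
rewrite XOmega in Oy.
apply: (closure_dform0 Xd f1 Xy Oy) => p Pp Xp.
by apply: (periodic_dform0 (g := g) X1 Xd f1 dfX Xp Pp); apply: Xhyp; right; exists p.
Qed.

Lemma quotient_constant x y : f x = f y.
Proof.
apply: negligible_range_constant => //.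
have iso p : X p = 0 -> \forall z \near p, z != p -> X z != 0.
  by move=> Xp; exact: (singularity_isolated d_gt0 Xd Xp (nondegenerate Xp)).
apply: negligibleS (singular_or_critical_values d_gt0 Xd fd iso).
by move=> _ [z _ <-]; have [w Cw <-] := quotient_value z; exists w.
Qed.

Lemma collinear_commuting_multiple : exists c, Y = fun x => c *: X x.
Proof.
have [[x0 _]|E] := pselect ([set: M] !=set0); last first.
  by exists 0; rewrite funeqE => x; case: E; exists x.
exists (f x0); rewrite funeqE => x; rewrite (quotient_constant x0 x).
have [Xx|Xx] := eqVneq (X x) 0; last exact: quotientE.
by rewrite Xx scaler0 (commuting_field_singular d_gt0 Xd bracket0 Xx (nondegenerate Xx)).
Qed.

End TrivialCentralizer.

Theorem theoremG (R : realType) (d : nat) (hd : (1 <= d)%N)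
    (M : manifold R d) (g : riemannian_metric M)
    (Mcompact : compact [set: M]) (Mconnected : connected [set: M])
    (X : vector_field M) (XCd : Ck_vector_field d X)
    (Xhyp : forall gamma : set M,
      singularity_or_periodic_orbit X gamma -> hyperbolic g X gamma)
    (XOmega : nonwandering_set X = closure (periodic_points X))
    (Xcol : collinear_centralizer d X) :
  centralizer d X = [set Y : vector_field M | exists c : R, Y = fun x => c *: X x].
Proof.
apply/seteqP; split=> [Y CY|_ [c ->]]; last exact: multiple_in_centralizer.
have [Yd bracket0] := CY.
exact: (collinear_commuting_multiple hd XCd Yd Mcompact Mconnected Xhyp XOmega bracket0 (Xcol Y CY)).
Qed.
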